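(* Let $\nu>-1$ and $\delta>0$. Let $F:\mathbb{C}\to\mathbb{C}$ be an entire function of exponential type at most $\delta$ such that $F\in L^p(\mathbb{R},|E_\nu(x)|^{-2}\,dx)$ for some $1\le p\le\infty$. Then $F'$ has exponential type at most $\delta$ and belongs to $L^p(\mathbb{R},|E_\nu(x)|^{-2}\,dx)$.
   Context: An entire function $F$, not identically zero, has exponential type at most $\delta$ if $\limsup_{|z|\to\infty}|z|^{-1}\log|F(z)|\le\delta$; the zero function is regarded as having exponential type at most $\delta$. For $\nu>-1$, $$A_\nu(z)=\sum_{n\ge0}\frac{(-1)^n(z/2)^{2n}}{n!(\nu+1)\cdots(\nu+n)},\qquad B_\nu(z)=\sum_{n\ge0}\frac{(-1)^n(z/2)^{2n+1}}{n!(\nu+1)\cdots(\nu+n+1)},\qquad E_\nu(z)=A_\nu(z)-iB_\nu(z).$$ $A_\nu$, $B_\nu$ are real on $\mathbb{R}$ and $E_\nu$ has no real zeros. *)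

(* Defs.v *)
From HB Require Import structures.
From mathcomp Require Import all_boot all_order all_algebra.
From mathcomp Require Import all_classical all_reals all_analysis.
From mathcomp Require Import measurable_realfun complex lra.

Set Implicit Arguments.
Unset Strict Implicit.
Unset Printing Implicit Defensive.

Import Order.TTheory GRing.Theory Num.Theory.
Import numFieldTopology.Exports numFieldNormedType.Exports.
Import ComplexField.Normc.

Local Open Scope classical_set_scope.
Local Open Scope ring_scope.
Local Open Scope complex_scope.

(* gives R[i] the topology of its modulus, as a normed space over itself *)
HB.instance Definition _ (R : realType) := NormedModule.copy R[i] R[i]^o.

Definition entire (R : realType) (F : R[i] -> R[i]) :=
  forall z : R[i], derivable F z 1.

(* the filter of |z| -> +oo *)
Definition cinfty_nbhs (R : realType) : set_system R[i] :=
  filter_from [set: R] (fun r => [set z | r < normc z]).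
Arguments cinfty_nbhs R : clear implicits.

(* lne 0 = -oo, so zeros of F do not affect the limit superior *)
Definition exp_type_le (R : realType) (delta : R) (F : R[i] -> R[i]) :=
  entire F /\
  ((forall z, F z = 0) \/
   (limf_esup (fun z => (normc z)^-1%:E * lne (normc (F z))%:E) (cinfty_nbhs R)
      <= delta%:E)%E).

Definition A_ (R : realType) (nu : R) (z : R[i]) : R[i] :=
  limn (series (fun n => (-1) ^+ n * (z / 2) ^+ (2 * n) /
    (n`!%:R * \prod_(1 <= k < n.+1) (nu + k%:R))%:C)).

Definition B_ (R : realType) (nu : R) (z : R[i]) : R[i] :=
  limn (series (fun n => (-1) ^+ n * (z / 2) ^+ (2 * n).+1 /
    (n`!%:R * \prod_(1 <= k < n.+2) (nu + k%:R))%:C)).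

Definition E_ (R : realType) (nu : R) (z : R[i]) : R[i] :=
  A_ nu z - 'i * B_ nu z.

Lemma prod_shift_gt0 (R : realType) (nu : R) (m : nat) : -1 < nu ->
  0 < \prod_(1 <= k < m.+1) (nu + k%:R).
Proof.
move=> nu1; rewrite big_add1 /= big_mkord; apply: prodr_gt0 => i _.
have : (1 : R) <= i.+1%:R by rewrite ler1n.
lra.
Qed.

Lemma prod_shift_inv_le (R : realType) (nu : R) (m : nat) : -1 < nu ->
  (\prod_(1 <= k < m.+1) (nu + k%:R))^-1 <= 1 + (nu + 1)^-1.
Proof.
move=> nu1; have nu0 : 0 < nu + 1 by lra.
case: m => [|m]; first by rewrite big_geq// invr1 lerDl invr_ge0 ltW.
rewrite big_nat_recl//= invfM.
have ge1 : 1 <= \prod_(1 <= i < m.+1) (nu + i.+1%:R).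
  rewrite big_add1 /= big_mkord; elim/big_ind : _ => // [x y x1 y1|i _].
    by rewrite mulr_ege1.
  have : (2 : R) <= i.+2%:R by rewrite ler_nat.
  lra.
rewrite (@le_trans _ _ (nu + 1)^-1) ?lerDr//.
by rewrite ler_piMr// ?invr_ge0 ?(ltW nu0)// invf_le1// (lt_le_trans ltr01).
Qed.

(* terms of the real series of A_ (j = 0) and B_ (j = 1) at a real point x *)
Definition Eterm (R : realType) (j : nat) (nu x : R) (n : nat) : R :=
  (-1) ^+ n * (x / 2) ^+ (2 * n + j) /
  (n`!%:R * \prod_(1 <= k < (n + j).+1) (nu + k%:R)).

Lemma is_cvg_Eterm (R : realType) (j : nat) (nu x : R) : -1 < nu ->
  cvgn (series (Eterm j nu x)).
Proof.
move=> nu1; apply: normed_cvg.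
pose C := `|x / 2| ^+ j * (1 + (nu + 1)^-1).
have nu0 : 0 < nu + 1 by lra.
have C0 : 0 <= C.
  by rewrite mulr_ge0// ?exprn_ge0// addr_ge0// invr_ge0 ltW.
apply: (@series_le_cvg _ _ (C *: exp_coeff (`|x / 2| ^+ 2))) => [n|n|n|].
- exact: normr_ge0.
- by apply: mulr_ge0 => //; rewrite exp_coeff_ge0// exprn_ge0.
- rewrite /= /Eterm normrM normrM normrX normrN1 expr1n mul1r normfV.
  have P0 := @prod_shift_gt0 _ nu (n + j) nu1.
  rewrite (@ger0_norm _ (_ * _)); last by rewrite mulr_ge0// ltW.
  rewrite /= /exp_coeff /= -[X in _ <= X]/(C * _) normrX exprD exprM invfM /C.
  set a := (`|_| ^+ 2) ^+ n; set b := `|_| ^+ j.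
  rewrite mulrACA mulrC; apply: ler_pM.
  + by rewrite mulr_ge0// ?exprn_ge0// invr_ge0 ltW.
  + by rewrite divr_ge0// !exprn_ge0.
  + by rewrite ler_wpM2l ?exprn_ge0// prod_shift_inv_le.
  + by [].
- by apply: is_cvg_seriesZ; exact: is_cvg_series_exp_coeff.
Qed.

Lemma measurable_Eseries (R : realType) (j : nat) (nu : R) : -1 < nu ->
  measurable_fun [set: R] (fun x => limn (series (Eterm j nu x))).
Proof.
move=> nu1.
apply: (@measurable_fun_cvg _ _ _ _ (fun n x => series (Eterm j nu x) n)).
  move=> n; apply: measurable_sum => i.
  apply: measurable_funM => //; apply: measurable_funM => //.
  by apply: measurable_funX; apply: measurable_funM.
by move=> x _; exact: is_cvg_Eterm.
Qed.

Lemma cvg_real_complex (R : realType) (u : R^nat) (l : R) :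
  u @ \oo --> l -> (fun n => (u n)%:C) @ \oo --> l%:C.
Proof.
move=> ul; apply/cvgrPdist_lt => /= -[e e'];
  rewrite ltcE => /andP[/eqP /= -> e0].
have /cvgrPdist_lt /(_ e e0) := ul.
apply: filterS => n ln.
by rewrite -rmorphB normc_def /= ltcR expr0n addr0 sqrtr_sqr.
Qed.

Lemma A_real (R : realType) (nu x : R) : -1 < nu ->
  A_ nu x%:C = (limn (series (Eterm 0 nu x)))%:C.
Proof.
move=> nu1; have /cvg_real_complex := @is_cvg_Eterm R 0 nu x nu1.
move=> /cvg_lim <- //; congr (lim (_ @ \oo)); apply/funext => n.
rewrite /series /= rmorph_sum; apply: eq_bigr => k _.
rewrite /Eterm !addn0 [RHS]rmorphM fmorphV; congr (_ * _).
by rewrite [RHS]rmorphM !rmorphXn rmorphN1 rmorphM fmorphV rmorph_nat.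
Qed.

Lemma B_real (R : realType) (nu x : R) : -1 < nu ->
  B_ nu x%:C = (limn (series (Eterm 1 nu x)))%:C.
Proof.
move=> nu1; have /cvg_real_complex := @is_cvg_Eterm R 1 nu x nu1.
move=> /cvg_lim <- //; congr (lim (_ @ \oo)); apply/funext => n.
rewrite /series /= rmorph_sum; apply: eq_bigr => k _.
rewrite /Eterm !addn1 [RHS]rmorphM fmorphV; congr (_ * _).
by rewrite [RHS]rmorphM !rmorphXn rmorphN1 rmorphM fmorphV rmorph_nat.
Qed.

Definition E_weight (R : realType) (nu x : R) : R := normc (E_ nu x%:C) ^- 2.

Lemma measurable_E_weight (R : realType) (nu : R) : -1 < nu ->
  measurable_fun [set: R] (E_weight nu).
Proof.
move=> nu1.
rewrite (_ : E_weight nu = fun x => (limn (series (Eterm 0 nu x)) ^+ 2 +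
  limn (series (Eterm 1 nu x)) ^+ 2) `^ (-1)); last first.
  apply/funext => x; rewrite /E_weight /E_ A_real// B_real//=.
  set a := limn _; set b := limn _.
  rewrite powR_inv1 ?addr_ge0 ?sqr_ge0//.
  rewrite !(mul0r, mulr0, subr0, addr0, mul1r, sub0r, add0r).
  by rewrite oppr0 subr0 sqr_sqrtr ?addr_ge0 ?sqr_ge0// sqrrN.
apply: (@measurableT_comp _ _ _ _ _ _ (fun y : R => y `^ (-1))) => /=.
  exact: measurable_powR.
by apply: measurable_funD; apply: measurable_funX; exact: measurable_Eseries.
Qed.

Section E_measure.
Context (R : realType) (nu : R) (hnu : -1 < nu).

(* the argument hnu is used only to show that E_measure is a measure *)
Definition E_measure (_ : -1 < nu) (A : set (measurableTypeR R)) : \bar R :=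
  (\int[lebesgue_measure]_(x in A) (E_weight nu x)%:E)%E.

Let E_measure0 : E_measure hnu set0 = 0%E.
Proof. by rewrite /E_measure integral_set0. Qed.

Let E_weight_ge0 x : (0 <= (E_weight nu x)%:E)%E.
Proof. by rewrite lee_fin /E_weight invr_ge0 sqr_ge0. Qed.

Let E_measure_ge0 A : (0 <= E_measure hnu A)%E.
Proof. by apply: integral_ge0 => x _; exact: E_weight_ge0. Qed.

Let E_measure_sigma_additive : semi_sigma_additive (E_measure hnu).
Proof.
move=> F mF tF mUF; rewrite /E_measure ge0_integral_bigcup//; last first.
  apply/measurable_EFinP; apply: measurable_funTS; exact: measurable_E_weight.
by apply: is_cvg_ereal_nneg_natsum_cond => n _ _; exact: integral_ge0.
Qed.

HB.instance Definition _ := isMeasure.Build _ _ _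
  (E_measure hnu) E_measure0 E_measure_ge0 E_measure_sigma_additive.

End E_measure.

(* the L^p-norm of a complex function is the library's, applied to the modulus;
   for p = +oo it is the essential supremum *)
Definition in_Lp d (T : measurableType d) (R : realType)
    (mu : {measure set T -> \bar R}) (p : \bar R) (f : T -> R[i]) :=
  [/\ measurable_fun [set: T] (fun x => complex.Re (f x)),
      measurable_fun [set: T] (fun x => complex.Im (f x)) &
      finite_norm mu p (fun x => normc (f x))].

(* Main.v *)
Require Import Defs.
From mathcomp Require Import all_boot all_order all_algebra.
From mathcomp Require Import all_classical all_reals all_analysis.
From mathcomp Require Import measurable_realfun ess_sup_inf complex zify ring lra.

Set Implicit Arguments.
Unset Strict Implicit.
Unset Printing Implicit Defensive.

Import Order.TTheory GRing.Theory Num.Theory.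
Import numFieldTopology.Exports numFieldNormedType.Exports.
Import ComplexField.Normc.

Local Open Scope classical_set_scope.
Local Open Scope ring_scope.
Local Open Scope complex_scope.
(* again, so that ['i] is the unit of [R[i]] as a closed field *)
Local Open Scope ring_scope.

(** Write [w] for the weight [|E_nu|^-2] on the real line. Two facts combine.

    The weight varies at most polynomially: [w x <= K * (1 + |x - y|)^L * w y]
    ([E_weight_compare]). Indeed, with [u = (x / 2)^2] one has
    [|E_nu x|^2 = M u], where [M u = a u ^ 2 + u * b u ^ 2] for power series [a]
    and [b] with [a' = - b]. Bessel's recurrence turns the derivative of [M] into
    [- (2 nu + 1) * b ^ 2], so that [u * |M'| <= |2 nu + 1| * M]: multiplying or
    dividing [M] by a large power of [u] makes it monotone ([emod_growth]).

    The derivative obeys a pointwise Bernstein inequality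
    ([bernstein_pointwise]): if [F] is entire, [F z] is [O(exp (tau * |z|))] and
    [|F t| <= B * (1 + |t|)^n] on the line, then
    [|F' x| <= C * int |F s| * (1 + |s - x|)^-(n+1) ds], where [C] depends on [n]
    and [tau] only. For [x = 0], put [G z = F z * (sin z / z)^(n+1)], which has
    the same derivative at 0 and is [O(exp ((tau + n + 1) * |y|))] at [iy]. With [s = tau + n + 2], the
    function [G z * e^(isz) * (1 - isz)], corrected by
    [- G 0 + i * F' 0 * (e^(iz) - 1)], has a double zero at 0; the quotient by
    [z^2] is entire and small in the upper half-plane, hence has integral zero
    over the line ([upper_half_plane_integral]). The sum of the identities
    obtained in this way for [z] and [- z] expresses
    [F' 0 * int (2 - 2 cos t) / t^2 dt] as an integral of [G t / t^2] against a
    function that is [O(t^2)].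

    Given [p]-integrability for a finite [p], [|F| <= 1 + |F|^p] and the lower
    bound on the weight show that a primitive of [F] grows at most polynomially
    on the line ([primitive_poly_growth]); being of exponential type, it passes
    this growth on to its derivative [F] ([deriv_poly_growth]). The Bernstein
    inequality with a large [n] then applies to [F], and Jensen's inequality,
    Tonelli's theorem and [E_weight_compare] bound the weighted integral of
    [|F'|^p] by that of [|F|^p] ([weighted_Lp_bound]). For [p = +oo] the weight,
    being positive, plays no part: [F] is bounded on the line, hence so is [F'].

    That [F'] has exponential type at most [delta] is Cauchy's estimate on unit
    discs. Complex derivatives are treated in Caratheodory's form, up to Cauchy's
    formula on the unit circle; integrals along paths appear as increments of
    antiderivatives. *)

(** * The modulus *)

Section Modulus.
Context {R : realType}.
Implicit Types (x y : R) (z w : R[i]).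

Lemma normc_ge0 z : 0 <= normc z.
Proof. by case: z => a b; rewrite /= sqrtr_ge0. Qed.

Lemma normcD z w : normc (z + w) <= normc z + normc w.
Proof. exact: le_normcD. Qed.

Lemma normc_opp z : normc (- z) = normc z.
Proof. exact: normcN. Qed.

Lemma normcB z w : normc (z - w) <= normc z + normc w.
Proof. by rewrite (le_trans (normcD _ _))// normc_opp. Qed.

Lemma normc_distC z w : normc (z - w) = normc (w - z).
Proof. by rewrite -normc_opp opprB. Qed.

Lemma normc_real x : normc x%:C = `|x|.
Proof. by rewrite /= expr0n addr0 sqrtr_sqr. Qed.

Lemma normcX z n : normc (z ^+ n) = normc z ^+ n.
Proof. by elim: n => [|n IH]; rewrite ?normc1// !exprS normcM IH. Qed.

Lemma normci : normc ('i : R[i]) = 1.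
Proof. by rewrite /= expr0n expr1n add0r sqrtr1. Qed.

Lemma normc_eq0 z : (normc z == 0) = (z == 0).
Proof. by apply/eqP/eqP => [/eq0_normc//|->]; rewrite normc0. Qed.

Lemma normc_gt0 z : (0 < normc z) = (z != 0).
Proof. by rewrite lt0r normc_eq0 normc_ge0 andbT. Qed.

Lemma normc_le0 z : (normc z <= 0) = (z == 0).
Proof. by rewrite -normc_eq0 eq_le normc_ge0 andbT. Qed.

Lemma le_Re_normc z : `|complex.Re z| <= normc z.
Proof.
by case: z => a b /=; rewrite -[leLHS]sqrtr_sqr ler_wsqrtr// lerDl sqr_ge0.
Qed.

Lemma le_Im_normc z : `|complex.Im z| <= normc z.
Proof.
by case: z => a b /=; rewrite -[leLHS]sqrtr_sqr ler_wsqrtr// lerDr sqr_ge0.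
Qed.

Lemma Re_le_normc z : complex.Re z <= normc z.
Proof. by rewrite (le_trans (ler_norm _))// le_Re_normc. Qed.

Lemma real_imagE z : z = (complex.Re z)%:C + 'i * (complex.Im z)%:C.
Proof. exact: complexE. Qed.

Lemma Re_add z w : complex.Re (z + w) = complex.Re z + complex.Re w.
Proof. by case: z; case: w. Qed.

Lemma Im_add z w : complex.Im (z + w) = complex.Im z + complex.Im w.
Proof. by case: z; case: w. Qed.

Lemma Re_mul z w : complex.Re (z * w) =
  complex.Re z * complex.Re w - complex.Im z * complex.Im w.
Proof. by case: z; case: w. Qed.

Lemma Im_mul z w : complex.Im (z * w) =
  complex.Re z * complex.Im w + complex.Im z * complex.Re w.
Proof. by case: z; case: w. Qed.

Lemma Re_opp z : complex.Re (- z) = - complex.Re z.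
Proof. by case: z. Qed.

Lemma Im_opp z : complex.Im (- z) = - complex.Im z.
Proof. by case: z. Qed.

Lemma Re_realM x z : complex.Re (x%:C * z) = x * complex.Re z.
Proof. by case: z => a b /=; rewrite mul0r subr0. Qed.

Lemma i_sqr : 'i * 'i = -1 :> R[i].
Proof. by rewrite -expr2 sqr_i. Qed.

(** Some unimodular number turns a given one into its modulus. *)
Lemma normc_rotate z : exists2 u : R[i], normc u = 1 & complex.Re (u * z) = normc z.
Proof.
have [->|z0] := eqVneq z 0.
  by exists 1; rewrite ?normc1// mulr0 normc0.
have nz : normc z != 0 by rewrite normc_eq0.
exists (z^*%C / (normc z)%:C).
  have -> : normc (z^*%C / (normc z)%:C) = normc z / normc z.
    rewrite normcM normcV normc_real ger0_norm ?normc_ge0//.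
    by case: z {z0 nz} => a b /=; rewrite sqrrN.
  by rewrite divff.
rewrite -fmorphV /=; case: z z0 nz => a b /= _ nz.
rewrite !(mulr0, mulr0, subr0, addr0, add0r, mul0r, oppr0).
set s := Num.sqrt _ in nz *.
have s2 : s ^+ 2 = a ^+ 2 + b ^+ 2 by rewrite sqr_sqrtr// addr_ge0 ?sqr_ge0.
apply: (mulfI nz); rewrite -expr2 s2.
by field.
Qed.

End Modulus.

(** * Differential calculus *)

Section Deriv.
Context {R : realType}.

(** [lim0 j f l]: [f h] tends to [l] as [j h] tends to 0.  With [j] the identity
    of [R[i]] or the embedding of [R] this covers complex and real variables. *)
Definition lim0 (K : zmodType) (j : K -> R[i]) (f : K -> R[i]) (l : R[i]) :=
  forall e : R, 0 < e -> exists2 d : R, 0 < d &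
    forall h, normc (j h) < d -> normc (f h - l) <= e.

(** Caratheodory's form of the derivative of [f] at [x]; one notion for a
    complex and for a real variable. *)
Definition gderiv (K : zmodType) (j : K -> R[i]) (f : K -> R[i]) (x : K)
    (l : R[i]) :=
  exists2 q : K -> R[i], lim0 j q l & forall h, f (x + h) = f x + q h * j h.

Definition Cderiv := @gderiv R[i] id.
Definition Rderiv := @gderiv R (real_complex R).

Section gen.
Context (K : zmodType) (j : K -> R[i]).
Implicit Types (f g : K -> R[i]).

Lemma lim0_cst c : lim0 j (fun=> c) c.
Proof. by move=> e e0; exists 1 => // h _; rewrite subrr normc0 ltW. Qed.

Lemma lim0D f g l m : lim0 j f l -> lim0 j g m ->
  lim0 j (fun h => f h + g h) (l + m).
Proof.
move=> fl gm e e0.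
have [d d0 H] := fl _ (divr_gt0 e0 (ltr0Sn _ 1)).
have [d' d'0 H'] := gm _ (divr_gt0 e0 (ltr0Sn _ 1)).
exists (Num.min d d'); first by rewrite lt_min d0.
move=> h; rewrite lt_min => /andP[/H h1 /H' h2].
rewrite opprD addrACA (le_trans (normcD _ _))//; lra.
Qed.

Lemma lim0_bound f l : lim0 j f l -> exists2 d : R, 0 < d &
  forall h, normc (j h) < d -> normc (f h) <= normc l + 1.
Proof.
move=> /(_ _ ltr01) [d d0 H]; exists d => // h /H H1.
by rewrite -[f h](subrK l) (le_trans (normcD _ _))// addrC lerD2l.
Qed.

Lemma lim0M f g l m : lim0 j f l -> lim0 j g m ->
  lim0 j (fun h => f h * g h) (l * m).
Proof.
move=> fl gm e e0.
have L0 : 0 < normc l + 1 by rewrite ltr_wpDl ?normc_ge0.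
have M0 : 0 < normc m + 1 by rewrite ltr_wpDl ?normc_ge0.
have [d1 d10 H1] := fl _ (divr_gt0 e0 (mulr_gt0 (ltr0Sn _ 1) M0)).
have [d2 d20 H2] := gm _ (divr_gt0 e0 (mulr_gt0 (ltr0Sn _ 1) L0)).
have [d3 d30 H3] := lim0_bound gm.
exists (Num.min d1 (Num.min d2 d3)); first by rewrite !lt_min d10 d20.
move=> h; rewrite !lt_min => /and3P[/H1 h1 /H2 h2 /H3 h3].
have -> : f h * g h - l * m = (f h - l) * g h + l * (g h - m) by ring.
rewrite (le_trans (normcD _ _))// !normcM.
have E1 : normc (f h - l) * normc (g h) <= e / 2.
  rewrite (le_trans (ler_pM (normc_ge0 _) (normc_ge0 _) h1 h3))//.
  by rewrite le_eqVlt; apply/orP; left; apply/eqP; field; rewrite gt_eqF.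
have E2 : normc l * normc (g h - m) <= e / 2.
  rewrite (le_trans (ler_wpM2l (normc_ge0 _) h2))//.
  have -> : normc l * (e / (2 * (normc l + 1))) = e / 2 * (normc l / (normc l + 1)).
    by field; rewrite gt_eqF.
  by rewrite ger_pMr ?divr_gt0// ler_pdivrMr// mul1r lerDl.
lra.
Qed.

Lemma lim0_j : lim0 j j 0.
Proof. by move=> e e0; exists e => // h /ltW; rewrite subr0. Qed.

Lemma lim0_comp (g : R[i] -> R[i]) f l : lim0 id g l -> lim0 j f 0 ->
  lim0 j (fun h => g (f h)) l.
Proof.
move=> gl f0 e /gl [d d0 H].
have [d' d'0 H'] := f0 _ (divr_gt0 d0 (ltr0Sn _ 1)).
exists d' => // h /H'; rewrite subr0 => h1; apply: H.
by rewrite (le_lt_trans h1)// ltr_pdivrMr// ltr_pMr// ltr1n.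
Qed.

Lemma gderiv_cont f x l : gderiv j f x l -> lim0 j (fun h => f (x + h)) (f x).
Proof.
move=> [q ql H].
have := lim0D (lim0_cst (f x)) (lim0M ql lim0_j).
by rewrite mulr0 addr0 => + e e0 => /(_ e e0)[d d0 E]; exists d => // h /E; rewrite H.
Qed.

Lemma gderiv_cst c x : gderiv j (fun=> c) x 0.
Proof. by exists (fun=> 0); [exact: lim0_cst|move=> h; rewrite mul0r addr0]. Qed.

Lemma gderivD f g x l m : gderiv j f x l -> gderiv j g x m ->
  gderiv j (fun y => f y + g y) x (l + m).
Proof.
move=> [q ql fq] [r rm gr]; exists (fun h => q h + r h); first exact: lim0D.
by move=> h; rewrite fq gr; ring.
Qed.

Lemma gderivM f g x l m : gderiv j f x l -> gderiv j g x m ->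
  gderiv j (fun y => f y * g y) x (l * g x + f x * m).
Proof.
move=> df dg; have gc := gderiv_cont dg.
case: df dg => [q ql fq] [r rm gr].
exists (fun h => q h * g (x + h) + f x * r h).
  by apply: lim0D; apply: lim0M => //; exact: lim0_cst.
by move=> h; rewrite fq gr; ring.
Qed.

Lemma gderivZ c f x l : gderiv j f x l -> gderiv j (fun y => c * f y) x (c * l).
Proof. by move=> /(gderivM (gderiv_cst c x)); rewrite mul0r add0r. Qed.

Lemma gderivN f x l : gderiv j f x l -> gderiv j (fun y => - f y) x (- l).
Proof.
move=> /(gderivZ (-1)); rewrite mulN1r.
by under eq_fun do rewrite mulN1r.
Qed.

Lemma gderivB f g x l m : gderiv j f x l -> gderiv j g x m ->
  gderiv j (fun y => f y - g y) x (l - m).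
Proof. by move=> df dg; apply: gderivD => //; exact: gderivN. Qed.

Lemma gderiv_comp (G : R[i] -> R[i]) f x l m :
  Cderiv G (f x) m -> gderiv j f x l -> gderiv j (fun y => G (f y)) x (m * l).
Proof.
move=> [Q Qm GQ] [q ql fq].
exists (fun h => Q (q h * j h) * q h).
  apply: lim0M => //; apply: lim0_comp => //.
  by rewrite -(mulr0 l); apply: lim0M => //; exact: lim0_j.
by move=> h; rewrite fq GQ /=; ring.
Qed.

Lemma gderiv_ext f g x l : f =1 g -> gderiv j f x l -> gderiv j g x l.
Proof. by move=> fg; rewrite (_ : f = g)//; exact/funext. Qed.

Lemma gderiv_eq f x l m : gderiv j f x l -> l = m -> gderiv j f x m.
Proof. by move=> + <-. Qed.

Lemma gderivX f x l n : gderiv j f x l ->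
  gderiv j (fun y => f y ^+ n) x (n%:R * f x ^+ n.-1 * l).
Proof.
move=> df; elim: n => [|n IH].
  by rewrite mul0r mul0r; exact: gderiv_cst.
apply: (@gderiv_ext (fun y => f y * f y ^+ n)).
  by move=> y; rewrite exprS.
apply: gderiv_eq (gderivM df IH) _.
case: n {IH} => [|n] /=; first by rewrite !expr0; ring.
by rewrite exprS -[n.+2]addn1 natrD; ring.
Qed.

End gen.

Lemma Cderiv_id z : Cderiv id z 1.
Proof. by exists (fun=> 1) => [|h]; [exact: lim0_cst|rewrite mul1r]. Qed.

Lemma Rderiv_id t : Rderiv (real_complex R) t 1.
Proof.
by exists (fun=> 1) => [|h]; [exact: lim0_cst|rewrite mul1r rmorphD].
Qed.

(** Working form of the two-sided estimate behind [gderiv]. *)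
Lemma gderiv_approx (K : zmodType) (j : K -> R[i]) f x l : gderiv j f x l ->
  forall e : R, 0 < e -> exists2 d : R, 0 < d & forall h, normc (j h) < d ->
    normc (f (x + h) - f x - l * j h) <= e * normc (j h).
Proof.
move=> [q ql fq] e /ql[d d0 H]; exists d => // h /H H1.
have -> : f (x + h) - f x - l * j h = (q h - l) * j h by rewrite fq; ring.
by rewrite normcM ler_wpM2r// normc_ge0.
Qed.

Lemma approx_gderiv (K : zmodType) (j : K -> R[i]) f x l :
  (forall e : R, 0 < e -> exists2 d : R, 0 < d & forall h, normc (j h) < d ->
    normc (f (x + h) - f x - l * j h) <= e * normc (j h)) ->
  gderiv j f x l.
Proof.
move=> H; exists (fun h => if j h == 0 then l else (f (x + h) - f x) / j h).
  move=> e e0; have [d d0 Hd] := H e e0; exists d => // h /Hd E.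
  have [_|jh0] := eqVneq (j h) 0; first by rewrite subrr normc0 ltW.
  have -> : (f (x + h) - f x) / j h - l = (f (x + h) - f x - l * j h) / j h.
    by field.
  by rewrite normcM normcV ler_pdivrMr ?normc_gt0.
move=> h; case: (eqVneq (j h) 0) => [jh0|jh0]; last by rewrite divfK// [RHS]addrC subrK.
have [d d0 Hd] := H _ ltr01.
move: (Hd h); rewrite jh0 normc0 mulr0 subr0 => /(_ d0).
by rewrite mul1r normc_le0 subr_eq0 addr0 => /eqP.
Qed.

Lemma gderiv_unique (K : zmodType) (j : K -> R[i]) f x l m :
  (forall d : R, 0 < d -> exists2 h, j h != 0 & normc (j h) < d) ->
  gderiv j f x l -> gderiv j f x m -> l = m.
Proof.
move=> small dl dm; apply/eqP; rewrite -subr_eq0; apply/negPn/negP => lm.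
have n0 : 0 < normc (l - m) / 3 by rewrite divr_gt0// normc_gt0.
have [d1 d10 H1] := gderiv_approx dl n0.
have [d2 d20 H2] := gderiv_approx dm n0.
have [|h h0] := small (Num.min d1 d2); first by rewrite lt_min d10.
rewrite lt_min => /andP[/H1 h1 /H2 h2].
have := normcB (f (x + h) - f x - m * j h) (f (x + h) - f x - l * j h).
rewrite (_ : _ - _ = (l - m) * j h); last by ring.
rewrite normcM => h3.
have : normc (l - m) * normc (j h) <= 2 * (normc (l - m) / 3 * normc (j h)) by lra.
have : 0 < normc (l - m) * normc (j h) by rewrite mulr_gt0// normc_gt0.
lra.
Qed.

Lemma Cderiv_unique f z l m : Cderiv f z l -> Cderiv f z m -> l = m.
Proof.
apply: gderiv_unique => d d0; exists (d / 2)%:C.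
  by rewrite -normc_eq0 normc_real gt_eqF// normr_gt0 gt_eqF// divr_gt0.
by rewrite normc_real gtr0_norm ?divr_gt0// ltr_pdivrMr// ltr_pMr// ltr1n.
Qed.

(** ** Link with derivatives of real functions *)

Lemma is_derive_approx (u : R -> R) (t l : R) : is_derive t 1 u l <->
  forall e : R, 0 < e -> exists2 d : R, 0 < d & forall h, `|h| < d ->
    `|u (t + h) - u t - l * h| <= e * `|h|.
Proof.
split=> [[du Eu] e e0|H].
  move: du; rewrite /derivable => /cvg_ex[/= m um].
  have ml : m = l.
    by rewrite -Eu; symmetry; apply/cvg_lim.
  move: um; rewrite ml => /cvgrPdist_le /(_ e e0).
  rewrite /dnbhs near_withinE => /nbhs_ballP[d /= d0 H].
  exists d => // h hd.
  have [->|h0] := eqVneq h 0; first by rewrite addr0 subrr mulr0 subr0 normr0 mulr0.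
  have := H h; rewrite /ball /= sub0r normrN => /(_ hd h0).
  rewrite /GRing.scale /= mulr1 distrC (addrC h) => E.
  have -> : u (t + h) - u t - l * h = (h^-1 * (u (t + h) - u t) - l) * h.
    by field.
  by rewrite normrM ler_wpM2r.
have L : (fun h => h^-1 *: (u (h *: (1:R) + t) - u t)) @ (0:R)^' --> l.
  apply/cvgrPdist_le => e /H[d d0 Hd].
  rewrite /dnbhs near_withinE; apply/nbhs_ballP; exists d => // h.
  rewrite /ball /= sub0r normrN => hd h0.
  rewrite /GRing.scale /= mulr1 distrC (addrC h).
  have -> : h^-1 * (u (t + h) - u t) - l = (u (t + h) - u t - l * h) / h.
    by field.
  by rewrite normrM normfV ler_pdivrMr ?normr_gt0// Hd.
by split; [apply/cvg_ex; exists l|apply/cvg_lim].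
Qed.

Lemma Rderiv_Re (f : R -> R[i]) t l : Rderiv f t l ->
  is_derive t (1:R) (fun s => complex.Re (f s)) (complex.Re l).
Proof.
move=> /gderiv_approx H; apply/is_derive_approx => e /H[d d0 Hd].
exists d => // h hd; have := Hd h; rewrite normc_real => /(_ hd).
apply: le_trans; apply: le_trans (le_Re_normc _).
by rewrite !(Re_add, Re_opp, Re_mul) /= mulr0 subr0.
Qed.

Lemma Rderiv_real (u : R -> R) (t l : R) : is_derive t (1:R) u l ->
  Rderiv (fun s => (u s)%:C) t l%:C.
Proof.
move=> /is_derive_approx H; apply: approx_gderiv => e /H[d d0 Hd].
exists d => // h; rewrite normc_real => /Hd.
by rewrite -rmorphM -!rmorphB normc_real.
Qed.

Lemma Rderiv_Cderiv (G : R[i] -> R[i]) (t : R) m :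
  Cderiv G t%:C m -> Rderiv (fun s => G s%:C) t m.
Proof.
move=> dG; have := gderiv_comp dG (Rderiv_id t).
by rewrite mulr1.
Qed.

End Deriv.

(** * Increments of antiderivatives *)

Section Antiderivative.
Context {R : realType}.

Lemma is_derive_cont (u : R -> R) t l : is_derive t (1:R) u l ->
  {for t, continuous u}.
Proof. by move=> [du _]; apply/differentiable_continuous/derivable1_diffP. Qed.

Lemma incr_ge0 (u du : R -> R) (a b : R) : a <= b ->
  (forall t, a <= t <= b -> is_derive t (1:R) u (du t)) ->
  (forall t, a < t < b -> 0 <= du t) -> u a <= u b.
Proof.
rewrite le_eqVlt => /predU1P[->//|ab] D P.
have [c] : exists2 c, c \in `]a, b[%R & u b - u a = du c * (b - a).
  apply: (@MVT _ u du a b ab).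
    by move=> x; rewrite in_itv /= => /andP[ax xb]; apply: D; rewrite !ltW.
  apply: continuous_in_subspaceT => x; rewrite inE /= in_itv /= => xab.
  exact: is_derive_cont (D x xab).
rewrite in_itv /= => /andP[ac cb] E.
by rewrite -subr_ge0 E mulr_ge0 ?subr_ge0 ?P ?(ltW ab)// ac.
Qed.

(** The mean value inequality: speed at most [dp] gives displacement at most
    the increment of [p]. *)
Lemma mean_value (f df : R -> R[i]) (p dp : R -> R) (a b : R) : a <= b ->
  (forall t, a <= t <= b -> Rderiv f t (df t)) ->
  (forall t, a <= t <= b -> is_derive t (1:R) p (dp t)) ->
  (forall t, a <= t <= b -> normc (df t) <= dp t) ->
  normc (f b - f a) <= p b - p a.
Proof.
move=> ab Df Dp H; have [u u1 <-] := normc_rotate (f b - f a).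
pose k t := p t - complex.Re (u * f t).
suff : k a <= k b by rewrite /k mulrBr Re_add Re_opp; lra.
apply: (@incr_ge0 k (fun t => dp t - complex.Re (u * df t))) => // t tab.
  apply: is_deriveB; first exact: Dp.
  exact/Rderiv_Re/gderivZ/Df.
rewrite subr_ge0 (le_trans (Re_le_normc _))// normcM u1 mul1r.
by apply: H; case/andP: tab => at_ tb; rewrite !ltW.
Qed.

Lemma mean_value_cst (f df : R -> R[i]) (M a b : R) : a <= b ->
  (forall t, a <= t <= b -> Rderiv f t (df t)) ->
  (forall t, a <= t <= b -> normc (df t) <= M) ->
  normc (f b - f a) <= M * (b - a).
Proof.
move=> ab Df H; rewrite mulrBr.
apply: (@mean_value f df (fun t => M * t) (fun=> M)) => // t _.
by apply: is_derive_eq; rewrite /GRing.scale /= mulr1.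
Qed.

Lemma deriv0_cst (f : R -> R[i]) (a b : R) :
  (forall t, Rderiv f t 0) -> f a = f b.
Proof.
move=> H; wlog ab : a b / a <= b.
  by move=> W; have [/W//|/ltW/W->] := leP a b.
apply/eqP; rewrite eq_sym -subr_eq0 -normc_le0.
have -> : (0:R) = 0 * (b - a) by rewrite mul0r.
by apply: (@mean_value_cst f (fun=> 0)) => // t _; rewrite normc0.
Qed.

Lemma eq_deriv_eq (f g df : R -> R[i]) (a b : R) :
  (forall t, Rderiv f t (df t)) -> (forall t, Rderiv g t (df t)) ->
  f b - f a = g b - g a.
Proof.
move=> Df Dg.
suff E : f a - g a = f b - g b.
  by have -> : f b = f a - g a + g b; [rewrite E subrK|ring].
apply: (@deriv0_cst (fun t => f t - g t)) => t.
by rewrite -(subrr (df t)); apply: gderivB; [exact: Df|exact: Dg].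
Qed.

Lemma ge0_deriv_eq (u v d : R -> R) (a b : R) : a <= b ->
  (forall t, a <= t <= b -> is_derive t (1:R) u (d t)) ->
  (forall t, a <= t <= b -> is_derive t (1:R) v (d t)) ->
  u b - u a = v b - v a.
Proof.
move=> ab Du Dv.
have D t : a <= t <= b -> is_derive t (1:R) (fun s => u s - v s) 0.
  move=> tab; have := Du t tab; have := Dv t tab => ? ?.
  by apply: is_derive_eq; rewrite subrr.
have D' t : a <= t <= b -> is_derive t (1:R) (fun s => - (u s - v s)) 0.
  move=> tab; have := D t tab => ?.
  by apply: is_derive_eq; rewrite oppr0.
have := @incr_ge0 _ _ a b ab D (fun _ _ => lexx 0).
have := @incr_ge0 _ _ a b ab D' (fun _ _ => lexx 0).
lra.
Qed.

(** Normalized to vanish at 0, so that these antiderivatives agree on common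
    intervals. *)
Lemma local_antiderivative (f : R -> R) (N : R) : continuous f -> 0 < N ->
  exists2 u : R -> R, u 0 = 0 &
    forall t, - N < t < N -> is_derive t (1:R) u (f t).
Proof.
move=> cf N0.
pose F x := (\int[lebesgue_measure]_(t in [set` `[(- N), x]]) (f t))%R.
exists (fun x => F x - F 0); first by rewrite subrr.
move=> t /andP[Nt tN].
have [|||] := @continuous_FTC1_closed R f (- N) t N tN.
- apply: continuous_compact_integrable; first exact: segment_compact.
  exact: continuous_subspaceT.
- exact: Nt.
- exact: cf.
move=> d1 d2; have : is_derive t (1:R) F (f t).
  by split; [exact: d1|rewrite -derive1E d2].
by move=> ?; apply: is_derive_eq; rewrite subr0.
Qed.

Lemma antiderivative (f : R -> R) : continuous f ->
  exists u : R -> R, forall t, is_derive t (1:R) u (f t).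
Proof.
move=> cf.
have /choice[U HU] (n : nat) : exists u : R -> R, u 0 = 0 /\
    forall t : R, - n.+1%:R < t < n.+1%:R -> is_derive t (1:R) u (f t).
  by have [u u0 Hu] := @local_antiderivative f n.+1%:R cf (ltr0Sn _ _); exists u.
have agree n m (s : R) : (n <= m)%N -> - n.+1%:R < s < n.+1%:R -> U n s = U m s.
  move=> nm /andP[s1 s2].
  have inn (t : R) : - n.+1%:R < t < n.+1%:R -> is_derive t (1:R) (U n) (f t).
    exact: (HU n).2.
  have inm (t : R) : - n.+1%:R < t < n.+1%:R -> is_derive t (1:R) (U m) (f t).
    move=> /andP[t1 t2]; apply: (HU m).2.
    have : (n.+1%:R : R) <= m.+1%:R by rewrite ler_nat.
    lra.
  have [s0|s0] := leP 0 s.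
    have := @ge0_deriv_eq (U n) (U m) f 0 s s0.
    rewrite (HU n).1 (HU m).1 !subr0; apply=> t tab; [apply: inn|apply: inm]; lra.
  have := @ge0_deriv_eq (U n) (U m) f s 0 (ltW s0).
  rewrite (HU n).1 (HU m).1 !sub0r => E; apply: oppr_inj; apply: E => t tab;
    [apply: inn|apply: inm]; lra.
exists (fun t => U (Num.truncn `|t|) t) => t.
pose n := (Num.truncn `|t|).+1.
have tn : `|t| < n%:R.
  by have /andP[] := truncn_itv (normr_ge0 t).
have Dn : is_derive t (1:R) (U n) (f t).
  apply: (HU n).2; rewrite -ltr_norml (lt_le_trans tn)// ler_nat; lia.
apply/is_derive_approx => e e0.
have /is_derive_approx /(_ e e0) [d d0 Hd] := Dn.
have locE s : `|s| < n%:R -> U (Num.truncn `|s|) s = U n s.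
  move=> sn; apply: agree.
    have /andP[+ _] := truncn_itv (normr_ge0 s).
    move=> h; have := le_lt_trans h sn; rewrite ltr_nat; lia.
  have := truncn_itv (normr_ge0 s).
  by rewrite -ltr_norml => /andP[].
exists (Num.min d (n%:R - `|t|)); first by rewrite lt_min d0 subr_gt0.
move=> h; rewrite lt_min => /andP[hd hn].
rewrite !locE//; first exact: Hd.
by rewrite (le_lt_trans (ler_normD _ _))// -ltrBrDl.
Qed.

(** Continuity of complex functions of a real, respectively complex, variable. *)
Definition Rcontinuous (f : R -> R[i]) :=
  forall t, lim0 (real_complex R) (fun h => f (t + h)) (f t).

Definition Ccontinuous (f : R[i] -> R[i]) :=
  forall z, lim0 id (fun h => f (z + h)) (f z).

Lemma Rcontinuous_approx (f : R -> R[i]) (u : R -> R) : Rcontinuous f ->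
  (forall s t, `|u s - u t| <= normc (f s - f t)) -> continuous u.
Proof.
move=> cf H t; apply/cvgrPdist_le => e e0; have [d d0 Hd] := cf t e e0.
apply/nbhs_ballP; exists d => // s; rewrite /ball /= distrC => ts.
rewrite distrC (le_trans (H _ _))//.
by have := Hd (s - t); rewrite normc_real [t + _]addrC subrK; apply.
Qed.

Lemma Rantiderivative (f : R -> R[i]) : Rcontinuous f ->
  exists g : R -> R[i], forall t, Rderiv g t (f t).
Proof.
move=> cf.
have [u Hu] : exists u : R -> R, forall t, is_derive t (1:R) u (complex.Re (f t)).
  apply: antiderivative; apply: (Rcontinuous_approx cf) => s t.
  by rewrite -Re_opp -Re_add; exact: le_Re_normc.
have [v Hv] : exists v : R -> R, forall t, is_derive t (1:R) v (complex.Im (f t)).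
  apply: antiderivative; apply: (Rcontinuous_approx cf) => s t.
  by rewrite -Im_opp -Im_add; exact: le_Im_normc.
exists (fun t => (u t)%:C + 'i * (v t)%:C) => t.
rewrite [f t]real_imagE; apply: gderivD; first exact: Rderiv_real.
exact/gderivZ/Rderiv_real.
Qed.

Lemma Ccontinuous_path (f : R[i] -> R[i]) (g : R -> R[i]) :
  Ccontinuous f -> Rcontinuous g -> Rcontinuous (fun t => f (g t)).
Proof.
move=> cf cg t.
have : lim0 (real_complex R) (fun h => f (g t + (g (t + h) - g t))) (f (g t)).
  apply: (@lim0_comp _ _ _ (fun h => f (g t + h))); first exact: cf.
  by rewrite -(subrr (g t)); apply: lim0D => //; exact: lim0_cst.
move=> H e /H[d d0 Hd]; exists d => // h /Hd.
by rewrite [g t + _]addrC subrK.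
Qed.

Lemma Rcontinuous_deriv (f df : R -> R[i]) : (forall t, Rderiv f t (df t)) ->
  Rcontinuous f.
Proof. by move=> H t; exact: gderiv_cont (H t). Qed.

Lemma Ccontinuous_deriv (f df : R[i] -> R[i]) : (forall z, Cderiv f z (df z)) ->
  Ccontinuous f.
Proof. by move=> H t; exact: gderiv_cont (H t). Qed.

Lemma RcontinuousM (f g : R -> R[i]) : Rcontinuous f -> Rcontinuous g ->
  Rcontinuous (fun t => f t * g t).
Proof. by move=> cf cg t; apply: lim0M; [exact: cf|exact: cg]. Qed.

Lemma RcontinuousD (f g : R -> R[i]) : Rcontinuous f -> Rcontinuous g ->
  Rcontinuous (fun t => f t + g t).
Proof. by move=> cf cg t; apply: lim0D; [exact: cf|exact: cg]. Qed.

End Antiderivative.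

(** * Primitives of holomorphic functions *)

Section Bisection.
Context {R : realType}.

(** Bisection of rectangles: a property that passes from the four quarters to
    the whole, and holds for all small rectangles of the given shape around each
    point, holds. *)
Lemma bisection (P : R -> R -> R -> R -> Prop) (x1 x2 y1 y2 : R) :
  x1 <= x2 -> y1 <= y2 ->
  (forall a b c d, a <= b -> c <= d ->
    P a ((a + b) / 2) c ((c + d) / 2) -> P ((a + b) / 2) b c ((c + d) / 2) ->
    P a ((a + b) / 2) ((c + d) / 2) d -> P ((a + b) / 2) b ((c + d) / 2) d ->
    P a b c d) ->
  (forall s t, exists2 e : R, 0 < e & forall a b c d k,
    a <= s <= b -> c <= t <= d -> b - a = (x2 - x1) / 2 ^+ k ->
    d - c = (y2 - y1) / 2 ^+ k -> b - a < e -> d - c < e -> P a b c d) ->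
  P x1 x2 y1 y2.
Proof.
move=> x12 y12 quarter loc; apply: contrapT => nP.
pose S := {q : R * R * R * R | [/\ ~ P q.1.1.1 q.1.1.2 q.1.2 q.2,
  q.1.1.1 <= q.1.1.2 & q.1.2 <= q.2]}.
pose half (a b a' b' : R) := [\/ (a' = a /\ b' = (a + b) / 2) |
  (a' = (a + b) / 2 /\ b' = b)].
have /choice[next Hn] : forall q : S, exists q' : S,
    half (sval q).1.1.1 (sval q).1.1.2 (sval q').1.1.1 (sval q').1.1.2 /\
    half (sval q).1.2 (sval q).2 (sval q').1.2 (sval q').2.
  move=> [[[[a b] c] d] /= [nQ ab cd]].
  apply: contrapT => N; apply: nQ.
  have step a' b' c' d' : half a b a' b' -> half c d c' d' -> P a' b' c' d'.
    move=> h1 h2; apply: contrapT => nP'; apply: N.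
    have ab' : a' <= b' by case: h1 => -[-> ->]; lra.
    have cd' : c' <= d' by case: h2 => -[-> ->]; lra.
    by exists (exist _ (a', b', c', d') (And3 nP' ab' cd')).
  by apply: quarter => //; apply: step; (try by left); right.
pose q0 : S := exist _ (x1, x2, y1, y2) (And3 nP x12 y12).
pose q n := iter n next q0.
pose a n := (sval (q n)).1.1.1; pose b n := (sval (q n)).1.1.2.
pose c n := (sval (q n)).1.2; pose d n := (sval (q n)).2.
have Hq n : half (a n) (b n) (a n.+1) (b n.+1) /\ half (c n) (d n) (c n.+1) (d n.+1).
  exact: Hn (q n).
have ab n : a n <= b n by rewrite /a /b; case: (sval _) (svalP (q n)) => ? ? [].
have cd n : c n <= d n by rewrite /c /d; case: (sval _) (svalP (q n)) => ? ? [].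
(* the nested intervals of either coordinate have a common point *)
have nested (u v : nat -> R) : (forall n, u n <= v n) ->
    (forall n, half (u n) (v n) (u n.+1) (v n.+1)) ->
    (forall n, v n - u n = (v 0%N - u 0%N) / 2 ^+ n) /\
    exists s, forall n, u n <= s <= v n.
  move=> uv H; split.
    elim=> [|n IH]; first by rewrite expr0 divr1.
    rewrite exprS invfM mulrCA -IH.
    by case: (H n) => -[-> ->]; field.
  have mono n : u n <= u n.+1 /\ v n.+1 <= v n.
    by have := uv n; case: (H n) => -[-> ->] ?; split; lra.
  have umono n m : (n <= m)%N -> u n <= u m.
    move=> /subnKC <-; elim: (m - n)%N => [|k IH]; first by rewrite addn0.
    by rewrite addnS (le_trans IH)//; case: (mono (n + k)%N).
  have vmono n m : (n <= m)%N -> v m <= v n.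
    move=> /subnKC <-; elim: (m - n)%N => [|k IH]; first by rewrite addn0.
    by rewrite addnS (le_trans _ IH)//; case: (mono (n + k)%N).
  have uvnm n m : u n <= v m.
    have [nm|mn] := leP n m; first exact: le_trans (umono _ _ nm) (uv _).
    exact: le_trans (uv _) (vmono _ _ (ltW mn)).
  exists (sup (range u)) => n; apply/andP; split.
    apply: ub_le_sup; last by exists n.
    by exists (v 0%N) => _ [m _ <-].
  apply: ge_sup; first by exists (u 0%N), 0%N.
  by move=> _ [m _ <-].
have [lab [s Hs]] := nested a b ab (fun n => (Hq n).1).
have [lcd [t Ht]] := nested c d cd (fun n => (Hq n).2).
have [e e0 He] := loc s t.
have small (l : R) : 0 <= l -> exists k, forall n, (k <= n)%N -> l / 2 ^+ n < e.
  move=> l0; have [k _ Hk] := near_infty_natSinv_expn_lt (PosNum (divr_gt0 e0 (ltr_pwDl ltr01 l0))).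
  exists k => n kn; have := Hk n kn; rewrite /= div1r => h.
  rewrite (le_lt_trans (_ : _ <= (1 + l) / 2 ^+ n))//.
    by rewrite ler_pM2r ?invr_gt0 ?exprn_gt0// lerDr.
  by rewrite mulrC -ltr_pdivlMr// ltr_pwDl.
have [k1 H1] : exists k, forall n, (k <= n)%N -> (x2 - x1) / 2 ^+ n < e.
  by apply: small; rewrite subr_ge0.
have [k2 H2] : exists k, forall n, (k <= n)%N -> (y2 - y1) / 2 ^+ n < e.
  by apply: small; rewrite subr_ge0.
pose n := maxn k1 k2.
suff : P (a n) (b n) (c n) (d n).
  by rewrite /a /b /c /d; case: (sval _) (svalP (q n)) => ? ? [].
apply: (He _ _ _ _ n (Hs n) (Ht n) (lab n) (lcd n)).
- by rewrite lab H1// leq_maxl.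
- by rewrite lcd H2// leq_maxr.
Qed.

End Bisection.

Section Goursat.
Context {R : realType}.
Implicit Types (f : R[i] -> R[i]).

(** The point of the complex plane with coordinates [x] and [y]. *)
Definition cpt (x y : R) : R[i] := x%:C + 'i * y%:C.

Lemma cptE (z : R[i]) : cpt (complex.Re z) (complex.Im z) = z.
Proof. by rewrite /cpt -real_imagE. Qed.

Lemma cpt_dist (x y x' y' : R) :
  normc (cpt x y - cpt x' y') <= `|x - x'| + `|y - y'|.
Proof.
have -> : cpt x y - cpt x' y' = (x - x')%:C + 'i * (y - y')%:C.
  by rewrite /cpt !rmorphB; ring.
by rewrite (le_trans (normcD _ _))// normcM normci mul1r !normc_real.
Qed.

Lemma Rderiv_cptx (y x : R) : Rderiv (cpt^~ y) x 1.
Proof.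
rewrite -[1]addr0; apply: gderivD; [exact: Rderiv_id|exact: gderiv_cst].
Qed.

Lemma Rderiv_cpty (x y : R) : Rderiv (cpt x) y 'i.
Proof.
rewrite -['i]add0r; apply: gderivD; first exact: gderiv_cst.
by apply: gderiv_eq (gderivZ _ (Rderiv_id y)) _; rewrite mulr1.
Qed.

(** The mean value inequality for the deviation from a linear function, without
    order between [a] and [b]. *)
Lemma mean_value_abs (g dg : R -> R[i]) (c : R[i]) (M a b : R) :
  (forall t, Rderiv g t (dg t)) ->
  (forall t, `|t - a| <= `|b - a| -> normc (dg t - c) <= M) ->
  normc (g b - g a - c * (b - a)%:C) <= M * `|b - a|.
Proof.
move=> Dg H.
pose k t := g t - c * t%:C.
have Dk t : Rderiv k t (dg t - c).
  apply: gderivB; first exact: Dg.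
  by apply: gderiv_eq (gderivZ _ (Rderiv_id t)) _; rewrite mulr1.
have -> : g b - g a - c * (b - a)%:C = k b - k a by rewrite /k rmorphB; ring.
have [ab|ba] := leP a b.
  rewrite ger0_norm ?subr_ge0//; apply: (mean_value_cst ab (fun t _ => Dk t)).
  by move=> t /andP[at_ tb]; apply: H; rewrite !ger0_norm ?subr_ge0//; lra.
rewrite normc_distC distrC gtr0_norm ?subr_gt0//.
apply: (mean_value_cst (ltW ba) (fun t _ => Dk t)).
move=> t /andP[bt ta]; apply: H; rewrite ler0_norm ?ltr0_norm ?subr_le0 ?subr_lt0//; lra.
Qed.

Section rectangles.
Variables (f : R[i] -> R[i]) (hx vy : R -> R -> R[i]).
Hypothesis Dhx : forall y x, Rderiv (hx y) x (f (cpt x y)).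
Hypothesis Dvy : forall x y, Rderiv (vy x) y (f (cpt x y)).

(** The integral of [f] along the boundary of the rectangle
    [[x1, x2] x [y1, y2]]; [hx y] and [vy x] are antiderivatives of [f] along
    the horizontal and the vertical lines. *)
Definition rect (x1 x2 y1 y2 : R) : R[i] :=
  (hx y1 x2 - hx y1 x1) + 'i * (vy x2 y2 - vy x2 y1)
  - (hx y2 x2 - hx y2 x1) - 'i * (vy x1 y2 - vy x1 y1).

Lemma rect_bound (A G : R[i] -> R[i]) (M x1 x2 y1 y2 : R) :
  x1 <= x2 -> y1 <= y2 -> (forall z, Cderiv G z (A z)) ->
  (forall x y, x1 <= x <= x2 -> y1 <= y <= y2 ->
    normc (f (cpt x y) - A (cpt x y)) <= M) ->
  normc (rect x1 x2 y1 y2) <= 2 * M * ((x2 - x1) + (y2 - y1)).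
Proof.
move=> x12 y12 DG H.
have Hx y : y1 <= y <= y2 -> normc (hx y x2 - hx y x1 -
    (G (cpt x2 y) - G (cpt x1 y))) <= M * (x2 - x1).
  move=> yy; pose k x := hx y x - G (cpt x y).
  have -> : hx y x2 - hx y x1 - (G (cpt x2 y) - G (cpt x1 y)) = k x2 - k x1.
    by rewrite /k; ring.
  apply: (@mean_value_cst _ k (fun x => f (cpt x y) - A (cpt x y) * 1)) => // t tt.
    apply: gderivB; first exact: Dhx.
    by apply: gderiv_comp; [exact: DG|exact: Rderiv_cptx].
  by rewrite mulr1; exact: H.
have Hy x : x1 <= x <= x2 -> normc ('i * (vy x y2 - vy x y1) -
    (G (cpt x y2) - G (cpt x y1))) <= M * (y2 - y1).
  move=> xx; pose k y := 'i * vy x y - G (cpt x y).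
  have -> : 'i * (vy x y2 - vy x y1) - (G (cpt x y2) - G (cpt x y1)) = k y2 - k y1.
    by rewrite /k; ring.
  apply: (@mean_value_cst _ k (fun y => 'i * f (cpt x y) - A (cpt x y) * 'i)) => // t tt.
    apply: gderivB; first by apply: gderivZ; exact: Dvy.
    by apply: gderiv_comp; [exact: DG|exact: Rderiv_cpty].
  by rewrite mulrC -mulrBl normcM normci mulr1; exact: H.
have := Hx y1; rewrite lexx y12 => /(_ isT) h1.
have := Hx y2; rewrite lexx y12 => /(_ isT) h2.
have := Hy x1; rewrite lexx x12 => /(_ isT) h3.
have := Hy x2; rewrite lexx x12 => /(_ isT) h4.
move: h1 h2 h3 h4; set A1 := (X in normc X <= _).
set A2 := (X in _ -> normc X <= _ -> _); set A3 := (X in _ -> _ -> normc X <= _ -> _).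
set A4 := (X in _ -> _ -> _ -> normc X <= _ -> _) => h1 h2 h3 h4.
have -> : rect x1 x2 y1 y2 = (A1 + A4) - (A2 + A3).
  by rewrite /rect /A1 /A2 /A3 /A4; ring.
have := normcB (A1 + A4) (A2 + A3); have := normcD A1 A4; have := normcD A2 A3.
lra.
Qed.

Lemma rect_flipx x1 x2 y1 y2 : rect x2 x1 y1 y2 = - rect x1 x2 y1 y2.
Proof. by rewrite /rect; ring. Qed.

Lemma rect_flipy x1 x2 y1 y2 : rect x1 x2 y2 y1 = - rect x1 x2 y1 y2.
Proof. by rewrite /rect; ring. Qed.

(** A monotone function whose increment over any interval of length [l] around
    [a] is at least [sqrt l]. *)
Let U (a t : R) := Num.sqrt (t - a) - Num.sqrt (a - t).

Let U_mono a s t : s <= t -> U a s <= U a t.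
Proof.
move=> st; rewrite /U lerB//; apply: ler_wsqrtr; lra.
Qed.

Let U_around a s t : s <= a <= t -> Num.sqrt (t - s) <= U a t - U a s.
Proof.
move=> /andP[sa at_]; rewrite /U.
rewrite (@ler0_sqrtr _ (a - t)) ?subr_le0// (@ler0_sqrtr _ (s - a)) ?subr_le0//.
rewrite subr0 sub0r opprK.
rewrite -(@ler_pXn2r _ 2) ?nnegrE ?sqrtr_ge0 ?addr_ge0 ?sqrtr_ge0//.
rewrite sqrrD !sqr_sqrtr; [|lra..].
have : 0 <= Num.sqrt (t - a) * Num.sqrt (a - s) by rewrite mulr_ge0 ?sqrtr_ge0.
lra.
Qed.

(** Goursat's lemma; at the point [a] continuity suffices. The proof
    bisects the bound [e * mass], where [mass] is additive: the area, plus a term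
    at least of the order of the diameter on rectangles of the given shape
    around [a]. *)
Lemma goursat (a : R[i]) :
  Ccontinuous f -> (forall z, z != a -> exists l, Cderiv f z l) ->
  forall x1 x2 y1 y2, rect x1 x2 y1 y2 = 0.
Proof.
move=> cf df.
suff W x1 x2 y1 y2 : x1 < x2 -> y1 < y2 -> rect x1 x2 y1 y2 = 0.
  move=> x1 x2 y1 y2.
  wlog x12 : x1 x2 / x1 <= x2 => [Wx|].
    have [/Wx//|/ltW/Wx E] := leP x1 x2.
    by apply/eqP; rewrite -oppr_eq0 -rect_flipx E.
  wlog y12 : y1 y2 / y1 <= y2 => [Wy|].
    have [/Wy//|/ltW/Wy E] := leP y1 y2.
    by apply/eqP; rewrite -oppr_eq0 -rect_flipy E.
  move: x12; rewrite le_eqVlt => /predU1P[->|x12]; first by rewrite /rect; ring.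
  move: y12; rewrite le_eqVlt => /predU1P[->|y12]; first by rewrite /rect; ring.
  exact: W.
move=> x12 y12.
pose X := x2 - x1; pose Y := y2 - y1.
have X0 : 0 < X by rewrite subr_gt0.
have Y0 : 0 < Y by rewrite subr_gt0.
pose mass s1 s2 t1 t2 := (s2 - s1) * (t2 - t1) +
  (U (complex.Re a) s2 - U (complex.Re a) s1) * (U (complex.Im a) t2 - U (complex.Im a) t1).
suff K (e : R) : 0 < e -> normc (rect x1 x2 y1 y2) <= e * mass x1 x2 y1 y2.
  have m0 : 0 < mass x1 x2 y1 y2.
    rewrite ltr_pwDl ?mulr_gt0// mulr_ge0// subr_ge0 U_mono// ltW//.
  apply/eqP; rewrite -normc_le0; apply/ler_addgt0Pl => e e0; rewrite addr0.
  have := K _ (divr_gt0 e0 m0); rewrite divfK ?gt_eqF//.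
move=> e0; pattern x1, x2, y1, y2; apply: bisection; [exact: ltW|exact: ltW| |].
  move=> s1 s2 t1 t2 s12 t12; set m := (s1 + s2) / 2; set n := (t1 + t2) / 2.
  have -> : rect s1 s2 t1 t2 = (rect s1 m t1 n + rect m s2 t1 n) +
      (rect s1 m n t2 + rect m s2 n t2) by rewrite /rect; ring.
  have -> : mass s1 s2 t1 t2 = (mass s1 m t1 n + mass m s2 t1 n) +
      (mass s1 m n t2 + mass m s2 n t2) by rewrite /mass; ring.
  move=> h1 h2 h3 h4; apply: (le_trans (normcD _ _)).
  by rewrite mulrDr; apply: lerD; apply: (le_trans (normcD _ _)); rewrite mulrDr lerD.
move=> s t; rewrite -/X -/Y.
have near (b1 b2 c1 c2 x y : R) : b1 <= s <= b2 -> c1 <= t <= c2 ->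
    b1 <= x <= b2 -> c1 <= y <= c2 ->
    normc (cpt x y - cpt s t) <= (b2 - b1) + (c2 - c1).
  move=> bs ct bx cy; rewrite (le_trans (cpt_dist _ _ _ _))//.
  by rewrite lerD// ler_norml; apply/andP; split; lra.
have [Ea|Na] := eqVneq (cpt s t) a.
  pose C := (X + Y) / Num.sqrt (X * Y).
  have sXY : 0 < Num.sqrt (X * Y) by rewrite sqrtr_gt0 mulr_gt0.
  have C0 : 0 < C by rewrite divr_gt0// addr_gt0.
  have e'0 : 0 < e / (2 * C) by rewrite divr_gt0// mulr_gt0.
  have [d d0 Hd] := cf a _ e'0.
  exists (d / 2); first by rewrite divr_gt0.
  move=> b1 b2 c1 c2 k bs ct bX cY bd cd.
  have b12 : b1 <= b2 by case/andP: bs; exact: le_trans.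
  have c12 : c1 <= c2 by case/andP: ct; exact: le_trans.
  have Da z : Cderiv (fun z => f a * z) z (f a).
    by apply: gderiv_eq (gderivZ _ (Cderiv_id z)) _; rewrite mulr1.
  apply: (le_trans (rect_bound b12 c12 Da (M := e / (2 * C)) _)).
    move=> x y bx cy; have := Hd (cpt x y - a); rewrite [a + _]addrC subrK; apply.
    rewrite -Ea (le_lt_trans (near _ _ _ _ _ _ bs ct bx cy))//; lra.
  have -> : 2 * (e / (2 * C)) * (b2 - b1 + (c2 - c1)) =
      e * (Num.sqrt (b2 - b1) * Num.sqrt (c2 - c1)).
    rewrite bX cY -sqrtrM ?divr_ge0 ?exprn_ge0 ?(ltW X0)//.
    have -> : X / 2 ^+ k * (Y / 2 ^+ k) = (X * Y) * (2 ^- k) ^+ 2.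
      by rewrite exprVn; field; rewrite expf_neq0// pnatr_eq0.
    rewrite sqrtrM ?mulr_ge0 ?ltW// sqrtr_sqr ger0_norm ?invr_ge0 ?exprn_ge0//.
    rewrite /C; field.
    by rewrite expf_neq0 ?pnatr_eq0// !gt_eqF// addr_gt0.
  rewrite ler_pM2l// /mass; apply: (@le_trans _ _ ((U (complex.Re a) b2 - U (complex.Re a) b1) * (U (complex.Im a) c2 - U (complex.Im a) c1))).
    apply: ler_pM; rewrite ?sqrtr_ge0// U_around// -Ea /cpt /=.
    - by rewrite !(mul0r,mulr0,addr0,subr0).
    - by rewrite !(mul0r,mulr0,addr0,subr0,mul1r,add0r).
  by rewrite lerDr mulr_ge0 ?subr_ge0.
have [l /gderiv_approx Dl] := df _ Na.
pose C := (X + Y) ^+ 2 / (X * Y).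
have C0 : 0 < C by apply: divr_gt0; [exact/exprn_gt0/addr_gt0|exact: mulr_gt0].
have e'0 : 0 < e / (2 * C) by rewrite divr_gt0// mulr_gt0.
have [d d0 Hd] := Dl _ e'0.
exists (d / 2); first by rewrite divr_gt0.
move=> b1 b2 c1 c2 k bs ct bX cY bd cd.
have b12 : b1 <= b2 by case/andP: bs; exact: le_trans.
have c12 : c1 <= c2 by case/andP: ct; exact: le_trans.
set w := cpt s t in Dl Hd Na near.
have Da z : Cderiv (fun z => (f w - l * w) * z + l / 2 * z ^+ 2) z (f w + l * (z - w)).
  have := gderivD (gderivZ (f w - l * w) (Cderiv_id z))
    (gderivZ (l / 2) (gderivX 2 (Cderiv_id z))).
  by move=> D; apply: gderiv_eq D _; rewrite /=; field.
apply: (le_trans (rect_bound b12 c12 Da (M := e / (2 * C) * (b2 - b1 + (c2 - c1))) _)).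
  move=> x y bx cy; have nr := near _ _ _ _ _ _ bs ct bx cy.
  have := Hd (cpt x y - w); rewrite [w + _]addrC subrK => h.
  have -> : f (cpt x y) - (f w + l * (cpt x y - w)) =
      f (cpt x y) - f w - l * (cpt x y - w) by ring.
  rewrite (le_trans (h _))//; first by rewrite (le_lt_trans nr)//; lra.
  by rewrite ler_pM2l.
have -> : 2 * (e / (2 * C) * (b2 - b1 + (c2 - c1))) * (b2 - b1 + (c2 - c1)) =
    e * ((b2 - b1) * (c2 - c1)).
  rewrite bX cY /C; field.
  by rewrite expf_neq0 ?pnatr_eq0// !gt_eqF// addr_gt0.
by rewrite ler_pM2l// /mass lerDl mulr_ge0// subr_ge0 U_mono.
Qed.

End rectangles.

(** A continuous function that is holomorphic off one point has a primitive. *)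
Lemma primitive_off_point f (a : R[i]) : Ccontinuous f ->
  (forall z, z != a -> exists l, Cderiv f z l) ->
  exists g : R[i] -> R[i], forall z, Cderiv g z (f z).
Proof.
move=> cf df.
have /choice[hx Dhx] (y : R) :
    exists h : R -> R[i], forall x, Rderiv h x (f (cpt x y)).
  apply: (Rantiderivative (f := fun x => f (cpt x y))).
  exact: Ccontinuous_path cf (Rcontinuous_deriv (Rderiv_cptx y)).
have /choice[vy Dvy] (x : R) :
    exists v : R -> R[i], forall y, Rderiv v y (f (cpt x y)).
  apply: (Rantiderivative (f := fun y => f (cpt x y))).
  exact: Ccontinuous_path cf (Rcontinuous_deriv (Rderiv_cpty x)).
have I0 := goursat Dhx Dvy cf df.
pose g z := let x := complex.Re z in let y := complex.Im z in
  hx 0 x - hx 0 0 + 'i * (vy x y - vy x 0).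
exists g => z; apply: approx_gderiv => e e0.
have [d d0 Hd] := cf z _ (divr_gt0 e0 (ltr0Sn _ 1)).
exists (d / 2); rewrite ?divr_gt0// => h hd.
set x := complex.Re z; set y := complex.Im z.
set s := complex.Re h; set t := complex.Im h.
have sh : `|s| <= normc h by exact: le_Re_normc.
have th : `|t| <= normc h by exact: le_Im_normc.
have zE : z = cpt x y by rewrite cptE.
(* from z to z + h along a horizontal, then a vertical segment *)
have E : g (z + h) - g z = (hx y (x + s) - hx y x) +
    'i * (vy (x + s) (y + t) - vy (x + s) y).
  have := I0 0 (x + s) 0 y; have := I0 0 x 0 y; rewrite /rect /g Re_add Im_add -/x -/y -/s -/t.
  move=> E1 E2.
  apply/eqP; rewrite -subr_eq0; apply/eqP.
  by rewrite -[RHS](subrr 0) -{1}E2 -E1; ring.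
have -> : g (z + h) - g z - f z * h =
   (hx y (x + s) - hx y x - f z * (x + s - x)%:C) +
   'i * (vy (x + s) (y + t) - vy (x + s) y - f z * (y + t - y)%:C).
  rewrite E [h in LHS]real_imagE -/s -/t.
  have -> : x + s - x = s by ring.
  have -> : y + t - y = t by ring.
  by ring.
have dist x' y' : `|x' - x| <= `|s| -> `|y' - y| <= `|t| ->
    normc (f (cpt x' y') - f z) <= e / 2.
  move=> hx' hy'; have := Hd (cpt x' y' - z); rewrite [z + _]addrC subrK; apply.
  rewrite zE (le_lt_trans (cpt_dist _ _ _ _))//; lra.
rewrite (le_trans (normcD _ _))// normcM normci mul1r.
have h1 := @mean_value_abs (hx y) _ (f z) (e / 2) x (x + s) (Dhx y).
have h2 := @mean_value_abs (vy (x + s)) _ (f z) (e / 2) y (y + t) (Dvy (x + s)).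
have {}h1 : normc (hx y (x + s) - hx y x - f z * (x + s - x)%:C) <= e / 2 * `|s|.
  have -> : `|s| = `|x + s - x| by congr `|_|; ring.
  apply: h1 => u; rewrite (_ : x + s - x = s); last by ring.
  by move=> us; apply: dist => //; rewrite subrr normr0.
have {}h2 : normc (vy (x + s) (y + t) - vy (x + s) y - f z * (y + t - y)%:C) <= e / 2 * `|t|.
  have -> : `|t| = `|y + t - y| by congr `|_|; ring.
  apply: h2 => u; rewrite (_ : y + t - y = t); last by ring.
  by move=> us; apply: dist => //; rewrite (_ : x + s - x = s)//; ring.
apply: (le_trans (lerD h1 h2)).
have := ler_wpM2l (ltW (divr_gt0 e0 (ltr0Sn R 1))) sh.
have := ler_wpM2l (ltW (divr_gt0 e0 (ltr0Sn R 1))) th.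
lra.
Qed.

Lemma primitive f : (forall z, exists l, Cderiv f z l) ->
  exists g : R[i] -> R[i], forall z, Cderiv g z (f z).
Proof.
move=> df; apply: (@primitive_off_point f 0) => // z.
by have [l /gderiv_cont] := df z.
Qed.

End Goursat.

(** * Cauchy's formula *)

Section Cauchy.
Context {R : realType}.
Implicit Types (f : R[i] -> R[i]).

Lemma bounded_disc f (r : R) : Ccontinuous f ->
  exists M : R, forall z, normc z <= r -> normc (f z) <= M.
Proof.
move=> cf; have [r0|r0] := leP 0 r; last first.
  by exists 0 => z zr; have := le_lt_trans zr r0; rewrite ltNge normc_ge0.
suff [M HM] : exists M : R, forall x y, - r <= x <= r -> - r <= y <= r ->
    normc (f (cpt x y)) <= M.
  exists M => z zr; rewrite -(cptE z); apply: HM; rewrite -ler_norml.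
    exact: le_trans (le_Re_normc _) zr.
  exact: le_trans (le_Im_normc _) zr.
apply: (@bisection _ (fun a b c d => exists M : R, forall x y, a <= x <= b ->
    c <= y <= d -> normc (f (cpt x y)) <= M) (- r) r (- r) r); [lra|lra| |].
  move=> a b c d ab cd [M1 H1] [M2 H2] [M3 H3] [M4 H4].
  exists (Num.max (Num.max M1 M2) (Num.max M3 M4)) => x y /andP[ax xb] /andP[cy yd].
  rewrite !le_max; have [xm|mx] := leP x ((a + b) / 2);
    have [ym|my] := leP y ((c + d) / 2).
  - by rewrite H1 ?ax ?cy.
  - by rewrite H3 ?ax ?yd ?(ltW my) ?orbT.
  - by rewrite H2 ?cy ?xb ?(ltW mx) ?orbT.
  - by rewrite H4 ?xb ?yd ?(ltW mx) ?(ltW my) ?orbT.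
move=> s t; have [d d0 Hd] := cf (cpt s t) 1 ltr01.
exists (d / 2); first by rewrite divr_gt0.
move=> a b c e k sab tce _ _ ba ec.
exists (normc (f (cpt s t)) + 1) => x y xab yce.
have := Hd (cpt x y - cpt s t); rewrite [_ + (_ - _)]addrC subrK => h.
rewrite -[f (cpt x y)](subrK (f (cpt s t))) addrC (le_trans (normcD _ _))//.
rewrite lerD2l; apply: h; rewrite (le_lt_trans (cpt_dist _ _ _ _))//.
have : `|x - s| <= b - a by rewrite ler_norml; apply/andP; split; lra.
have : `|y - t| <= e - c by rewrite ler_norml; apply/andP; split; lra.
lra.
Qed.

(** ** Integrals over a period *)

(** Integral over [[0, 2 * pi]], as the increment of some antiderivative; if
    there is none, the value is 0. *)
Definition circ_int (g : R -> R[i]) : R[i] :=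
  let G := xget (fun=> 0) [set G | forall t, Rderiv G t (g t)] in
  G (2 * pi) - G 0.

Lemma circ_intE (G g : R -> R[i]) : (forall t, Rderiv G t (g t)) ->
  circ_int g = G (2 * pi) - G 0.
Proof.
move=> DG; rewrite /circ_int; case: xgetP => [H _ DH|/(_ G)//].
exact: eq_deriv_eq DH DG.
Qed.

Lemma circ_intD (g h : R -> R[i]) : Rcontinuous g -> Rcontinuous h ->
  circ_int (fun t => g t + h t) = circ_int g + circ_int h.
Proof.
move=> /Rantiderivative[G DG] /Rantiderivative[H DH].
rewrite (circ_intE DG) (circ_intE DH).
by rewrite (circ_intE (G := fun t => G t + H t)); [ring|move=> t; apply: gderivD; [exact: DG|exact: DH]].
Qed.

Lemma circ_intZ c (g : R -> R[i]) : Rcontinuous g ->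
  circ_int (fun t => c * g t) = c * circ_int g.
Proof.
move=> /Rantiderivative[G DG]; rewrite (circ_intE DG).
by rewrite (circ_intE (G := fun t => c * G t)); [ring|move=> t; apply: gderivZ; exact: DG].
Qed.

Lemma circ_int_bound (g : R -> R[i]) (M : R) : Rcontinuous g ->
  (forall t, normc (g t) <= M) -> normc (circ_int g) <= M * (2 * pi).
Proof.
move=> /Rantiderivative[G DG] H; rewrite (circ_intE DG) -[2 * pi in leRHS]subr0.
apply: mean_value_cst => [|t _|t _]; [|exact: DG|exact: H].
by rewrite mulr_ge0// pi_ge0.
Qed.

Lemma Cderiv_inv (z : R[i]) : z != 0 -> Cderiv GRing.inv z (- z ^- 2).
Proof.
move=> z0; have n0 : 0 < normc z by rewrite normc_gt0.
apply: approx_gderiv => e e0.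
exists (Num.min (normc z / 2) (e * normc z ^+ 3 / 2)).
  by rewrite lt_min !divr_gt0// mulr_gt0// exprn_gt0.
move=> h; rewrite lt_min => /andP[h1 h2].
have zh : normc z / 2 <= normc (z + h).
  have := normcB (z + h) h; rewrite addrK; lra.
have zh0 : z + h != 0 by rewrite -normc_gt0; lra.
have -> : (z + h)^-1 - z^-1 - - z ^- 2 * h = h * h / (z ^+ 2 * (z + h)).
  by field; rewrite z0 zh0.
rewrite !normcM normcV normcM normcX -mulrA mulrC ler_wpM2r ?normc_ge0//.
rewrite ler_pdivrMr; last by rewrite mulr_gt0 ?exprn_gt0// normc_gt0.
apply: (le_trans (ltW h2)).
have -> : e * normc z ^+ 3 / 2 = e * (normc z ^+ 2 * (normc z / 2)) by ring.
by rewrite ler_pM2l// ler_pM2l ?exprn_gt0.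
Qed.

Lemma gderivV (K : zmodType) (j : K -> R[i]) (g : K -> R[i]) x l :
  g x != 0 -> gderiv j g x l -> gderiv j (fun y => (g y)^-1) x (- g x ^- 2 * l).
Proof. by move=> g0; apply: gderiv_comp; exact: Cderiv_inv. Qed.

Lemma Rcontinuous_cst (c : R[i]) : Rcontinuous (fun=> c : R[i]).
Proof. by move=> t; exact: lim0_cst. Qed.

Local Ltac rcont := repeat first [assumption | apply: Rcontinuous_cst |
  apply: RcontinuousM | apply: RcontinuousD].

(** ** The unit circle *)

(** The parametrization of the unit circle by the angle. *)
Definition circ (t : R) : R[i] := cpt (cos t) (sin t).

Lemma normc_circ t : normc (circ t) = 1.
Proof.
rewrite /circ /cpt /= !(mul0r, mulr0, mul1r, subr0, addr0, add0r).
by rewrite cos2Dsin2 sqrtr1.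
Qed.

Lemma circ_neq0 t : circ t != 0.
Proof. by rewrite -normc_gt0 normc_circ. Qed.

Lemma Rderiv_circ t : Rderiv circ t ('i * circ t).
Proof.
have -> : 'i * circ t = (- sin t)%:C + 'i * (cos t)%:C.
  by rewrite /circ /cpt rmorphN mulrDr mulrA i_sqr; ring.
apply: gderivD; first by apply: Rderiv_real; exact: is_derive_cos.
by apply: gderivZ; apply: Rderiv_real; exact: is_derive_sin.
Qed.

Lemma circ_period : circ (2 * pi) = circ 0.
Proof. by rewrite /circ mulr_natl cos2pi sin2pi cos0 sin0. Qed.

Lemma circ_int_expV k : circ_int (fun t => (circ t)^-1 ^+ k.+1) = 0.
Proof.
have K0 : 'i * k.+1%:R != 0 :> R[i].
  by rewrite mulf_neq0 ?pnatr_eq0// -normc_gt0 normci.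
rewrite (circ_intE (G := fun t => - ('i * k.+1%:R)^-1 * (circ t)^-1 ^+ k.+1)).
  by rewrite circ_period subrr.
move=> t.
have D := gderivX k.+1 (gderivV (circ_neq0 t) (Rderiv_circ t)).
apply: gderiv_eq (gderivZ _ D) _ => /=.
rewrite [RHS]exprS; have := circ_neq0 t; move: ((circ t)^-1 ^+ k) => E c0.
have := K0; rewrite mulf_eq0 negb_or => /andP[].
move: ('i%R) (k.+1%:R) => a b a0 b0.
by field; rewrite c0 a0 b0.
Qed.

Lemma Rcontinuous_circV : Rcontinuous (fun t => (circ t)^-1).
Proof.
move=> t; exact: gderiv_cont (gderivV (circ_neq0 t) (Rderiv_circ t)).
Qed.

Lemma RcontinuousX (g : R -> R[i]) n : Rcontinuous g ->
  Rcontinuous (fun t => g t ^+ n).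
Proof.
move=> cg; elim: n => [|n IH]; first by move=> t; exact: lim0_cst.
by under eq_fun do rewrite exprS; exact: RcontinuousM.
Qed.

Lemma circ_sub_neq0 (b : R[i]) t : normc b < 1 -> circ t - b != 0.
Proof.
by move=> b1; rewrite -normc_gt0; have := normcB (circ t - b + b) b;
  rewrite addrK subrK normc_circ; have := normcD (circ t - b) b; rewrite subrK normc_circ; lra.
Qed.

Lemma Rderiv_circ_subV (b : R[i]) t : normc b < 1 ->
  Rderiv (fun t => (circ t - b)^-1) t (- (circ t - b) ^- 2 * ('i * circ t)).
Proof.
move=> b1; apply: gderivV; first exact: circ_sub_neq0.
by rewrite -['i * _]subr0; apply: gderivB; [exact: Rderiv_circ|exact: gderiv_cst].
Qed.

Lemma Rcontinuous_circ_subV (b : R[i]) : normc b < 1 ->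
  Rcontinuous (fun t => (circ t - b)^-1).
Proof. by move=> b1 t; exact: gderiv_cont (Rderiv_circ_subV t b1). Qed.

(** By the geometric series, whose terms but the first have mean zero. *)
Lemma circ_int_kernel (b : R[i]) : normc b < 1 ->
  circ_int (fun t => circ t * (circ t - b)^-1) = (2 * pi)%:C.
Proof.
move=> b1; pose u t := b * (circ t)^-1.
have cu : Rcontinuous u.
  by apply: RcontinuousM; [exact: Rcontinuous_cst|exact: Rcontinuous_circV].
pose K t := circ t * (circ t - b)^-1.
have cc : Rcontinuous circ by move=> t; exact: gderiv_cont (Rderiv_circ t).
have cK : Rcontinuous K by apply: RcontinuousM => //; exact: Rcontinuous_circ_subV.
have uK n t : u t ^+ n * K t = u t ^+ n + u t ^+ n.+1 * K t.
  have K1 : K t = 1 + u t * K t.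
    by rewrite /K /u; field; rewrite circ_neq0 circ_sub_neq0.
  by rewrite {1}K1 mulrDr mulr1 exprSr mulrA.
have Iu n : circ_int (fun t => u t ^+ n.+1) = 0.
  under eq_fun do rewrite /u exprMn.
  rewrite circ_intZ ?circ_int_expV ?mulr0//.
  by apply: RcontinuousX; exact: Rcontinuous_circV.
have H n : circ_int K = (2 * pi)%:C + circ_int (fun t => u t ^+ n.+1 * K t).
  elim: n => [|n ->].
    have -> : K = fun t => 1 + u t ^+ 1 * K t.
      by apply/funext => t; have := uK 0%N t; rewrite expr0 mul1r => {1}->.
    rewrite circ_intD; [|exact: Rcontinuous_cst|]; last first.
      by apply: RcontinuousM => //; exact: RcontinuousX.
    have -> : circ_int (fun=> 1) = (2 * pi)%:C.
      by rewrite (circ_intE (G := real_complex R)) ?subr0// => t; exact: Rderiv_id.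
    congr (_ + circ_int _); apply/funext => t; congr (_ * _).
    by have := uK 0%N t; rewrite expr0 mul1r => {1}->.
  have -> : (fun t => u t ^+ n.+1 * K t) = fun t => u t ^+ n.+1 + u t ^+ n.+2 * K t.
    by apply/funext => t; rewrite uK.
  rewrite circ_intD; [by rewrite Iu add0r|exact: RcontinuousX|].
  by apply: RcontinuousM => //; exact: RcontinuousX.
apply/eqP; rewrite -subr_eq0 -normc_le0; apply/ler_addgt0Pl => e e0; rewrite addr0.
have bnd n : normc (circ_int K - (2 * pi)%:C) <= normc b ^+ n.+1 * ((1 - normc b)^-1 * (2 * pi)).
  rewrite {1}(H n) addrC addKr mulrA; apply: circ_int_bound.
    by apply: RcontinuousM => //; exact: RcontinuousX.
  move=> t; rewrite normcM normcX /u normcM normcV normc_circ invr1 mulr1.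
  rewrite ler_wpM2l ?exprn_ge0 ?normc_ge0// /K normcM normc_circ mul1r normcV.
  rewrite lef_pV2 ?posrE ?subr_gt0 ?normc_gt0 ?circ_sub_neq0//.
  by have := normcD (circ t - b) b; rewrite subrK normc_circ; lra.
have C0 : 0 < (1 - normc b)^-1 * (2 * pi) :> R.
  by rewrite mulr_gt0 ?invr_gt0 ?subr_gt0// mulr_gt0// pi_gt0.
have : (fun n => normc b ^+ n) @ \oo --> (0 : R).
  by apply: cvg_expr; rewrite ger0_norm ?normc_ge0.
move=> /cvgrPdist_lt /(_ _ (divr_gt0 e0 C0)) [n _ Hn].
have := Hn n.+1 (leqnSn n); rewrite /= sub0r normrN ger0_norm ?exprn_ge0 ?normc_ge0//.
by rewrite ltr_pdivlMr// => /ltW; exact: le_trans.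
Qed.

Section holomorphic.
Variables (f f' : R[i] -> R[i]).
Hypothesis Df : forall z, Cderiv f z (f' z).

Let cf : Ccontinuous f. Proof. exact: Ccontinuous_deriv Df. Qed.

Lemma Rcontinuous_on_circ c : Rcontinuous (fun t => f (c + circ t)).
Proof.
apply: Ccontinuous_path => // t; apply: lim0D; first exact: lim0_cst.
exact: gderiv_cont (Rderiv_circ t).
Qed.

(** The difference quotient at [b], completed by the derivative there. *)
Lemma Cderiv_quotient b z : z != b -> exists l,
  Cderiv (fun z => if z == b then f' b else (f z - f b) / (z - b)) z l.
Proof.
move=> zb; have zb0 : z - b != 0 by rewrite subr_eq0.
have D1 : Cderiv (fun z => f z - f b) z (f' z).
  by rewrite -[f' z]subr0; apply: gderivB; [exact: Df|exact: gderiv_cst].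
have D2 : Cderiv (fun z => z - b) z 1.
  by rewrite -[1]subr0; apply: gderivB; [exact: Cderiv_id|exact: gderiv_cst].
have [q ql E] := gderivM D1 (gderivV (g := fun z => z - b) zb0 D2).
eexists; exists (fun h => if z + h == b then (f' b - (f z - f b) / (z - b)) / (b - z) else q h).
  move=> e /ql[d d0 Hd]; exists (Num.min d (normc (z - b))).
    by rewrite lt_min d0 normc_gt0.
  move=> h; rewrite lt_min => /andP[hd hb]; case: eqP => [zh|_]; last exact: Hd.
  by move: hb; rewrite -zh opprD addrA subrr sub0r normc_opp ltxx.
move=> h; rewrite (negbTE zb); case: eqP => [zh|_]; last exact: E.
have -> : h = b - z by rewrite -zh addrC addKr.
by rewrite divfK ?subr_eq0 1?eq_sym//; ring.
Qed.

Lemma Ccontinuous_quotient b :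
  Ccontinuous (fun z => if z == b then f' b else (f z - f b) / (z - b)).
Proof.
move=> z; have [->|zb] := eqVneq z b; last first.
  by have [l /gderiv_cont] := Cderiv_quotient zb; rewrite (negbTE zb).
move=> e e0; have [d d0 Hd] := gderiv_approx (Df b) e0.
exists d => // h hd; case: eqVneq => [_|bh]; first by rewrite subrr normc0 ltW.
have h0 : h != 0 by apply: contraNneq bh => ->; rewrite addr0.
have -> : (f (b + h) - f b) / (b + h - b) - f' b = (f (b + h) - f b - f' b * h) / h.
  by rewrite [b + h]addrC addrK; field.
by rewrite normcM normcV ler_pdivrMr ?normc_gt0// Hd.
Qed.

(** The completed difference quotient at [c + b] is continuous, and holomorphic
    off that point, so it has a primitive and integral zero along the circle. *)
Lemma cauchy_formula c b : normc b < 1 ->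
  circ_int (fun t => f (c + circ t) * (circ t * (circ t - b)^-1)) =
  (2 * pi)%:C * f (c + b).
Proof.
move=> b1; pose D z := if z == c + b then f' (c + b)
  else (f z - f (c + b)) / (z - (c + b)).
have [G DG] : exists G, forall z, Cderiv G z (D z).
  apply: (@primitive_off_point _ D (c + b)); first exact: Ccontinuous_quotient.
  exact: Cderiv_quotient.
have DGc t : Rderiv (fun t => G (c + circ t)) t (D (c + circ t) * ('i * circ t)).
  apply: gderiv_comp; first exact: DG.
  by rewrite -['i * _]add0r; apply: gderivD; [exact: gderiv_cst|exact: Rderiv_circ].
have cc : Rcontinuous circ by move=> t; exact: gderiv_cont (Rderiv_circ t).
have cK : Rcontinuous (fun t => circ t * (circ t - b)^-1).
  by apply: RcontinuousM => //; exact: Rcontinuous_circ_subV.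
have E0 : circ_int (fun t => D (c + circ t) * ('i * circ t)) = 0.
  by rewrite (circ_intE DGc) circ_period subrr.
have i0 : 'i != 0 :> R[i] by rewrite -normc_gt0 normci.
have -> : (fun t => f (c + circ t) * (circ t * (circ t - b)^-1)) =
    fun t => 'i^-1 * (D (c + circ t) * ('i * circ t)) +
      f (c + b) * (circ t * (circ t - b)^-1).
  apply/funext => t; have h := circ_sub_neq0 t b1.
  rewrite /D; case: eqVneq => [/addrI E|_].
    by move: h; rewrite E subrr eqxx.
  have -> : c + circ t - (c + b) = circ t - b by ring.
  by field; rewrite i0 h.
rewrite circ_intD; last 2 first.
- apply: RcontinuousM; first exact: Rcontinuous_cst.
  apply: RcontinuousM; last by apply: RcontinuousM => //; exact: Rcontinuous_cst.
  apply: (Ccontinuous_path (f := D) (g := fun t => c + circ t)).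
    exact: Ccontinuous_quotient.
  exact: RcontinuousD (Rcontinuous_cst c) cc.
- by apply: RcontinuousM => //; exact: Rcontinuous_cst.
rewrite !circ_intZ//; last first.
  apply: RcontinuousM; last by apply: RcontinuousM => //; exact: Rcontinuous_cst.
  apply: (Ccontinuous_path (f := D) (g := fun t => c + circ t)).
    exact: Ccontinuous_quotient.
  exact: RcontinuousD (Rcontinuous_cst c) cc.
by rewrite E0 mulr0 add0r circ_int_kernel// mulrC.
Qed.

Lemma circ_sub_ge (b : R[i]) t (r : R) : normc b <= r -> 1 - r <= normc (circ t - b).
Proof.
by have := normcD (circ t - b) b; rewrite subrK normc_circ; lra.
Qed.

(** Cauchy's formula for the derivative, by expansion of the kernel in [b] up to
    second order. *)
Lemma cauchy_formula1 c b : normc b < 1 / 2 ->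
  (2 * pi)%:C * f' (c + b) =
  circ_int (fun t => f (c + circ t) * (circ t * (circ t - b) ^- 2)).
Proof.
move=> b2; have b1 : normc b < 1 by lra.
set J := circ_int _.
have pi0 : (2 * pi)%:C != 0 :> R[i].
  by rewrite -normc_eq0 normc_real gt_eqF// normr_gt0 mulf_neq0// gt_eqF// pi_gt0.
suff D : Cderiv f (c + b) (J / (2 * pi)%:C).
  by rewrite (Cderiv_unique (Df _) D) mulrC divfK.
have [M0 HM0] := bounded_disc (normc c + 1) cf.
pose M := Num.max 1 M0.
have M1 : 0 < M by rewrite lt_max ltr01.
have HM t : normc (f (c + circ t)) <= M.
  by rewrite le_max HM0 ?orbT// (le_trans (normcD _ _))// normc_circ.
have pi1 : 0 < 2 * pi :> R by rewrite mulr_gt0// pi_gt0.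
apply: approx_gderiv => e e0.
exists (Num.min (1 / 4) (e / (16 * M))).
  by rewrite lt_min !divr_gt0// mulr_gt0.
move=> k; rewrite lt_min => /andP[k4 ke].
have bk1 : normc (b + k) < 1 by have := normcD b k; lra.
have cc : Rcontinuous circ by move=> t; exact: gderiv_cont (Rderiv_circ t).
have cfc := Rcontinuous_on_circ c.
have cV (a : R[i]) : normc a < 1 -> Rcontinuous (fun t => (circ t - a)^-1).
  exact: Rcontinuous_circ_subV.
pose A t := f (c + circ t) * (circ t * (circ t - b)^-1).
pose B t := f (c + circ t) * (circ t * (circ t - b) ^- 2).
pose E t := f (c + circ t) * circ t * ((circ t - b)^-1 ^+ 2 * (circ t - (b + k))^-1).
have cA : Rcontinuous A by do 2 apply: RcontinuousM => //; exact: cV.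
have cB : Rcontinuous B.
  rewrite /B; under eq_fun do rewrite -exprVn.
  by do 2 apply: RcontinuousM => //; apply: RcontinuousX; exact: cV.
have cE : Rcontinuous E.
  apply: RcontinuousM; first exact: RcontinuousM.
  by apply: RcontinuousM; [apply: RcontinuousX|]; exact: cV.
have key : (2 * pi)%:C * f (c + b + k) =
    (2 * pi)%:C * f (c + b) + k * J + k ^+ 2 * circ_int E.
  rewrite -addrA -(cauchy_formula c bk1) -(cauchy_formula c b1) -/A /J -/B.
  rewrite -!circ_intZ// -!circ_intD; try by rcont.
  congr circ_int; apply/funext => t; rewrite /A /B /E; field.
  by rewrite (circ_sub_neq0 t b1) (circ_sub_neq0 t bk1).
have -> : f (c + b + k) - f (c + b) - J / (2 * pi)%:C * k =
    k ^+ 2 * (circ_int E / (2 * pi)%:C).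
  move: pi0 key; move: ((2 * pi)%:C) => P P0 key.
  by apply: (mulfI P0); rewrite mulrBr mulrBr key; field.
rewrite normcM normcX expr2 -mulrA mulrC.
rewrite ler_wpM2r ?normc_ge0//.
have : normc (circ_int E / (2 * pi)%:C) <= 16 * M.
  rewrite normcM normcV normc_real gtr0_norm// ler_pdivrMr//.
  apply: circ_int_bound => // t; rewrite /E normcM normcM normc_circ mulr1.
  rewrite (normcM (_ ^+ 2)) normcX !normcV.
  have h1 := circ_sub_ge t (ltW b2).
  have h2 : 1 - 3/4 <= normc (circ t - (b + k)).
    by apply: circ_sub_ge; have := normcD b k; lra.
  have n1 : (normc (circ t - b))^-1 <= 2.
    by rewrite -[2]invrK lef_pV2 ?posrE; lra.
  have n2 : (normc (circ t - (b + k)))^-1 <= 4.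
    by rewrite -[4]invrK lef_pV2 ?posrE; lra.
  rewrite mulrC ler_pM// ?normc_ge0//.
    by rewrite mulr_ge0 ?exprn_ge0 ?invr_ge0 ?normc_ge0.
  have -> : 16 = 2 ^+ 2 * 4 :> R by ring.
  rewrite ler_pM ?exprn_ge0 ?invr_ge0 ?normc_ge0//.
  by rewrite lerXn2r ?nnegrE ?invr_ge0 ?normc_ge0.
move=> h; rewrite mulrC (le_trans (ler_wpM2r (normc_ge0 _) h))//.
by move: ke; rewrite ltr_pdivlMr ?mulr_gt0// mulrC => /ltW.
Qed.

Lemma cauchy_estimate c (M : R) :
  (forall z, normc (z - c) <= 1 -> normc (f z) <= M) -> normc (f' c) <= M.
Proof.
move=> H.
have pi1 : 0 < 2 * pi :> R by rewrite mulr_gt0// pi_gt0.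
have := @cauchy_formula1 c 0; rewrite normc0 addr0 => /(_ _) E.
rewrite -(@ler_pM2r _ (2 * pi))//.
have -> : normc (f' c) * (2 * pi) = normc ((2 * pi)%:C * f' c).
  by rewrite normcM normc_real gtr0_norm// mulrC.
rewrite E; last by lra.
apply: circ_int_bound => [|t].
  under eq_fun do rewrite subr0 -exprVn; apply: RcontinuousM.
    exact: Rcontinuous_on_circ.
  apply: RcontinuousM; first by move=> t; exact: gderiv_cont (Rderiv_circ t).
  exact/RcontinuousX/Rcontinuous_circV.
rewrite subr0 !normcM normcV normcX normc_circ expr1n invr1 !mulr1.
by apply: H; rewrite addrC addKr normc_circ.
Qed.

(** The derivative is again holomorphic, by expansion of the kernel of
    [cauchy_formula1]. *)
Lemma holomorphic_deriv : exists f'' : R[i] -> R[i], forall z, Cderiv f' z (f'' z).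
Proof.
suff H z : exists l, Cderiv f' z l by have [f'' ?] := choice H; exists f''.
have pi1 : 0 < 2 * pi :> R by rewrite mulr_gt0// pi_gt0.
have pi0 : (2 * pi)%:C != 0 :> R[i].
  by rewrite -normc_eq0 normc_real gt_eqF// normr_gt0 gt_eqF.
have [M0 HM0] := bounded_disc (normc z + 1) cf.
pose M := Num.max 1 M0.
have M1 : 0 < M by rewrite lt_max ltr01.
have HM t : normc (f (z + circ t)) <= M.
  by rewrite le_max HM0 ?orbT// (le_trans (normcD _ _))// normc_circ.
have cc : Rcontinuous circ by move=> t; exact: gderiv_cont (Rderiv_circ t).
have cfc := Rcontinuous_on_circ z.
pose A t := f (z + circ t) * (circ t * (circ t)^-1 ^+ 2).
pose B t := f (z + circ t) * (circ t * (circ t)^-1 ^+ 3).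
have cX n : Rcontinuous (fun t => f (z + circ t) * (circ t * (circ t)^-1 ^+ n)).
  by do 2 apply: RcontinuousM => //; apply: RcontinuousX; exact: Rcontinuous_circV.
exists (2 * circ_int B / (2 * pi)%:C).
apply: approx_gderiv => e e0.
exists (Num.min (1 / 4) (e / (16 * M))).
  by rewrite lt_min !divr_gt0// mulr_gt0.
move=> h; rewrite lt_min => /andP[h4 he].
pose E t := f (z + circ t) * ((circ t * (circ t)^-1 ^+ 3) *
  ((3 * circ t - 2 * h) * (circ t - h)^-1 ^+ 2)).
have h1 : normc h < 1 by lra.
have cE : Rcontinuous E.
  apply: RcontinuousM => //; apply: RcontinuousM.
    by apply: RcontinuousM => //; apply: RcontinuousX; exact: Rcontinuous_circV.
  apply: RcontinuousM; last by apply: RcontinuousX; exact: Rcontinuous_circ_subV.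
  apply: RcontinuousD; last exact: Rcontinuous_cst.
  by apply: RcontinuousM => //; exact: Rcontinuous_cst.
have key : (2 * pi)%:C * f' (z + h) =
    (2 * pi)%:C * f' z + 2 * h * circ_int B + h ^+ 2 * circ_int E.
  have h12 : normc h < 1 / 2 by lra.
  have -> : (2 * pi)%:C * f' z = circ_int A.
    have := @cauchy_formula1 z 0; rewrite normc0 addr0 => -> //.
    by congr circ_int; apply/funext => t; rewrite subr0 /A exprVn.
  rewrite (cauchy_formula1 z h12).
  have [cA cB] : Rcontinuous A /\ Rcontinuous B by split; exact: cX.
  rewrite -!circ_intZ// -!circ_intD; try by rcont.
  congr circ_int; apply/funext => t; rewrite /A /B /E; field.
  by rewrite circ_sub_neq0// circ_neq0.
have -> : f' (z + h) - f' z - 2 * circ_int B / (2 * pi)%:C * h =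
    h ^+ 2 * (circ_int E / (2 * pi)%:C).
  move: pi0 key; move: ((2 * pi)%:C) => P P0 key.
  by apply: (mulfI P0); rewrite mulrBr mulrBr key; field.
rewrite normcM normcX expr2 -mulrA mulrC.
rewrite ler_wpM2r ?normc_ge0//.
have : normc (circ_int E / (2 * pi)%:C) <= 16 * M.
  rewrite normcM normcV normc_real gtr0_norm// ler_pdivrMr//.
  apply: circ_int_bound => // t; rewrite /E normcM (normcM (circ t * _)) (normcM (circ t)).
  rewrite (normcM (3 * circ t - _)) !normcX !normcV normc_circ mul1r.
  rewrite invr1 expr1n mul1r.
  have g1 : 1 - 1/2 <= normc (circ t - h) by apply: circ_sub_ge; lra.
  have n1 : (normc (circ t - h))^-1 <= 2.
    by rewrite -[2]invrK lef_pV2 ?posrE; lra.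
  rewrite mulrC ler_pM// ?normc_ge0//.
    by rewrite mulr_ge0 ?exprn_ge0 ?invr_ge0 ?normc_ge0.
  have -> : 16 = 4 * 2 ^+ 2 :> R by ring.
  rewrite ler_pM ?exprn_ge0 ?invr_ge0 ?normc_ge0//.
    rewrite (le_trans (normcB _ _))// !normcM normc_circ.
    have -> : 3 = (3:R)%:C by rewrite rmorph_nat.
    have -> : 2 = (2:R)%:C by rewrite rmorph_nat.
    rewrite !normc_real !ger0_norm//; lra.
  by rewrite lerXn2r ?nnegrE ?invr_ge0 ?normc_ge0.
move=> k; rewrite mulrC (le_trans (ler_wpM2r (normc_ge0 _) k))//.
by move: he; rewrite ltr_pdivlMr ?mulr_gt0// mulrC => /ltW.
Qed.

(** A zero at the origin can be divided out; the quotient is differentiable at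
    the origin by the second order Taylor estimate for [f]. *)
Lemma divide_zero : f 0 = 0 -> exists g g' : R[i] -> R[i],
  [/\ forall z, Cderiv g z (g' z), forall z, f z = z * g z & g 0 = f' 0].
Proof.
move=> f0; have [f'' Df'] := holomorphic_deriv.
pose g z := if z == 0 then f' 0 else (f z - f 0) / (z - 0).
suff H z : exists l, Cderiv g z l.
  have [g' Hg] := choice H; exists g, g'; split => //; last by rewrite /g eqxx.
  move=> z; rewrite /g; have [->|z0] := eqVneq z 0; first by rewrite f0 mul0r.
  by rewrite f0 !subr0 mulrC divfK.
have [->|z0] := eqVneq z 0; last exact: Cderiv_quotient.
exists (f'' 0 / 2); apply: approx_gderiv => e e0.
have [d d0 Hd] := gderiv_approx (Df' 0) e0.
exists d => // h hd; rewrite add0r /g eqxx.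
have [->|h0] := eqVneq h 0; first by rewrite subrr mulr0 subr0 normc0 mulr0.
rewrite f0 !subr0.
pose k (t : R) := f (t%:C * h) - f' 0 * (t%:C * h) - f'' 0 / 2 * (t%:C * h) ^+ 2.
pose k' (t : R) := (f' (t%:C * h) - f' 0 - f'' 0 * (t%:C * h)) * h.
have Dth t : Rderiv (fun t : R => t%:C * h) t h.
  by have := gderivM (Rderiv_id t) (gderiv_cst (real_complex R) h t);
    rewrite mul1r mulr0 addr0.
have Dk t : Rderiv k t (k' t).
  have := gderivB (gderivB (gderiv_comp (Df _) (Dth t)) (gderivZ (f' 0) (Dth t)))
    (gderivZ (f'' 0 / 2) (gderivX 2 (Dth t))).
  by move=> D; apply: gderiv_eq D _; rewrite /k' /=; field.
have : normc (k 1 - k 0) <= (e * normc h * normc h) * (1 - 0).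
  apply: (mean_value_cst ler01 (fun t _ => Dk t)) => t /andP[t0 t1].
  rewrite /k' normcM ler_wpM2r ?normc_ge0//.
  have nth : normc (t%:C * h) <= normc h.
    by rewrite normcM normc_real ger0_norm// ler_piMl ?normc_ge0.
  have := Hd (t%:C * h); rewrite add0r => /(_ (le_lt_trans nth hd)) H.
  by rewrite (le_trans H)// ler_wpM2l// ltW.
rewrite /k !mul1r !mul0r f0 !expr0n /= !mulr0 !subr0 mulr1.
have -> : f h / h - f' 0 - f'' 0 / 2 * h = (f h - f' 0 * h - f'' 0 / 2 * h ^+ 2) / h.
  by field.
by move=> E; rewrite normcM normcV ler_pdivrMr ?normc_gt0.
Qed.

End holomorphic.

End Cauchy.

(** * Entire functions of exponential growth *)

Section Cexp.
Context {R : realType}.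

(** The complex exponential. *)
Definition cexp (z : R[i]) : R[i] := (expR (complex.Re z))%:C * circ (complex.Im z).

Lemma normc_cexp z : normc (cexp z) = expR (complex.Re z).
Proof. by rewrite normcM normc_circ mulr1 normc_real gtr0_norm// expR_gt0. Qed.

Lemma cexp0 : cexp 0 = 1.
Proof. by rewrite /cexp /circ /cpt /= expR0 cos0 sin0 mulr0 addr0 mulr1. Qed.

Lemma circD s t : circ (s + t) = circ s * circ t :> R[i].
Proof.
rewrite /circ /cpt cosD sinD !(rmorphD, rmorphB, rmorphM).
set a := (cos s)%:C; set b := (sin s)%:C; set c := (cos t)%:C; set d := (sin t)%:C.
have -> : (a + 'i * b) * (c + 'i * d) =
  a * c + ('i * 'i) * (b * d) + 'i * (b * c + a * d) by ring.
by rewrite i_sqr; ring.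
Qed.

Lemma cexpD z w : cexp (z + w) = cexp z * cexp w.
Proof. by rewrite /cexp Re_add Im_add expRD circD rmorphM; ring. Qed.

Lemma Cderiv_cexp z : Cderiv cexp z (cexp z).
Proof.
suff D0 : Cderiv cexp 0 1.
  apply: approx_gderiv => e e0.
  have n0 : 0 < normc (cexp z) by rewrite normc_cexp expR_gt0.
  have [d d0 Hd] := gderiv_approx D0 (divr_gt0 e0 n0).
  exists d => // h /Hd; rewrite add0r cexp0 mul1r cexpD => H.
  have -> : cexp z * cexp h - cexp z - cexp z * h = cexp z * (cexp h - 1 - h) by ring.
  rewrite normcM (le_trans (ler_wpM2l (normc_ge0 _) H))// mulrA.
  by rewrite [_ * (e / _)]mulrC divfK// gt_eqF.
apply: approx_gderiv => e0 e00.
have [e [ep e9 e1]] : exists e : R, [/\ 0 < e, e * 9 <= e0 & e <= 1].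
  exists (Num.min (e0 / 9) 1); split; first by rewrite lt_min divr_gt0//=.
    by rewrite -ler_pdivlMr// ge_min lexx.
  by rewrite ge_min lexx orbT.
have /is_derive_approx/(_ e ep)[d1 d10 H1] : is_derive (0:R) (1:R) expR (expR 0).
  exact: is_derive_expR.
have /is_derive_approx/(_ e ep)[d2 d20 H2] := is_derive_cos (0:R).
have /is_derive_approx/(_ e ep)[d3 d30 H3] := is_derive_sin (0:R).
exists (Num.min e (Num.min d1 (Num.min d2 d3))); first by rewrite !lt_min ep d10 d20.
move=> h; rewrite !lt_min => /and4P[he hd1 hd2 hd3].
rewrite add0r cexp0 mul1r; set x := complex.Re h; set y := complex.Im h.
have xh : `|x| <= normc h by exact: le_Re_normc.
have yh : `|y| <= normc h by exact: le_Im_normc.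
have := H3 y (le_lt_trans yh hd3); have := H2 y (le_lt_trans yh hd2).
have := H1 x (le_lt_trans xh hd1).
rewrite !add0r expR0 cos0 sin0 oppr0 mul0r !mul1r !(subr0, addr0).
set r1 := expR x - 1 - x; set r2 := cos y - 1; set r3 := sin y - y => b1 b2 b3.
have Ex : `|expR x| <= 3.
  have -> : expR x = r1 + 1 + x by rewrite /r1; ring.
  rewrite (le_trans (ler_normD _ _))// (_ : 3 = 2 + 1); last by ring.
  have x1 : `|x| <= 1 by rewrite (le_trans xh)// (le_trans (ltW he)).
  apply: lerD => //; rewrite (le_trans (ler_normD _ _))// normr1 lerD2r.
  rewrite (le_trans b1)// -[1]mulr1 ler_pM// ltW//.
have -> : cexp h - 1 - h = (r1 + expR x * r2)%:C +
    'i * (expR x * r3 + (x + r1) * y)%:C.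
  rewrite [X in _ - X = _](real_imagE h) /cexp /circ /cpt -/x -/y.
  have -> : x + r1 = expR x - 1 by rewrite /r1; ring.
  have -> : r1 + expR x * r2 = expR x * cos y - 1 - x by rewrite /r1 /r2; ring.
  have -> : expR x * r3 + (expR x - 1) * y = expR x * sin y - y by rewrite /r3; ring.
  by rewrite !(rmorphB, rmorphM) rmorph1; ring.
rewrite (le_trans (normcD _ _))// normcM normci mul1r !normc_real.
have n0 := normc_ge0 h.
have P1 : `|r1 + expR x * r2| <= e * normc h + 3 * (e * normc h).
  rewrite (le_trans (ler_normD _ _))// lerD//.
    by rewrite (le_trans b1)// ler_pM2l.
  by rewrite normrM ler_pM// (le_trans b2)// ler_pM2l.
have P2 : `|expR x * r3 + (x + r1) * y| <= 3 * (e * normc h) + 2 * (e * normc h).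
  rewrite (le_trans (ler_normD _ _))// lerD//.
    by rewrite normrM ler_pM// (le_trans b3)// ler_pM2l.
  rewrite normrM mulrA ler_pM//.
  rewrite (le_trans (ler_normD _ _))// (_ : 2 * e = e + e * 1); last by ring.
  rewrite lerD//; first exact: le_trans xh (ltW he).
  rewrite (le_trans b1)// ler_pM2l// (le_trans xh)// (le_trans (ltW he))//.
have : e * 9 * normc h <= e0 * normc h by rewrite ler_wpM2r.
lra.
Qed.

Lemma cexp_dist (z : R[i]) : complex.Re z <= 0 ->
  normc (cexp z - 1) <= 2 /\ normc (cexp z - 1) <= normc z.
Proof.
move=> z0; split.
  rewrite (le_trans (normcB _ _))// normc_cexp normc1.
  by rewrite (_ : 2 = 1 + 1 :> R)// lerD2r -expR0 ler_expR.
pose k (t : R) := cexp (t%:C * z).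
have Dk t : Rderiv k t (cexp (t%:C * z) * z).
  apply: gderiv_comp; first exact: Cderiv_cexp.
  by have := gderivM (Rderiv_id t) (gderiv_cst (real_complex R) z t);
    rewrite mul1r mulr0 addr0.
have : normc (k 1 - k 0) <= normc z * (1 - 0).
  apply: (mean_value_cst ler01 (fun t _ => Dk t)) => t /andP[t0 _].
  rewrite normcM normc_cexp Re_realM.
  by rewrite ler_piMl ?normc_ge0// -expR0 ler_expR mulr_ge0_le0.
by rewrite /k mul1r mul0r cexp0 subr0 mulr1.
Qed.

(** Entire functions of at most exponential growth. *)
Definition exp_entire (f : R[i] -> R[i]) :=
  (exists f', forall z, Cderiv f z (f' z)) /\
  (exists2 C : R, 0 <= C & forall z, normc (f z) <= C * expR (C * normc z)).

Lemma exp_growth_le (a b : R) z : 0 <= a -> a <= b ->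
  a * expR (a * normc z) <= b * expR (b * normc z).
Proof.
move=> a0 ab; rewrite ler_pM ?expR_ge0// ler_expR.
by rewrite ler_wpM2r ?normc_ge0.
Qed.

Lemma exp_entire_cst (c : R[i]) : exp_entire (fun=> c).
Proof.
split; first by exists (fun=> 0) => z; exact: gderiv_cst.
exists (normc c); first exact: normc_ge0.
move=> z; rewrite ler_peMr ?normc_ge0// -expR0 ler_expR.
by rewrite mulr_ge0 ?normc_ge0.
Qed.

Lemma exp_entire_id : exp_entire id.
Proof.
split; first by exists (fun=> 1) => z; exact: Cderiv_id.
exists 1 => // z; rewrite !mul1r.
by have := expR_ge1Dx (normc z); lra.
Qed.

Lemma exp_entireD f g : exp_entire f -> exp_entire g ->
  exp_entire (fun z => f z + g z).
Proof.
move=> [[f' Df] [C C0 Hf]] [[g' Dg] [D D0 Hg]]; split.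
  by exists (fun z => f' z + g' z) => z; apply: gderivD; [exact: Df|exact: Dg].
exists (C + D); first by rewrite addr_ge0.
move=> z; rewrite (le_trans (normcD _ _))// mulrDl lerD//.
  rewrite (le_trans (Hf z))// ler_wpM2l// ler_expR ler_wpM2r ?normc_ge0//; lra.
rewrite (le_trans (Hg z))// ler_wpM2l// ler_expR ler_wpM2r ?normc_ge0//; lra.
Qed.

Lemma exp_entireN f : exp_entire f -> exp_entire (fun z => - f z).
Proof.
move=> [[f' Df] [C C0 Hf]]; split.
  by exists (fun z => - f' z) => z; apply: gderivN; exact: Df.
by exists C => // z; rewrite normc_opp.
Qed.

Lemma exp_entireM f g : exp_entire f -> exp_entire g ->
  exp_entire (fun z => f z * g z).
Proof.
move=> [[f' Df] [C C0 Hf]] [[g' Dg] [D D0 Hg]]; split.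
  by exists (fun z => f' z * g z + f z * g' z) => z; apply: gderivM; [exact: Df|exact: Dg].
exists (C + D + C * D); first by rewrite !addr_ge0// mulr_ge0.
move=> z; rewrite normcM (le_trans (ler_pM (normc_ge0 _) (normc_ge0 _) (Hf z) (Hg z)))//.
rewrite mulrACA -expRD; have CD := mulr_ge0 C0 D0.
rewrite ler_pM ?expR_ge0//; first lra.
by rewrite ler_expR -mulrDl ler_wpM2r ?normc_ge0//; lra.
Qed.

Lemma exp_entireX f n : exp_entire f -> exp_entire (fun z => f z ^+ n).
Proof.
move=> ef; elim: n => [|n IH]; first exact: exp_entire_cst.
under eq_fun do rewrite exprS; exact: exp_entireM.
Qed.

Lemma exp_entire_lin f (c d : R[i]) : exp_entire f ->
  exp_entire (fun z => f (c * z + d)).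
Proof.
move=> [[f' Df] [C C0 Hf]]; split.
  exists (fun z => f' (c * z + d) * (c * 1 + 0)) => z; apply: gderiv_comp => //.
  by apply: gderivD; [apply: gderivZ; exact: Cderiv_id|exact: gderiv_cst].
pose D := C * expR (C * normc d) + C * normc c.
have CD : 0 <= C * normc c by rewrite mulr_ge0 ?normc_ge0.
have CE : 0 <= C * expR (C * normc d) by rewrite mulr_ge0 ?expR_ge0.
exists D; first by rewrite addr_ge0.
move=> z; rewrite (le_trans (Hf _))//.
apply: (@le_trans _ _ (C * expR (C * normc d) * expR (C * normc c * normc z))).
  rewrite -mulrA -expRD ler_wpM2l// ler_expR -mulrA -mulrDr ler_wpM2l//.
  by rewrite (le_trans (normcD _ _))// normcM addrC.
rewrite ler_pM ?expR_ge0// /D ?lerDl// ler_expR ler_wpM2r ?normc_ge0//.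
by rewrite lerDr.
Qed.

Lemma exp_entire_cexp (c : R[i]) : exp_entire (fun z => cexp (c * z)).
Proof.
have : exp_entire cexp.
  split; first by exists cexp => z; exact: Cderiv_cexp.
  exists 1 => // z; rewrite !mul1r normc_cexp ler_expR.
  exact: Re_le_normc.
move=> /(exp_entire_lin c 0).
by under eq_fun do rewrite addr0.
Qed.

(** Dividing out a zero at the origin preserves exponential growth. *)
Lemma exp_entire_divide f f' : exp_entire f -> (forall z, Cderiv f z (f' z)) ->
  f 0 = 0 -> exists g, [/\ exp_entire g, forall z, f z = z * g z & g 0 = f' 0].
Proof.
move=> ef Df f0; have [g [g' [Dg fg g0]]] := divide_zero Df f0.
exists g; split => //; split; first by exists g'.
have [M0 HM0] := bounded_disc 1 (Ccontinuous_deriv Dg).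
have [_ [C C0 Hf]] := ef.
pose M := Num.max M0 C.
exists M; first by rewrite le_max C0 orbT.
move=> z; have [z1|z1] := leP (normc z) 1.
  apply: (@le_trans _ _ M); first by rewrite le_max HM0.
  have M0' : 0 <= M by rewrite le_max C0 orbT.
  by rewrite ler_peMr// -expR0 ler_expR mulr_ge0 ?normc_ge0.
apply: (@le_trans _ _ (normc (f z))).
  by rewrite fg normcM ler_peMl ?normc_ge0// ltW.
by rewrite (le_trans (Hf z))// exp_growth_le// le_max lexx orbT.
Qed.

End Cexp.

(** * Rotation of the contour *)

Section Rotation.
Context {R : realType}.

Lemma atan_lt2 (x : R) : atan x < 2.
Proof.
exact: lt_trans (atan_ltpi2 x) (pihalf_lt2 R).
Qed.

Lemma exp_sqr_decay (X : R) : 0 < X -> X ^+ 2 * expR (- X) <= 27 / X.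
Proof.
move=> X0; rewrite expRN ler_pdivlMr// mulrAC -exprSr ler_pdivrMr ?expR_gt0//.
have -> : expR X = expR (X / 3) ^+ 3.
  by rewrite -expRM_natl; congr expR; field.
have -> : X ^+ 3 = 27 * (X / 3) ^+ 3 by field.
rewrite ler_pM2l// lerXn2r ?nnegrE ?expR_ge0 ?divr_ge0 ?ltW//.
by have := expR_ge1Dx (X / 3); lra.
Qed.

Section quadrant.
Variables (f P : R[i] -> R[i]) (C : R).
Hypothesis C0 : 0 <= C.
Hypothesis ef : exp_entire f.
Hypothesis DP : forall z, Cderiv P z (f z).

(** After the substitution [z = w ^+ 2] the quadrant becomes the sector
    [0 <= Im w <= Re w]. The real part of [(2 i - 1) * w ^+ 3] is at most
    [- Re w ^+ 3] there, so this factor decays faster than any exponential of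
    [normc w ^+ 2] grows; it tends to 1 as [h] tends to 0. *)
Let damp (h : R) (w : R[i]) := cexp ((h ^+ 3)%:C * ((2 * 'i - 1) * w ^+ 3)).

Let exp_entire_fsqr (h : R) : exists f', forall w,
  Cderiv (fun w => 2 * w * f (w ^+ 2) * damp h w) w (f' w).
Proof.
have [[f' Df] _] := ef.
suff H w : exists l, Cderiv (fun w => 2 * w * f (w ^+ 2) * damp h w) w l.
  by have [f1 Df1] := choice H; exists f1.
eexists; apply: gderivM.
  apply: gderivM; first by apply: gderivZ; exact: Cderiv_id.
  by apply: gderiv_comp; [exact: Df|apply: gderivX; exact: Cderiv_id].
apply: gderiv_comp; first exact: Cderiv_cexp.
by do 2 apply: gderivZ; apply: gderivX; exact: Cderiv_id.
Qed.

(** Along a side of the sector the damping changes the integral by [O(h)]. *)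
Let ray (h : R) (Q : R[i] -> R[i]) (u : R[i]) : 0 < h ->
  (forall w, Cderiv Q w (2 * w * f (w ^+ 2) * damp h w)) ->
  normc u = 1 -> complex.Re ((2 * 'i - 1) * u ^+ 3) <= 0 ->
  (forall t : R, 0 <= t -> normc (f (u ^+ 2 * t%:C)) <= C / (1 + t ^+ 2)) ->
  forall r : R, 0 <= r -> normc (Q (r%:C * u) - P ((r%:C * u) ^+ 2) - (Q 0 - P 0))
    <= 24 * C * h.
Proof.
move=> h0 DQ u1 Ru Hf r r0.
have Dr (t : R) : Rderiv (fun t : R => t%:C * u) t u.
  by have := gderivM (Rderiv_id t) (gderiv_cst (real_complex R) u t);
    rewrite mul1r mulr0 addr0.
pose k (t : R) := Q (t%:C * u) - P ((t%:C * u) ^+ 2).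
pose k' (t : R) := 2 * (t%:C * u) * f ((t%:C * u) ^+ 2) * (damp h (t%:C * u) - 1) * u.
have Dk t : Rderiv k t (k' t).
  have := gderivB (gderiv_comp (DQ _) (Dr t)) (gderiv_comp (DP _) (gderivX 2 (Dr t))).
  by move=> D; apply: gderiv_eq D _; rewrite /k' /=; ring.
have -> : Q (r%:C * u) - P ((r%:C * u) ^+ 2) - (Q 0 - P 0) = k r - k 0.
  by rewrite /k mul0r expr0n.
apply: (@le_trans _ _ (12 * C * h * atan r - 12 * C * h * atan 0)); last first.
  rewrite atan0 mulr0 subr0 (_ : 24 * C * h = 12 * C * h * 2); last by ring.
  by rewrite ler_wpM2l ?(ltW (atan_lt2 _))// !mulr_ge0// ltW.
apply: (@mean_value _ k k' (fun t => 12 * C * h * atan t)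
   (fun t => 12 * C * h * (1 + t ^+ 2)^-1) _ _ r0 (fun t _ => Dk t)).
move=> t /andP[t0 _]; rewrite /k' !normcM u1 normc_real (ger0_norm t0) !mulr1.
have -> : normc (2 : R[i]) = 2.
  by have := @normc_real R 2; rewrite rmorph_nat ger0_norm.
rewrite exprMn mulrAC [_ ^+ 2 * _]mulrC -[t%:C ^+ 2]rmorphXn.
have F := Hf (t ^+ 2) (sqr_ge0 t).
have D3 : normc (damp h (t%:C * u) - 1) <= 3 * h * t.
  have Rez : complex.Re ((h ^+ 3)%:C * ((2 * 'i - 1) * (t%:C * u) ^+ 3)) <= 0.
    have -> : (h ^+ 3)%:C * ((2 * 'i - 1) * (t%:C * u) ^+ 3) =
        (h ^+ 3 * t ^+ 3)%:C * ((2 * 'i - 1) * u ^+ 3).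
      by rewrite exprMn !(rmorphM, rmorphXn); ring.
    by rewrite Re_realM mulr_ge0_le0// mulr_ge0// exprn_ge0// ltW.
  have [d1 d2] := cexp_dist Rez.
  have [ht|ht] := leP (h * t) 1; last by rewrite (le_trans d1)//; lra.
  rewrite (le_trans d2)// normcM (normcM (2 * 'i - 1)) normcX (normcM t%:C) u1 mulr1 !normc_real.
  have n3 : normc (2 * 'i - 1 : R[i]) <= 3.
    rewrite (le_trans (normcB _ _))// normcM normci normc1.
    by have := @normc_real R 2; rewrite rmorph_nat ger0_norm// => ->; lra.
  rewrite (ger0_norm (exprn_ge0 _ (ltW h0))) (ger0_norm t0).
  have -> : h ^+ 3 * (normc (2 * 'i - 1 : R[i]) * t ^+ 3) =
    normc (2 * 'i - 1 : R[i]) * (h * t) ^+ 3 by ring.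
  rewrite -mulrA ler_pM ?normc_ge0 ?exprn_ge0 ?mulr_ge0 ?(ltW h0)//.
  by rewrite exprS ler_piMr ?mulr_ge0 ?(ltW h0)// exprn_ile1// mulr_ge0// ltW.
apply: (@le_trans _ _ ((3 * h * t) * (C / (1 + (t ^+ 2) ^+ 2)) * (2 * t))).
  have -> : 3 * h * t * (C / (1 + (t ^+ 2) ^+ 2)) * (2 * t) =
      2 * t * (3 * h * t) * (C / (1 + (t ^+ 2) ^+ 2)) by ring.
  apply: ler_pM => //.
  - by rewrite mulr_ge0 ?normc_ge0// mulr_ge0.
  - exact: normc_ge0.
  - by rewrite ler_wpM2l// mulr_ge0.
have p1 : 0 < 1 + (t ^+ 2) ^+ 2 by rewrite ltr_pwDl// sqr_ge0.
have p2 : 0 < 1 + t ^+ 2 by rewrite ltr_pwDl// sqr_ge0.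
have -> : 3 * h * t * (C / (1 + (t ^+ 2) ^+ 2)) * (2 * t) =
  6 * C * h * (t ^+ 2 / (1 + (t ^+ 2) ^+ 2)) by field; rewrite gt_eqF.
have -> : 12 * C * h * (1 + t ^+ 2)^-1 = 6 * C * h * (2 / (1 + t ^+ 2)).
  by field; rewrite gt_eqF.
rewrite ler_wpM2l ?mulr_ge0 ?(ltW h0)//.
rewrite ler_pdivrMr// mulrAC ler_pdivlMr//.
have := sqr_ge0 (t ^+ 2); have := sqr_ge0 (t ^+ 2 - 1).
by rewrite !expr2; lra.
Qed.

Hypothesis fR : forall t : R, 0 <= t -> normc (f t%:C) <= C / (1 + t ^+ 2).
Hypothesis fI : forall t : R, 0 <= t -> normc (f ('i * t%:C)) <= C / (1 + t ^+ 2).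

(** The integrals of [f] along the two half-axes bounding the quadrant agree. *)
Lemma quadrant_rotation (e : R) : 0 < e -> exists T0 : R, forall T, T0 <= T ->
  normc (P T%:C - P ('i * T%:C)) <= e.
Proof.
move=> e0; have [[f' Df] [B B0 HB]] := ef.
pose h := e / (4 * (48 * C + 1)).
have C1 : 0 < 48 * C + 1 by rewrite ltr_wpDl// mulr_ge0.
have h0 : 0 < h by rewrite divr_gt0// mulr_gt0.
have hC : 48 * C * h <= e / 4.
  rewrite /h (_ : 48 * C * (e / (4 * (48 * C + 1))) = (e / 4) * (48 * C / (48 * C + 1))).
    by rewrite ler_piMr ?divr_ge0 ?ltW// ltr_pdivrMr// mul1r ltrDl.
  by field; rewrite gt_eqF.
have [g' Dg] := exp_entire_fsqr h.
have [Q DQ] := primitive (fun z => ex_intro _ _ (Dg z)).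
pose s2 : R := Num.sqrt 2.
have s20 : 0 < s2 by rewrite sqrtr_gt0.
have s22 : s2 ^+ 2 = 2 by rewrite sqr_sqrtr.
pose u : R[i] := (s2^-1)%:C * (1 + 'i).
have s2C : (s2^-1)%:C ^+ 2 = 2^-1 :> R[i].
  by rewrite -rmorphXn exprVn s22 fmorphV rmorph_nat.
have u2 : u ^+ 2 = 'i.
  rewrite /u exprMn s2C sqrrD expr1n (expr2 'i) i_sqr mul1r.
  by field.
have nu : normc u = 1.
  apply/eqP; rewrite -(@eqrXn2 _ 2) ?normc_ge0// expr1n -normcX u2.
  by rewrite normci.
have ru3 : complex.Re ((2 * 'i - 1) * u ^+ 3) <= 0.
  rewrite exprSr u2 /u.
  have -> : (2 * 'i - 1) * ('i * ((s2^-1)%:C * (1 + 'i))) =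
    (s2^-1)%:C * ((2 * ('i * 'i) - 'i) * (1 + 'i)) :> R[i] by ring.
  have -> : (2 * ('i * 'i) - 'i) * (1 + 'i) = - 2 - 'i * 'i + 'i * (- 3%:R) + 2 * ('i * 'i + 1) * (1 + 'i) :> R[i].
    by ring.
  rewrite i_sqr Re_realM mulr_ge0_le0 ?invr_ge0 ?ltW//.
  by rewrite !(Re_add,Re_mul,Re_opp,Im_add,Im_mul,Im_opp)/=; lra.
have r1 : complex.Re ((2 * 'i - 1) * (1 : R[i]) ^+ 3) <= 0.
  by rewrite expr1n mulr1 !(Re_add,Re_mul,Re_opp)/=; lra.
have ray1 := @ray h Q 1 h0 DQ (normc1 R) r1.
have ray2 := @ray h Q u h0 DQ nu ru3.
have {ray1}ray1 (r : R) : 0 <= r -> normc (Q r%:C - P ((r ^+ 2)%:C) - (Q 0 - P 0)) <= 24 * C * h.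
  rewrite rmorphXn; have := @ray1 _ r; rewrite mulr1; apply => t t0.
  by rewrite expr1n mul1r fR.
have {ray2}ray2 (r : R) : 0 <= r -> normc (Q (r%:C * u) - P ('i * (r ^+ 2)%:C) - (Q 0 - P 0)) <= 24 * C * h.
  have -> : 'i * (r ^+ 2)%:C = (r%:C * u) ^+ 2 by rewrite exprMn u2 rmorphXn mulrC.
  by apply: ray2 => t t0; rewrite u2 fI.
pose X0 := 1 + (4 * B + 1) / h ^+ 3 + 4 * B * 27 * 4 / e + C * 4 / e.
have h3 : 0 < h ^+ 3 by rewrite exprn_gt0.
have q1 : 0 <= (4 * B + 1) / h ^+ 3.
  by rewrite divr_ge0 ?(ltW h3)// addr_ge0// mulr_ge0.
have q2 : 0 <= 4 * B * 27 * 4 / e by rewrite !mulr_ge0// invr_ge0 ltW.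
have q3 : 0 <= C * 4 / e by rewrite !mulr_ge0// invr_ge0 ltW.
exists (X0 ^+ 2) => T XT; pose X := Num.sqrt T.
have T0 : 0 <= T by rewrite (le_trans _ XT)// sqr_ge0.
have X2 : X ^+ 2 = T by rewrite sqr_sqrtr.
have XX : X0 <= X by rewrite -[X0]ger0_norm -?sqrtr_sqr ?ler_wsqrtr// /X0; lra.
have X1 : 1 <= X by move: XX; rewrite /X0; lra.
have Xp : 0 < X by lra.
(* the third side of the triangle 0, X, X + iX, where the damping prevails *)
have side : normc (Q (cpt X X) - Q (cpt X 0)) <= e / 4.
  pose k y := Q (cpt X y).
  have Dk y : Rderiv k y (2 * (cpt X y) * f ((cpt X y) ^+ 2) * damp h (cpt X y) * 'i).
    by apply: gderiv_comp; [exact: DQ|exact: Rderiv_cpty].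
  have := mean_value_cst (ltW Xp) (fun t _ => Dk t) (M := 4 * B * X * expR (- X)).
  rewrite subr0 => H; apply: (le_trans (H _)); last first.
    have -> : 4 * B * X * expR (- X) * X = 4 * B * (X ^+ 2 * expR (- X)) by ring.
    rewrite (le_trans (ler_wpM2l _ (exp_sqr_decay Xp))) ?mulr_ge0//.
    rewrite mulrA ler_pdivrMr//.
    have XB : 4 * B * 27 * 4 / e <= X by move: XX; rewrite /X0; lra.
    move: XB; rewrite ler_pdivrMr//; lra.
  move=> y /andP[y0 yX].
  rewrite normcM normci mulr1 normcM (normcM (2 * _)) (normcM 2).
  have -> : normc (2 : R[i]) = 2.
    by have := @normc_real R 2; rewrite rmorph_nat ger0_norm.
  have nX : normc (cpt X y) <= 2 * X.
    rewrite (le_trans (normcD _ _))// normcM normci mul1r !normc_real.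
    by rewrite !ger0_norm//; lra.
  apply: (@le_trans _ _ (2 * (2 * X) * (B * expR (B * (2 * X) ^+ 2)) * expR (- (h ^+ 3 * X ^+ 3)))).
    rewrite ler_pM ?mulr_ge0 ?normc_ge0//.
      rewrite ler_pM ?mulr_ge0 ?normc_ge0//; first by rewrite ler_pM2l.
      rewrite (le_trans (HB _))// ler_wpM2l// ler_expR ler_wpM2l// normcX.
      by rewrite lerXn2r ?nnegrE ?normc_ge0 ?mulr_ge0 ?(ltW Xp).
    rewrite /damp normc_cexp ler_expR Re_realM -mulrN ler_pM2l//.
    (* minus this real part is at least X ^+ 3, as 0 <= y <= X *)
    have -> : complex.Re ((2 * 'i - 1) * cpt X y ^+ 3) =
        - (X ^+ 3 - 3 * X * y ^+ 2 + 6 * X ^+ 2 * y - 2 * y ^+ 3).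
      rewrite /cpt !exprS expr0 !(Re_mul,Im_mul,Re_add,Im_add,Re_opp,Im_opp) /=; ring.
    rewrite lerN2.
    have yy : y ^+ 2 <= X * y by rewrite expr2 ler_wpM2r.
    have h1 : X * y ^+ 2 <= X ^+ 2 * y by rewrite [X ^+ 2]expr2 -mulrA ler_pM2l.
    have h2 : y ^+ 3 <= X ^+ 2 * y.
      rewrite exprS (le_trans (ler_wpM2l y0 yy))// mulrCA mulrA.
      by rewrite [X ^+ 2]expr2 -!mulrA ler_pM2l// ler_pM.
    have : 0 <= X ^+ 2 * y by rewrite mulr_ge0// sqr_ge0.
    have : 0 <= y ^+ 3 by rewrite exprn_ge0.
    lra.
  have -> : 2 * (2 * X) * (B * expR (B * (2 * X) ^+ 2)) * expR (- (h ^+ 3 * X ^+ 3)) =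
      4 * B * X * expR (B * (2 * X) ^+ 2 - h ^+ 3 * X ^+ 3) by rewrite expRD; ring.
  rewrite ler_wpM2l ?mulr_ge0 ?(ltW Xp)// ler_expR.
  have XB : (4 * B + 1) <= X * h ^+ 3.
    by rewrite -ler_pdivrMr//; move: XX; rewrite /X0; lra.
  have : (4 * B + 1) * X ^+ 2 <= X * h ^+ 3 * X ^+ 2.
    by rewrite ler_wpM2r ?sqr_ge0.
  have : X <= X ^+ 2 by rewrite expr2 ler_peMr// ltW.
  rewrite !expr2 !exprS !expr0; lra.
(* the vertex X + iX lies over 2iT; back from there to iT *)
have tail : normc (P ('i * (2 * T)%:C) - P ('i * T%:C)) <= e / 4.
  have DI t : Rderiv (fun t => P ('i * t%:C)) t (f ('i * t%:C) * 'i).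
    apply: gderiv_comp; first exact: DP.
    by apply: gderiv_eq (gderivZ _ (Rderiv_id t)) _; rewrite mulr1.
  have TT : T <= 2 * T by lra.
  have := mean_value_cst TT (fun t _ => DI t) (M := C / (1 + T ^+ 2)).
  move=> H; apply: (le_trans (H _)) => [t /andP[Tt _]|].
    have t0 : 0 <= t by lra.
    rewrite normcM normci mulr1 (le_trans (fI t0))// ler_wpM2l//.
    rewrite lef_pV2 ?posrE ?ltr_wpDr ?sqr_ge0// lerD2l lerXn2r//.
  have T1 : 1 <= T by rewrite -X2 expr_ge1// ltW.
  have TX : X <= T by rewrite -X2 expr2 ler_peMr// ltW.
  have CT : C * 4 / e <= T by rewrite (le_trans _ TX)//; move: XX; rewrite /X0; lra.
  move: CT; rewrite ler_pdivrMr// => CT.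
  rewrite mulrAC ler_pdivrMr ?ltr_wpDr ?sqr_ge0//.
  have : C * 4 * T <= T * e * T by rewrite ler_wpM2r.
  rewrite expr2; lra.
have Xu : cpt X X = (s2 * X)%:C * u.
  rewrite /u /cpt; have -> : (s2 * X)%:C * ((s2^-1)%:C * (1 + 'i)) = (s2 * X * s2^-1)%:C * (1 + 'i).
    by rewrite [RHS]mulrC -mulrA mulrC !rmorphM; ring.
  rewrite mulrAC divff ?gt_eqF// mul1r; ring.
have := ray1 X (ltW Xp); have := ray2 (s2 * X) (mulr_ge0 (ltW s20) (ltW Xp)).
rewrite -Xu exprMn s22 X2 => E2 E1.
have cX0 : cpt X 0 = X%:C by rewrite /cpt mulr0 addr0.
rewrite cX0 in side.
set a1 := (X in normc X <= 24 * C * h) in E1.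
set a2 := (X in normc X <= 24 * C * h) in E2.
set a3 := (X in normc X <= _) in side; set a4 := (X in normc X <= _) in tail.
have -> : P T%:C - P ('i * T%:C) = a2 - a1 - a3 + a4.
  by rewrite /a1 /a2 /a3 /a4; ring.
have := normcD (a2 - a1 - a3) a4; have := normcB (a2 - a1) a3; have := normcB a2 a1.
lra.
Qed.

End quadrant.

(** A form of the residue theorem: an entire function of exponential growth that
    decays like the inverse square on the boundary of the two upper quadrants has
    integral zero over the real line. *)
Lemma upper_half_plane_integral (f P : R[i] -> R[i]) (C : R) : 0 <= C ->
  exp_entire f -> (forall z, Cderiv P z (f z)) ->
  (forall t : R, normc (f t%:C) <= C / (1 + t ^+ 2)) ->
  (forall t : R, 0 <= t -> normc (f ('i * t%:C)) <= C / (1 + t ^+ 2)) ->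
  forall e : R, 0 < e -> exists T0 : R, forall T, T0 <= T ->
  normc (P T%:C - P (- T%:C)) <= e.
Proof.
move=> C0 ef DP fR fI e e0.
have e2 : 0 < e / 2 by rewrite divr_gt0.
have [T1 H1] := quadrant_rotation C0 ef DP (fun t _ => fR t) fI e2.
pose f2 z := 'i * f ('i * z); pose P2 z := P ('i * z).
have ii z : 'i * ('i * z) = - z :> R[i] by rewrite mulrA i_sqr mulN1r.
have ef2 : exp_entire f2.
  apply: exp_entireM; first exact: exp_entire_cst.
  by have := exp_entire_lin 'i 0 ef; under eq_fun do rewrite addr0.
have DP2 z : Cderiv P2 z (f2 z).
  have D : Cderiv (fun z => 'i * z) z 'i.
    by apply: gderiv_eq (gderivZ _ (Cderiv_id z)) _; rewrite mulr1.
  by have := gderiv_comp (DP _) D; rewrite mulrC.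
have [||T2 H2] := quadrant_rotation C0 ef2 DP2 _ _ e2.
- by move=> t t0; rewrite normcM normci mul1r fI.
- move=> t t0; rewrite normcM normci mul1r ii.
  by have := fR (- t); rewrite rmorphN sqrrN.
exists (Num.max T1 T2) => T; rewrite ge_max => /andP[/H1 h1 /H2 h2].
rewrite /P2 ii in h2.
have -> : P T%:C - P (- T%:C) = (P T%:C - P ('i * T%:C)) + (P ('i * T%:C) - P (- T%:C)).
  by ring.
have := normcD (P T%:C - P ('i * T%:C)) (P ('i * T%:C) - P (- T%:C)); lra.
Qed.

End Rotation.

(** * A reproducing inequality for the derivative *)

Section Reproducing.
Context {R : realType}.

Lemma exp_entire_divide2 (h : R[i] -> R[i]) : exp_entire h -> h 0 = 0 ->
  Cderiv h 0 0 -> exists2 f, exp_entire f & forall z, h z = z ^+ 2 * f z.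
Proof.
move=> eh h0 D0; have [[h' Dh] _] := eh.
have [g [eg hg g0]] := exp_entire_divide eh Dh h0.
have [[g' Dg] _] := eg.
have g00 : g 0 = 0 by rewrite g0 (Cderiv_unique (Dh 0) D0).
have [f [ef gf _]] := exp_entire_divide eg Dg g00.
by exists f => // z; rewrite hg gf mulrA.
Qed.

Lemma Cderiv_cexpZ (c z : R[i]) : Cderiv (fun z => cexp (c * z)) z (c * cexp (c * z)).
Proof.
have D : Cderiv (fun z => c * z) z c.
  by apply: gderiv_eq (gderivZ _ (Cderiv_id z)) _; rewrite mulr1.
by have := gderiv_comp (Cderiv_cexp _) D; rewrite mulrC.
Qed.

Lemma normc_cexp_iR (s t : R) : normc (cexp ('i * s%:C * t%:C)) = 1.
Proof.
rewrite normc_cexp -mulrA -rmorphM mulrC Re_realM /=.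
by rewrite mulr0 expR0.
Qed.

Lemma cexp_i (t : R) : cexp ('i * t%:C) = circ t.
Proof.
have Re_i : complex.Re ('i%R : R[i]) = 0 by [].
have Im_i : complex.Im ('i%R : R[i]) = 1 by [].
rewrite /cexp Re_mul Im_mul Re_i Im_i /= !(mul0r, mulr0, mul1r, subr0, add0r).
by rewrite expR0 mul1r.
Qed.

Lemma Re_iMi (s y : R) : complex.Re ('i * s%:C * ('i * y%:C)) = - (s * y).
Proof.
have -> : 'i * s%:C * ('i * y%:C) = (- (s * y))%:C.
  rewrite rmorphN rmorphM -[RHS]mulN1r -[in RHS]i_sqr; ring.
by [].
Qed.

(** [f] is what remains of [G z * cexp (i s z) * (1 - i s z)] after removal of
    its Taylor polynomial at 0; its integral over the line vanishes because the
    exponential makes it decay in the upper half-plane. *)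
Lemma upper_part (G G' : R[i] -> R[i]) (C tau s : R) :
  exp_entire G -> (forall z, Cderiv G z (G' z)) -> 0 <= tau -> s = tau + 1 ->
  (forall t : R, normc (G t%:C) <= C / (1 + `|t|)) ->
  (forall y : R, 0 <= y -> normc (G ('i * y%:C)) <= C * expR (tau * y)) ->
  exists f P : R[i] -> R[i], [/\
    forall z, z ^+ 2 * f z = G z * cexp ('i * s%:C * z) * (1 - 'i * s%:C * z)
      - G 0 + 'i * G' 0 * (cexp ('i * z) - 1),
    forall z, Cderiv P z (f z) &
    forall e : R, 0 < e -> exists T0 : R, forall T, T0 <= T ->
      normc (P T%:C - P (- T%:C)) <= e].
Proof.
move=> eG DG t0 sE GR GI.
have s1 : 1 <= s by lra.
have s0 : 0 <= s by lra.
have C0 : 0 <= C by have := GR 0; rewrite normr0 addr0 divr1; exact: le_trans (normc_ge0 _).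
pose h z := G z * cexp ('i * s%:C * z) * (1 - 'i * s%:C * z)
      - G 0 + 'i * G' 0 * (cexp ('i * z) - 1).
have eh : exp_entire h.
  apply: exp_entireD.
    apply: exp_entireD; last exact: exp_entire_cst.
    apply: exp_entireM; first by apply: exp_entireM => //; exact: exp_entire_cexp.
    have := exp_entire_lin (- ('i * s%:C)) 1 (@exp_entire_id R).
    by under eq_fun do rewrite mulNr addrC.
  apply: exp_entireM; first exact: exp_entire_cst.
  by apply: exp_entireD; [exact: exp_entire_cexp|exact: exp_entire_cst].
have h0 : h 0 = 0 by rewrite /h !mulr0 cexp0; ring.
have Dh0 : Cderiv h 0 0.
  have D1 := gderivM (DG 0) (Cderiv_cexpZ ('i * s%:C) 0).
  have D2 : Cderiv (fun z => 1 - 'i * s%:C * z) 0 (0 - 'i * s%:C * 1).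
    by apply: gderivB; [exact: gderiv_cst|apply: gderivZ; exact: Cderiv_id].
  have D3 := gderivB (gderivM D1 D2) (gderiv_cst id (G 0) 0).
  have D4 := gderivB (Cderiv_cexpZ 'i 0) (gderiv_cst id 1 0).
  have D := gderivD D3 (gderivZ ('i * G' 0) D4).
  apply: gderiv_eq D _; rewrite !mulr0 cexp0 !mulr1 !subr0.
  transitivity (G' 0 * (1 + 'i * 'i)); first by ring.
  by rewrite i_sqr subrr mulr0.
have [f ef hf] := exp_entire_divide2 eh h0 Dh0.
have [P DP] : exists P, forall z, Cderiv P z (f z).
  by have [[f' Df] _] := ef; apply: primitive => z; exists (f' z).
exists f, P; split; [by move=> z; rewrite -hf|exact: DP|].
have [M HM] : exists M : R, forall z, normc z <= 1 -> normc (f z) <= M.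
  by have [[f' Df] _] := ef; exact: bounded_disc (Ccontinuous_deriv Df).
pose K := C * (1 + s) + normc (G 0) + 2 * normc (G' 0).
have tailE z : normc (cexp ('i * z)) <= 1 ->
    normc (G z * cexp ('i * s%:C * z) * (1 - 'i * s%:C * z)) <= C * (1 + s) ->
    normc (h z) <= K.
  move=> e1 e2; rewrite /h /K (le_trans (normcD _ _))// lerD//.
    by rewrite (le_trans (normcB _ _))// lerD2r.
  rewrite !normcM normci mul1r mulrC ler_wpM2r ?normc_ge0//.
  by rewrite (le_trans (normcB _ _))// normc1; lra.
have K0 : 0 <= K by rewrite !addr_ge0 ?mulr_ge0 ?normc_ge0//; lra.
have M0 : 0 <= M by rewrite (le_trans _ (HM 0 _))// ?normc0 ?normc_ge0.
have bnd z (r : R) : normc z = `|r| -> normc (h z) <= K ->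
    normc (f z) <= (2 * (M + K)) / (1 + r ^+ 2).
  move=> nz hK; rewrite ler_pdivlMr ?ltr_wpDr ?sqr_ge0//.
  have r2 : r ^+ 2 = normc z ^+ 2 by rewrite nz real_normK// num_real.
  have fK : r ^+ 2 * normc (f z) <= K by rewrite r2 -normcX -normcM -hf.
  have [z1|z1] := leP (normc z) 1; first by have := HM z z1; rewrite mulrDr mulr1 mulrC; lra.
  have : 1 * normc (f z) <= r ^+ 2 * normc (f z).
    by rewrite ler_wpM2r ?normc_ge0// r2 expr_ge1 ?normc_ge0// ltW.
  by rewrite mulrDr mulr1 [_ * r ^+ 2]mulrC; lra.
have MK0 : 0 <= 2 * (M + K) by apply: mulr_ge0 => //; exact: addr_ge0.
apply: (upper_half_plane_integral MK0 ef DP).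
- move=> t; apply: bnd; first by rewrite normc_real.
  apply: tailE; first by have := normc_cexp_iR 1 t; rewrite rmorph1 mulr1 => ->.
  rewrite normcM normcM normc_cexp_iR mulr1.
  rewrite (le_trans (ler_wpM2r (normc_ge0 _) (GR t)))//.
  rewrite mulrAC ler_pdivrMr ?ltr_wpDr//.
  have -> : C * (1 + s) * (1 + `|t|) = C * ((1 + s) * (1 + `|t|)) by ring.
  rewrite ler_wpM2l//.
  rewrite (le_trans (normcB _ _))// normc1 !normcM normci mul1r !normc_real.
  have := normr_ge0 t; rewrite (ger0_norm s0) => t1.
  rewrite mulrDr mulr1 mulrDl mul1r; lra.
- move=> y y0; apply: bnd; first by rewrite normcM normci mul1r normc_real.
  apply: tailE.
    have := Re_iMi 1 y; rewrite rmorph1 mulr1 mul1r normc_cexp => ->.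
    by rewrite -expR0 ler_expR oppr_le0.
  rewrite normcM normcM normc_cexp Re_iMi.
  have -> : normc (1 - 'i * s%:C * ('i * y%:C)) = 1 + s * y.
    have -> : 1 - 'i * s%:C * ('i * y%:C) = (1 + s * y)%:C.
      have -> : 'i * s%:C * ('i * y%:C) = ('i * 'i) * (s%:C * y%:C) by ring.
      by rewrite i_sqr mulN1r opprK rmorphD rmorphM rmorph1.
    by rewrite normc_real ger0_norm// addr_ge0// mulr_ge0.
  have sy : 0 <= 1 + s * y by rewrite addr_ge0// mulr_ge0.
  apply: (@le_trans _ _ (C * expR (tau * y) * expR (- (s * y)) * (1 + s * y))).
    by rewrite ler_wpM2r// ler_wpM2r ?expR_ge0// GI.
  rewrite -!mulrA ler_wpM2l// mulrA -expRD sE.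
  have -> : tau * y + - ((tau + 1) * y) = - y by ring.
  rewrite expRN mulrC ler_pdivrMr ?expR_gt0// -sE.
  have := expR_ge1Dx y => ey.
  have : s * (1 + y) <= s * expR y by rewrite ler_wpM2l.
  by rewrite mulrDl mul1r; lra.
Qed.

(** The entire function [sin z / z]. *)
Lemma sinc_exists : exists S S' : R[i] -> R[i], [/\ exp_entire S,
  (forall z, Cderiv S z (S' z)), S 0 = 1, S' 0 = 0 &
  exists2 C : R, 0 <= C & (forall t : R, normc (S t%:C) <= C / (1 + `|t|)) /\
    (forall y : R, normc (S ('i * y%:C)) <= C * expR `|y|)].
Proof.
pose c : R[i] := (2 * 'i)^-1.
pose h (z : R[i]) := c * (cexp ('i * z) - cexp (- 'i * z)).
have i0 : 'i%R != 0 :> R[i] by rewrite -normc_gt0 normci.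
have n2 : normc (2 : R[i]) = 2.
  by have := @normc_real R 2; rewrite rmorph_nat ger0_norm.
have eh : exp_entire h.
  apply: exp_entireM; first exact: exp_entire_cst.
  apply: exp_entireD; first exact: exp_entire_cexp.
  exact/exp_entireN/exp_entire_cexp.
have [[h' Dh] _] := eh.
have h0 : h 0 = 0 by rewrite /h !mulr0 subrr mulr0.
have Dh0 : Cderiv h 0 1.
  have := gderivZ c (gderivB (Cderiv_cexpZ 'i 0) (Cderiv_cexpZ (- 'i) 0)).
  move=> D; apply: gderiv_eq D _; rewrite !mulr0 cexp0 !mulr1 /c.
  by field.
have h'0 := Cderiv_unique (Dh 0) Dh0.
have [S [eS hS S0]] := exp_entire_divide eh Dh h0.
have [[S' DS] _] := eS.
have even z : S (- z) = S z.
  have [->|z0] := eqVneq z 0; first by rewrite oppr0.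
  have E : h (- z) = - h z by rewrite /h !mulNr !mulrN opprK; ring.
  apply: (mulfI z0); apply: oppr_inj; rewrite -mulNr -hS -hS.
  exact: E.
exists S, S'; split => //; first by rewrite S0.
  have D : Cderiv (fun z => S (- z)) 0 (- S' 0).
    have D1 := gderivN (Cderiv_id (0 : R[i])).
    have DS0 : Cderiv S (- 0) (S' 0) by rewrite oppr0.
    by have := gderiv_comp DS0 D1; rewrite mulrN1.
  have D' : Cderiv S 0 (- S' 0) by apply: gderiv_ext D => z; rewrite even.
  have := Cderiv_unique (DS 0) D' => /eqP.
  by rewrite -addr_eq0 -mulr2n mulrn_eq0 => /eqP.
have [M HM] := bounded_disc 1 (Ccontinuous_deriv DS).
have M0 : 0 <= M by rewrite (le_trans _ (HM 0 _))// ?normc0 ?normc_ge0.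
have nc : normc c = 2^-1 by rewrite /c normcV normcM normci mulr1 n2.
exists (2 * M + 2); first lra.
split=> [t|y].
  rewrite ler_pdivlMr ?ltr_wpDr// mulrDr mulr1.
  have ht : `|t| * normc (S t%:C) <= 1.
    rewrite -normc_real -normcM -hS /h normcM nc mulrC ler_pdivrMr// mul1r.
    have e1 := normc_cexp_iR 1 t; have e2 := normc_cexp_iR (-1) t.
    rewrite rmorph1 mulr1 in e1; rewrite rmorphN1 mulrN1 in e2.
    by rewrite (le_trans (normcB _ _))// e1 e2; lra.
  have [t1|t1] := leP `|t| 1.
    have := HM t%:C; rewrite normc_real => /(_ t1).
    by rewrite [_ * `|t|]mulrC; lra.
  have : 1 * normc (S t%:C) <= `|t| * normc (S t%:C).
    by rewrite ler_wpM2r ?normc_ge0// ltW.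
  by rewrite [_ * `|t|]mulrC; lra.
have Ey : 1 <= expR `|y| by rewrite -expR0 ler_expR.
have [y1|y1] := leP `|y| 1.
  apply: (@le_trans _ _ (2 * M + 2)).
    by have := HM ('i * y%:C); rewrite normcM normci mul1r normc_real => /(_ y1); lra.
  by rewrite ler_peMr//; lra.
apply: (@le_trans _ _ (normc (h ('i * y%:C)))).
  by rewrite hS normcM normcM normci mul1r normc_real ler_peMl ?normc_ge0// ltW.
rewrite /h normcM nc.
have e1 := Re_iMi 1 y; have e2 := Re_iMi (-1) y.
rewrite rmorph1 mulr1 mul1r in e1; rewrite rmorphN1 mulrN1 mulN1r opprK in e2.
have E1 : normc (cexp ('i * ('i * y%:C))) <= expR `|y|.
  by rewrite normc_cexp e1 ler_expR (le_trans (ler_norm _))// normrN.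
have E2 : normc (cexp (- 'i * ('i * y%:C))) <= expR `|y|.
  by rewrite normc_cexp e2 ler_expR ler_norm.
have := normcB (cexp ('i * ('i * y%:C))) (cexp (- 'i * ('i * y%:C))).
have := expR_ge0 `|y|; have := mulr_ge0 M0 (expR_ge0 `|y|).
by rewrite mulrDl -mulrA; lra.
Qed.

Lemma normc_dist_le (z w : R[i]) : `|normc z - normc w| <= normc (z - w).
Proof.
have := normcD (z - w) w; have := normcD (w - z) z; rewrite !subrK (normc_distC w z).
by move=> h1 h2; rewrite ler_norml; apply/andP; split; lra.
Qed.

Lemma continuous_normc_entire (F F' : R[i] -> R[i]) :
  (forall z, Cderiv F z (F' z)) -> continuous (fun t : R => normc (F t%:C)).
Proof.
move=> DF; apply: (@Rcontinuous_approx R (fun t : R => F t%:C)).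
  by apply: Rcontinuous_deriv => t; exact: Rderiv_Cderiv (DF _).
by move=> s t; exact: normc_dist_le.
Qed.

Lemma continuous_weight (n : nat) : continuous (fun t : R => (1 + `|t|) ^- n).
Proof.
move=> t; have p0 (u : R) : 0 < 1 + `|u| by rewrite ltr_wpDr.
apply: cvgV; first by rewrite gt_eqF// exprn_gt0.
have : (fun u : R => 1 + `|u|) @ t --> 1 + `|t|.
  by apply: cvgD; [exact: cvg_cst|exact: cvg_norm].
elim: n => [|n IH] H; first by under eq_cvg do rewrite expr0; exact: cvg_cst.
by under eq_cvg do rewrite exprS; rewrite exprS; apply: cvgM => //; exact: IH.
Qed.

Lemma cos1_lt1 : cos (1 : R) < 1.
Proof.
have p2 := pi_ge2 R.
by rewrite -[ltRHS]cos0 ltr_cos ?in_itv/=//; apply/andP; split; lra.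
Qed.

Lemma cos_le_cos1 (t : R) : 1 <= t <= 2 -> cos t <= cos 1.
Proof.
move=> /andP[t1 t2]; have p2 := pi_ge2 R.
move: t1; rewrite le_eqVlt => /predU1P[<-//|t1].
by rewrite ltW// ltr_cos// in_itv/=; apply/andP; split; lra.
Qed.

(** The derivative at 0 of an entire function of exponential type and of
    polynomial growth on the line is controlled by a weighted mean. In the proof,
    [k2 t = k t / t ^ 2] is bounded on the line and [phi], whose integral over the
    line is zero, satisfies
    [t ^ 2 * phi t = G t * k t - i * F' 0 * (2 - 2 * cos t)]. *)
Lemma bernstein_at0 (n : nat) (tau0 : R) : 0 <= tau0 -> exists2 C : R, 0 < C &
  forall F F' : R[i] -> R[i], exp_entire F -> (forall z, Cderiv F z (F' z)) ->
  (exists B : R, forall y : R, normc (F ('i * y%:C)) <= B * expR (tau0 * `|y|)) ->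
  (exists B : R, forall t : R, normc (F t%:C) <= B * (1 + `|t|) ^+ n) ->
  ((normc (F' 0))%:E <= C%:E *
    \int[lebesgue_measure]_t (normc (F t%:C) * (1 + `|t|) ^- n.+1)%:E)%E.
Proof.
move=> tau00.
have [S [S' [eS DS S0 S'0 [CS CS0 [SR SI]]]]] := sinc_exists.
pose tau := tau0 + n.+1%:R; pose s := tau + 1.
have tau_ge0 : 0 <= tau by rewrite addr_ge0.
have s0 : 0 <= s by rewrite addr_ge0.
pose k (z : R[i]) := cexp ('i * s%:C * z) * (1 - 'i * s%:C * z) -
  cexp (- ('i * s%:C) * z) * (1 + 'i * s%:C * z).
have ek : exp_entire k.
  apply: exp_entireD.
    apply: exp_entireM; first exact: exp_entire_cexp.
    have := exp_entire_lin (- ('i * s%:C)) 1 (@exp_entire_id R).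
    by under eq_fun do rewrite mulNr addrC.
  have E1 := exp_entire_cexp (- ('i * s%:C)).
  have E2 := exp_entire_lin ('i * s%:C) 1 (@exp_entire_id R).
  have := exp_entireN (exp_entireM E1 E2).
  by under eq_fun do rewrite [_ + 1]addrC.
have k0 : k 0 = 0 by rewrite /k !mulr0 cexp0; ring.
have Dk0 : Cderiv k 0 0.
  have D2 : Cderiv (fun z => 1 - 'i * s%:C * z) 0 (0 - 'i * s%:C * 1).
    by apply: gderivB; [exact: gderiv_cst|apply: gderivZ; exact: Cderiv_id].
  have D3 : Cderiv (fun z => 1 + 'i * s%:C * z) 0 (0 + 'i * s%:C * 1).
    by apply: gderivD; [exact: gderiv_cst|apply: gderivZ; exact: Cderiv_id].
  have := gderivB (gderivM (Cderiv_cexpZ ('i * s%:C) 0) D2)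
    (gderivM (Cderiv_cexpZ (- ('i * s%:C)) 0) D3).
  by move=> D; apply: gderiv_eq D _; rewrite !mulr0 cexp0; ring.
have [k2 ek2 kk2] := exp_entire_divide2 ek k0 Dk0.
have [M HM] : exists M : R, forall z, normc z <= 1 -> normc (k2 z) <= M.
  by have [[f' Df] _] := ek2; exact: bounded_disc (Ccontinuous_deriv Df).
have M0 : 0 <= M by rewrite (le_trans _ (HM 0 _))// ?normc0 ?normc_ge0.
pose CK := M + 2 * (1 + s).
have CK0 : 0 < CK by rewrite /CK; lra.
have kR (t : R) : normc (k2 t%:C) <= CK.
  have [t1|t1] := leP `|t| 1.
    by rewrite (le_trans (HM _ _)) ?normc_real// /CK lerDl; lra.
  have tt : 0 < t ^+ 2 by rewrite -real_normK ?num_real// exprn_gt0//; lra.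
  have : t ^+ 2 * normc (k2 t%:C) <= 2 * (1 + s * `|t|).
    have -> : t ^+ 2 * normc (k2 t%:C) = normc (k t%:C).
      by rewrite kk2 normcM -rmorphXn normc_real ger0_norm// sqr_ge0.
    rewrite /k; have e1 := normc_cexp_iR s t.
    have e2 : normc (cexp (- ('i * s%:C) * t%:C)) = 1.
      by have := normc_cexp_iR (- s) t; rewrite rmorphN mulrN.
    have e3 : normc ('i * s%:C * t%:C) = s * `|t|.
      by rewrite !normcM normci mul1r !normc_real (ger0_norm s0).
    have := normcB 1 ('i * s%:C * t%:C); have := normcD 1 ('i * s%:C * t%:C).
    rewrite e3 normc1 => h1 h2.
    rewrite (le_trans (normcB _ _))// normcM e1 normcM e2 !mul1r; lra.
  move=> H; have : t ^+ 2 * normc (k2 t%:C) <= t ^+ 2 * (2 * (1 + s)).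
    apply: (le_trans H); have : `|t| <= t ^+ 2.
      by rewrite -[t ^+ 2]real_normK ?num_real// expr2 ler_peMr// ltW.
    have : 1 <= t ^+ 2 by rewrite -[t ^+ 2]real_normK ?num_real// expr_ge1// ltW.
    move=> q1 q2; have := ler_wpM2l s0 q2; lra.
  by rewrite ler_pM2l// /CK; lra.
(* a lower bound of (2 - 2 cos t) / t ^ 2 on [1, 2] *)
pose c1 : R := (2 - 2 * cos 1) / 4.
have c10 : 0 < c1 by rewrite divr_gt0//; have := cos1_lt1; lra.
pose C := CS ^+ n.+1 * CK.
have C0 : 0 <= C by rewrite mulr_ge0 ?exprn_ge0// ltW.
exists ((C + 1) / c1); first by rewrite divr_gt0// ltr_wpDl.
move=> F F' eF DF [B HB] [B' HB'].
have B0 : 0 <= B.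
  by have := HB 0; rewrite normr0 !mulr0 expR0 mulr1; exact: le_trans (normc_ge0 _).
have B'0 : 0 <= B'.
  by have := HB' 0; rewrite normr0 addr0 expr1n mulr1; exact: le_trans (normc_ge0 _).
pose G z := F z * S z ^+ n.+1.
pose G' z := F' z * S z ^+ n.+1 + F z * (n.+1%:R * S z ^+ n * S' z).
have eG : exp_entire G by apply: exp_entireM => //; exact: exp_entireX.
have DG z : Cderiv G z (G' z).
  by apply: gderivM; [exact: DF|exact: (gderivX n.+1 (DS z))].
have G'0 : G' 0 = F' 0 by rewrite /G' S0 S'0 expr1n !mulr0 addr0 mulr1.
have p0 (t : R) : 0 < 1 + `|t| by rewrite ltr_wpDr.
have GS (t : R) : normc (G t%:C) <= normc (F t%:C) * (CS ^+ n.+1 * (1 + `|t|) ^- n.+1).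
  rewrite normcM ler_wpM2l ?normc_ge0// normcX -exprVn -exprMn.
  by rewrite lerXn2r ?nnegrE ?normc_ge0 ?divr_ge0 ?(ltW (p0 _)).
have GR (t : R) : normc (G t%:C) <= B' * CS ^+ n.+1 / (1 + `|t|).
  rewrite (le_trans (GS t))//.
  rewrite (le_trans (ler_wpM2r _ (HB' t))) ?mulr_ge0 ?invr_ge0 ?exprn_ge0 ?(ltW (p0 _))//.
  rewrite [(1 + `|t|) ^+ n.+1]exprS le_eqVlt; apply/orP; left; apply/eqP.
  by field; rewrite expf_neq0 ?gt_eqF.
have GI (y : R) : normc (G ('i * y%:C)) <= B * CS ^+ n.+1 * expR (tau * `|y|).
  rewrite normcM normcX.
  have -> : B * CS ^+ n.+1 * expR (tau * `|y|) =
      (B * expR (tau0 * `|y|)) * (CS * expR `|y|) ^+ n.+1.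
    by rewrite /tau mulrDl expRD exprMn expRM_natl; ring.
  by rewrite ler_pM ?normc_ge0 ?exprn_ge0 ?normc_ge0// lerXn2r ?nnegrE ?normc_ge0 ?mulr_ge0 ?expR_ge0.
pose D := Num.max (B' * CS ^+ n.+1) (B * CS ^+ n.+1).
have GRD (t : R) : normc (G t%:C) <= D / (1 + `|t|).
  by rewrite (le_trans (GR t))// ler_wpM2r ?invr_ge0 ?(ltW (p0 _))// /D le_max lexx.
have GID (y : R) : normc (G ('i * y%:C)) <= D * expR (tau * `|y|).
  by rewrite (le_trans (GI y))// ler_wpM2r ?expR_ge0// /D le_max lexx orbT.
have GIP (y : R) : 0 <= y -> normc (G ('i * y%:C)) <= D * expR (tau * y).
  by move=> y0; have := GID y; rewrite ger0_norm.
have [f [P [fE DP PT]]] := upper_part eG DG tau_ge0 erefl GRD GIP.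
(* the lower half-plane, by reflection *)
pose H z := G (- z); pose H' z := - G' (- z).
have eH : exp_entire H.
  have := exp_entire_lin (-1) 0 eG.
  by under eq_fun do rewrite addr0 mulN1r.
have DH z : Cderiv H z (H' z).
  by have := gderiv_comp (DG (- z)) (gderivN (Cderiv_id z)); rewrite mulrN1.
have HRD (t : R) : normc (H t%:C) <= D / (1 + `|t|).
  by have := GRD (- t); rewrite rmorphN normrN.
have HID (y : R) : 0 <= y -> normc (H ('i * y%:C)) <= D * expR (tau * y).
  by move=> y0; have := GID (- y); rewrite rmorphN mulrN normrN ger0_norm.
have [g [Q [gE DQ QT]]] := upper_part eH DH tau_ge0 erefl HRD HID.
pose phi (t : R) := f t%:C - g (- t%:C).
pose Phi (t : R) := P t%:C + Q (- t%:C).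
have DPhi t : Rderiv Phi t (phi t).
  apply: gderivD; first exact: Rderiv_Cderiv (DP _).
  have := gderiv_comp (f := fun y : R => - y%:C) (DQ (- t%:C)) (gderivN (Rderiv_id t)).
  by rewrite mulrN1.
have phiE (t : R) : t%:C ^+ 2 * phi t = G t%:C * k t%:C +
    'i * F' 0 * (2 * cos t - 2)%:C.
  rewrite mulrBr fE -[t%:C ^+ 2 * g _](_ : (- t%:C) ^+ 2 * g (- t%:C) = _); last by rewrite sqrrN.
  rewrite gE /H /H' opprK oppr0 G'0 -/s.
  have -> : (2 * cos t - 2)%:C = cexp ('i * t%:C) + cexp ('i * - t%:C) - 2.
    rewrite -rmorphN !cexp_i /circ /cpt cosN sinN rmorphB rmorphM rmorphN rmorph_nat; ring.
  rewrite /k !(mulrN, mulNr) !opprK; ring.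
(* L is an antiderivative of psi - Re (u * phi), which is nonnegative and at
   least normc (F' 0) * c1 on [1, 2] *)
have [u u1 uE] := normc_rotate ('i * F' 0).
rewrite normcM normci mul1r in uE.
pose psi (t : R) := C * (normc (F t%:C) * (1 + `|t|) ^- n.+1).
have cpsi : continuous psi.
  move=> t; apply: cvgM; first exact: cvg_cst.
  apply: cvgM; first exact: continuous_normc_entire DF t.
  exact: continuous_weight.
have wF0 (t : R) : 0 <= normc (F t%:C) * (1 + `|t|) ^- n.+1.
  by apply: mulr_ge0; [exact: normc_ge0|rewrite invr_ge0 exprn_ge0// ltW].
have psi0 t : 0 <= psi t by exact: mulr_ge0.
have key (t : R) : t != 0 ->
    complex.Re (u * phi t) + normc (F' 0) * ((2 - 2 * cos t) / t ^+ 2) <= psi t.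
  move=> tn; have t2 : 0 < t ^+ 2 by rewrite exprn_even_gt0.
  rewrite -(@ler_pM2l _ (t ^+ 2))// mulrDr -Re_realM.
  have -> : (t ^+ 2)%:C * (u * phi t) = u * (G t%:C * k t%:C) +
      (2 * cos t - 2)%:C * (u * ('i * F' 0)).
    by rewrite rmorphXn mulrCA phiE; ring.
  rewrite Re_add Re_realM uE.
  have -> : complex.Re (u * (G t%:C * k t%:C)) + (2 * cos t - 2) * normc (F' 0) +
     t ^+ 2 * (normc (F' 0) * ((2 - 2 * cos t) / t ^+ 2)) =
     complex.Re (u * (G t%:C * k t%:C)) by field.
  rewrite (le_trans (Re_le_normc _))// normcM u1 mul1r (normcM (G _)) kk2.
  rewrite -rmorphXn (normcM (t ^+ 2)%:C) normc_real.
  rewrite (ger0_norm (ltW t2)) mulrCA ler_pM2l//.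
  rewrite (le_trans (ler_pM (normc_ge0 _) (normc_ge0 _) (GS t) (kR t)))//.
  by rewrite /psi /C le_eqVlt; apply/orP; left; apply/eqP; ring.
have [Psi DPsi] := antiderivative cpsi.
pose L t := Psi t - complex.Re (u * Phi t).
pose dL t := psi t - complex.Re (u * phi t).
have DL t : is_derive t (1:R) L (dL t).
  by apply: is_deriveB; exact/Rderiv_Re/gderivZ/DPhi.
have dL0 t : t != 0 -> 0 <= dL t.
  move=> tn; have := key t tn; rewrite /dL.
  have : 0 <= normc (F' 0) * ((2 - 2 * cos t) / t ^+ 2).
    rewrite mulr_ge0 ?normc_ge0// divr_ge0 ?sqr_ge0//.
  by have := cos_le1 t; lra.
have L12 : normc (F' 0) * c1 <= L 2 - L 1.
  pose L' t := L t - normc (F' 0) * c1 * t.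
  suff : L' 1 <= L' 2 by rewrite /L'; lra.
  apply: (@incr_ge0 R L' (fun t => dL t - normc (F' 0) * c1)); [lra| |].
    move=> t _; have ? := DL t; apply: is_derive_eq.
    by rewrite /GRing.scale /= mulr1.
  move=> t /andP[t1 t2]; have t0 : t != 0 by rewrite gt_eqF//; lra.
  have := key t t0; rewrite /dL.
  have : normc (F' 0) * c1 <= normc (F' 0) * ((2 - 2 * cos t) / t ^+ 2).
    rewrite ler_wpM2l ?normc_ge0// /c1.
    have ct : cos t <= cos 1 by apply: cos_le_cos1; rewrite (ltW t1) (ltW t2).
    have c1' := cos1_lt1.
    apply: ler_pM; [lra|by []|lra|].
    rewrite lef_pV2 ?posrE// ?exprn_gt0//; [|lra].
    by rewrite expr2; apply: le_trans (ler_pM _ _ (ltW t2) (ltW t2)) _; lra.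
  lra.
have Lmono a b : a <= b -> (b <= 0) || (0 <= a) -> L a <= L b.
  move=> ab ab0; apply: (@incr_ge0 R L dL a b ab) => // t /andP[at_ tb].
  apply: dL0; case/orP: ab0 => ?; [rewrite lt_eqF//|rewrite gt_eqF//]; lra.
have LT (T : R) : 2 <= T -> normc (F' 0) * c1 <= L T - L (- T).
  move=> T2.
  have h1 : L (- T) <= L 0 by apply: Lmono; [lra|rewrite lexx].
  have h2 : L 0 <= L 1 by apply: Lmono; [lra|rewrite lexx orbT].
  have h3 : L 2 <= L T by apply: Lmono; [lra|apply/orP; right; lra].
  lra.
set J := (\int[_]_t _)%E.
have J0 : (0 <= J)%E.
  by apply: integral_ge0 => t _; rewrite lee_fin.
have mpsi : measurable_fun [set: R] psi by exact: continuous_measurable_fun.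
have JE : (\int[lebesgue_measure]_t (psi t)%:E = C%:E * J)%E.
  rewrite -ge0_integralZl//.
  - apply/measurable_EFinP; apply: continuous_measurable_fun => t.
    apply: cvgM; first exact: continuous_normc_entire DF t.
    exact: continuous_weight.
  - by move=> t _; rewrite lee_fin.
have PsiT (T : R) : 0 < T -> ((Psi T - Psi (- T))%:E <= C%:E * J)%E.
  move=> T0; rewrite -JE EFinB.
  rewrite -(@continuous_FTC2 R psi Psi (- T) T); [|lra|..].
  - apply: ge0_subset_integral => //; first exact/measurable_EFinP.
    by move=> t _; rewrite lee_fin.
  - exact: continuous_subspaceT.
  - split=> [x _| |].
    + by have [] := DPsi x.
    + by apply: cvg_at_right_filter; exact: is_derive_cont (DPsi _).
    + by apply: cvg_at_left_filter; exact: is_derive_cont (DPsi _).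
  - by move=> x _; rewrite derive1E; have [_ ->] := DPsi x.
have fin e : 0 < e -> ((normc (F' 0) * c1)%:E <= C%:E * J + e%:E)%E.
  move=> e0; have e2 : 0 < e / 2 by rewrite divr_gt0.
  have [T1 HT1] := PT _ e2; have [T2 HT2] := QT _ e2.
  pose T := Num.max 2 (Num.max T1 T2).
  have T2' : 2 <= T by rewrite le_max lexx.
  have h1 : normc (P T%:C - P (- T%:C)) <= e / 2.
    by apply: HT1; rewrite !le_max lexx orbT.
  have h2 : normc (Q T%:C - Q (- T%:C)) <= e / 2.
    by apply: HT2; rewrite !le_max lexx !orbT.
  have h3 : normc (Phi T - Phi (- T)) <= e.
    have -> : Phi T - Phi (- T) = (P T%:C - P (- T%:C)) - (Q T%:C - Q (- T%:C)).
      by rewrite /Phi rmorphN opprK; ring.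
    by rewrite (le_trans (normcB _ _))//; lra.
  have h4 : - complex.Re (u * (Phi T - Phi (- T))) <= e.
    rewrite -Re_opp (le_trans (Re_le_normc _))// normc_opp normcM u1 mul1r//.
  have h5 : normc (F' 0) * c1 <= (Psi T - Psi (- T)) + e.
    have := LT T T2'; move: h4; rewrite /L mulrBr Re_add Re_opp; lra.
  apply: (@le_trans _ _ ((Psi T - Psi (- T)) + e)%:E); first by rewrite lee_fin.
  rewrite EFinD leeD2r//; apply: PsiT; lra.
have {}fin : ((normc (F' 0) * c1)%:E <= C%:E * J)%E.
  apply/lee_addgt0Pr => e e0; exact: fin.
have -> : normc (F' 0) = c1^-1 * (normc (F' 0) * c1) by field; rewrite gt_eqF.
rewrite EFinM (le_trans (lee_wpmul2l _ fin)) ?lee_fin ?invr_ge0 ?(ltW c10)//.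
rewrite muleA -EFinM lee_wpmul2r// lee_fin mulrC ler_wpM2r ?invr_ge0 ?(ltW c10)//.
by rewrite lerDl.
Qed.

(** Bernstein's inequality in pointwise form. *)
Lemma bernstein_pointwise (n : nat) (tau : R) : 0 <= tau -> exists2 C : R, 0 < C &
  forall F F' : R[i] -> R[i], (forall z, Cderiv F z (F' z)) ->
  (exists B : R, forall z, normc (F z) <= B * expR (tau * normc z)) ->
  (exists B : R, forall t : R, normc (F t%:C) <= B * (1 + `|t|) ^+ n) ->
  forall x : R, ((normc (F' x%:C))%:E <= C%:E *
    \int[lebesgue_measure]_t (normc (F (x + t)%:C) * (1 + `|t|) ^- n.+1)%:E)%E.
Proof.
move=> tau0; have [C C0 HC] := bernstein_at0 n tau0.
exists C => // F F' DF [B HB] [B' HB'] x.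
pose G z := F (z + x%:C).
have DG z : Cderiv G z (F' (z + x%:C)).
  have D : Cderiv (fun z => z + x%:C) z 1.
    by rewrite -[1]addr0; apply: gderivD; [exact: Cderiv_id|exact: gderiv_cst].
  by have := gderiv_comp (f := fun z => z + x%:C) (DF (z + x%:C)) D; rewrite mulr1.
have B0 : 0 <= B.
  by have := HB 0; rewrite normc0 mulr0 expR0 mulr1; exact: le_trans (normc_ge0 _).
have B'0 : 0 <= B'.
  by have := HB' 0; rewrite normr0 addr0 expr1n mulr1; exact: le_trans (normc_ge0 _).
have eF : exp_entire F.
  split; first by exists F'.
  exists (B + tau); first exact: addr_ge0.
  move=> z; rewrite (le_trans (HB z))// ler_pM ?expR_ge0//; first by rewrite lerDl.
  by rewrite ler_expR ler_wpM2r ?normc_ge0// lerDr.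
have eG : exp_entire G.
  by have := exp_entire_lin 1 x%:C eF; under eq_fun do rewrite mul1r.
have := HC G (fun z => F' (z + x%:C)) eG DG; rewrite add0r => HG.
have {HG} HG := HG _ _.
apply: le_trans (HG _ _) _.
- exists (B * expR (tau * `|x|)) => y; rewrite /G (le_trans (HB _))//.
  rewrite -mulrA -expRD ler_wpM2l// ler_expR -mulrDr ler_wpM2l//.
  by rewrite (le_trans (normcD _ _))// normcM normci mul1r !normc_real addrC.
- exists (B' * (1 + `|x|) ^+ n) => t; rewrite /G -rmorphD (le_trans (HB' _))//.
  rewrite -mulrA -exprMn ler_wpM2l// lerXn2r ?nnegrE ?mulr_ge0 ?addr_ge0//.
  rewrite mulrDl mul1r mulrDr mulr1.
  have := ler_normD t x; have : 0 <= `|x| * `|t| by rewrite mulr_ge0.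
  lra.
by under eq_integral do rewrite /G -rmorphD addrC.
Qed.

End Reproducing.

(** * The weight *)

Section Weight.
Context {R : realType}.
Variable nu : R.
Hypothesis nu1 : -1 < nu.

(** In the variable [u = (x / 2) ^ 2] the series of [A_] and [B_] become
    [esum 0 u] and [x / 2 * esum 1 u]. *)
Definition ecoef (j n : nat) : R :=
  (-1) ^+ n / (n`!%:R * \prod_(1 <= k < (n + j).+1) (nu + k%:R)).

Definition esum (j : nat) (u : R) : R := limn (pseries (ecoef j) u).

Lemma EtermE j x :
  Eterm j nu x = (x / 2) ^+ j *: (fun n => ecoef j n * ((x / 2) ^+ 2) ^+ n).
Proof.
apply/funext => n; rewrite /Eterm -[RHS]/(_ * _) /ecoef exprD exprM; ring.
Qed.

Lemma is_cvg_ecoef j (u : R) : cvgn (pseries (ecoef j) u).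
Proof.
have cvg_pos (v : R) : 0 < v -> cvgn (pseries (ecoef j) v).
  move=> v0; have := @is_cvg_Eterm R j nu (2 * Num.sqrt v) nu1.
  have -> : Eterm j nu (2 * Num.sqrt v) = (Num.sqrt v) ^+ j *: (fun n => ecoef j n * v ^+ n).
    by rewrite EtermE [2 * _]mulrC mulfK// sqr_sqrtr// ltW.
  move=> cE; have := is_cvg_seriesZ (k := (Num.sqrt v) ^- j) cE.
  by rewrite scalerA mulVf ?scale1r// expf_neq0// gt_eqF// sqrtr_gt0.
apply: (@is_cvg_pseries_inside _ _ (`|u| + 1)); first by apply: cvg_pos; rewrite ltr_wpDl.
by rewrite [ltRHS]ger0_norm ?addr_ge0// ltrDl.
Qed.

Lemma lim_EtermE j x : limn (series (Eterm j nu x)) = (x / 2) ^+ j * esum j ((x / 2) ^+ 2).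
Proof. by rewrite EtermE lim_seriesZ//; exact: is_cvg_ecoef. Qed.

Lemma fact_prod_neq0 n j : (n`!%:R : R) != 0 /\
  \prod_(1 <= k < (n + j).+1) (nu + k%:R) != 0 :> R.
Proof.
by split; [rewrite pnatr_eq0 -lt0n fact_gt0|rewrite gt_eqF// prod_shift_gt0].
Qed.

Lemma pseries_diffs_ecoef j : pseries_diffs (ecoef j) = - ecoef j.+1.
Proof.
apply/funext => n; rewrite /pseries_diffs /ecoef fctE /= addSnnS factS natrM exprS.
have [f0 p0] := fact_prod_neq0 n j.+1.
have n0 : (n.+1%:R : R) != 0 by rewrite pnatr_eq0.
by move: f0 p0 n0; set a := n`!%:R; set b := \prod_(_ <= _ < _) _; set c := n.+1%:R => *; field; apply/and3P.
Qed.

Lemma pseries_opp (c : nat -> R) (u : R) :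
  pseries (- c) u = series (- (fun n => c n * u ^+ n)).
Proof.
congr series; apply/funext => n.
by rewrite -[RHS]/(- (c n * u ^+ n)) -[LHS]/((- c n) * u ^+ n) mulNr.
Qed.

Lemma is_derive_esum j (u : R) : is_derive u (1:R) (esum j) (- esum j.+1 u).
Proof.
have -> : - esum j.+1 u = limn (pseries (pseries_diffs (ecoef j)) u).
  rewrite pseries_diffs_ecoef /esum pseries_opp.
  by rewrite lim_seriesN//; exact: is_cvg_ecoef.
have cvgN k (v : R) : cvgn (pseries (- ecoef k) v).
  by rewrite pseries_opp is_cvg_seriesN; exact: is_cvg_ecoef.
apply: (@pseries_snd_diffs _ _ (`|u| + 1)).
- exact: is_cvg_ecoef.
- by rewrite pseries_diffs_ecoef.
- by rewrite pseries_diffs_ecoef pseries_diffsN pseries_diffs_ecoef opprK; exact: is_cvg_ecoef.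
- by rewrite [ltRHS]ger0_norm ?addr_ge0// ltrDl.
Qed.

(** Bessel's recurrence. *)
Lemma esum_rec (u : R) : (nu + 1) * esum 1 u - u * esum 2 u = esum 0 u.
Proof.
have cs : cvgn (pseries (pseries_diffs (ecoef 1)) u).
  rewrite pseries_diffs_ecoef pseries_opp.
  by rewrite is_cvg_seriesN; exact: is_cvg_ecoef.
have E2 : limn (series (fun i => i%:R * ecoef 1 i * u ^+ i.-1)) = - esum 2 u.
  rewrite (cvg_lim _ (pseries_diffs_equiv cs))//.
  by rewrite pseries_diffs_ecoef pseries_opp lim_seriesN//; exact: is_cvg_ecoef.
have c2 := is_cvg_pseries_diffs_equiv cs.
have c1 := @is_cvg_ecoef 1 u.
rewrite -mulrN -E2 /esum.
have -> : (nu + 1) * limn (pseries (ecoef 1) u) =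
    limn (series ((nu + 1) *: (fun n => ecoef 1 n * u ^+ n))) by rewrite lim_seriesZ.
rewrite -[u * _](lim_seriesZ _ c2) -lim_seriesD; [|exact: is_cvg_seriesZ..].
congr (limn (series _)); apply/funext => n.
rewrite -[LHS]/((nu + 1) * (ecoef 1 n * u ^+ n) + u * (n%:R * ecoef 1 n * u ^+ n.-1)).
have -> : u * (n%:R * ecoef 1 n * u ^+ n.-1) = n%:R * ecoef 1 n * u ^+ n.
  by case: n => [|n]; rewrite ?mul0r ?mulr0//= exprS; ring.
rewrite -[RHS]/(ecoef 0 n * u ^+ n).
have -> : ecoef 0 n = (nu + n.+1%:R) * ecoef 1 n.
  rewrite /ecoef addn0 addn1 [in RHS]big_nat_recr//=.
  have [f0 p0] := fact_prod_neq0 n 0; rewrite addn0 in p0.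
  have n0 : nu + n.+1%:R != 0.
    have n1 : (1 : R) <= n.+1%:R by rewrite ler1n.
    have nu0 : 0 < nu + 1 by rewrite -ltrBlDr sub0r.
    by rewrite gt_eqF// (lt_le_trans nu0)// lerD2l.
  by move: f0 p0 n0; set a := n`!%:R; set b := \prod_(_ <= _ < _) _; set c := _ + _ => *; field; apply/and3P.
by rewrite -[n.+1]addn1 natrD; ring.
Qed.

(** [normc (E_ nu x) ^ 2] in the variable [u = (x / 2) ^ 2]. *)
Definition emod (u : R) : R := esum 0 u ^+ 2 + u * esum 1 u ^+ 2.

Lemma E_weightE (x : R) : E_weight nu x = (emod ((x / 2) ^+ 2))^-1.
Proof.
rewrite /E_weight; congr (_^-1).
rewrite /E_ A_real// B_real// !lim_EtermE expr0 mul1r expr1 /emod.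
set a := esum 0 _; set b := esum 1 _.
rewrite /= !(mul0r, mulr0, subr0, addr0, mul1r, sub0r, add0r).
rewrite sqr_sqrtr ?addr_ge0 ?sqr_ge0//.
by rewrite ?(oppr0, subr0, addr0) sqrrN exprMn.
Qed.

Lemma is_derive_emod (u : R) :
  is_derive u (1:R) emod (- (2 * nu + 1) * esum 1 u ^+ 2).
Proof.
have D0 := is_derive_esum 0 u; have D1 := is_derive_esum 1 u.
apply: is_derive_eq.
rewrite /GRing.scale /= -(esum_rec u); ring.
Qed.

Lemma emod_ge0 (u : R) : 0 <= u -> 0 <= emod u.
Proof. by move=> u0; rewrite addr_ge0 ?sqr_ge0// mulr_ge0 ?sqr_ge0. Qed.

Lemma emod0 : emod 0 = 1.
Proof.
rewrite /emod mul0r addr0 /esum.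
suff -> : pseries (ecoef 0) 0 = (fun n => (n > 0)%N%:R).
  have -> : limn (fun n => (n > 0)%N%:R : R) = 1; last by rewrite expr1n.
  apply: cvg_lim => //; apply/cvgrPdist_le => e e0.
  by exists 1%N => // -[|n]//= _; rewrite subrr normr0 ltW.
apply/funext => -[|n]; rewrite /pseries /series /=; first by rewrite big_geq.
rewrite big_nat_recl//= big1 ?addr0 => [|i _]; last by rewrite exprS mul0r mulr0.
by rewrite /ecoef expr0 fact0 addn0 big_geq// mulr1 divr1 mulr1.
Qed.

Lemma is_derive_expn (f : R -> R) (u df : R) n : is_derive u (1:R) f df ->
  is_derive u (1:R) (fun v => f v ^+ n) (n%:R * f u ^+ n.-1 * df).
Proof.
move=> D; have := is_deriveX n D.
by rewrite (_ : f ^+ n = (fun v => f v ^+ n))//; apply/funext => v; rewrite exprfctE.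
Qed.

(** [u] times the logarithmic derivative of [emod] is bounded, so that [emod]
    grows and decays at most polynomially. *)
Lemma emod_growth : exists N : nat, forall s t : R, 0 < s <= t ->
  s ^+ N * emod s <= t ^+ N * emod t /\ emod t * s ^+ N <= emod s * t ^+ N.
Proof.
pose N := (Num.truncn `|2 * nu + 1|).+1.
have cN : `|2 * nu + 1| <= N%:R.
  by have /andP[_ /ltW] := truncn_itv (normr_ge0 (2 * nu + 1)).
have bound (u : R) : 0 < u ->
    `|u * (- (2 * nu + 1) * esum 1 u ^+ 2)| <= N%:R * emod u.
  have ub : 0 < u -> 0 <= u * esum 1 u ^+ 2.
    by move=> u0; apply: mulr_ge0; [exact: ltW|exact: sqr_ge0].
  move=> u0; rewrite mulrCA normrM normrN; apply: ler_pM => //.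
  by rewrite (ger0_norm (ub u0)) /emod lerDr sqr_ge0.
exists N; move=> s t /andP[s0 st]; split.
  apply: (@incr_ge0 R (fun u => u ^+ N * emod u) (fun u =>
    u ^+ N * (- (2 * nu + 1) * esum 1 u ^+ 2) + emod u * (N%:R * u ^+ N.-1))) => //.
    move=> u _; have D := is_derive_emod u.
    have := is_deriveM (is_derive_expn N (is_derive_id u 1)) D.
    by rewrite /GRing.scale /= mulr1.
  move=> u /andP[su _]; have u0 : 0 < u by lra.
  have := bound u u0; rewrite ler_norml => /andP[h _].
  have -> : u ^+ N * (- (2 * nu + 1) * esum 1 u ^+ 2) + emod u * (N%:R * u ^+ N.-1) =
    u ^+ N.-1 * (N%:R * emod u + u * (- (2 * nu + 1) * esum 1 u ^+ 2)).
    by rewrite /N /= exprS; ring.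
  by rewrite mulr_ge0 ?exprn_ge0 ?(ltW u0)//; lra.
have := @incr_ge0 R (fun u => - (emod u * u^-1 ^+ N)) (fun u =>
    - (emod u * (N%:R * u^-1 ^+ N.-1 * (- u ^- 2)) + u^-1 ^+ N * (- (2 * nu + 1) * esum 1 u ^+ 2))) s t st.
have t0 : 0 < t by lra.
move=> H; suff : emod t * t^-1 ^+ N <= emod s * s^-1 ^+ N.
  rewrite !exprVn ler_pdivrMr ?exprn_gt0// mulrAC ler_pdivlMr ?exprn_gt0//.
rewrite -lerN2; apply: H.
  move=> u /andP[su _]; have u0 : u != 0 by rewrite gt_eqF//; lra.
  have D := is_derive_emod u; have D2 := @is_deriveV R id u 1 1 u0 (is_derive_id u 1).
  have D3 := is_deriveN (is_deriveM D (is_derive_expn N D2)).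
  apply: is_derive_eq D3 _.
  by rewrite /GRing.scale /= !mulr1; ring.
move=> u /andP[su _]; have u0 : 0 < u by lra.
have := bound u u0; rewrite ler_norml => /andP[_ h].
have -> : - (emod u * (N%:R * u^-1 ^+ N.-1 * (- u ^- 2)) + u^-1 ^+ N * (- (2 * nu + 1) * esum 1 u ^+ 2)) =
  u^-1 ^+ N.-1 * u^-1 ^+ 2 * (N%:R * emod u - u * (- (2 * nu + 1) * esum 1 u ^+ 2)).
  have -> : u^-1 ^+ N = u^-1 ^+ N.-1 * u^-1 by rewrite /N exprSr.
  by move: (u^-1 ^+ N.-1) => E; field; rewrite gt_eqF.
by rewrite mulr_ge0 ?mulr_ge0 ?exprn_ge0 ?invr_ge0 ?(ltW u0)//; lra.
Qed.

(** By [emod_growth] a zero at [u] would propagate to all smaller arguments, but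
    [emod] is continuous with [emod 0 = 1]. *)
Lemma emod_gt0 (u : R) : 0 <= u -> 0 < emod u.
Proof.
have [N HN] := emod_growth.
rewrite le_eqVlt => /predU1P[<-|u0]; first by rewrite emod0.
rewrite lt_neqAle emod_ge0 ?ltW// andbT; apply/eqP => E.
have Z (s : R) : 0 < s <= u -> emod s = 0.
  move=> /[dup] /andP[s0 _] /HN[+ _]; rewrite -E mulr0.
  rewrite pmulr_rle0 ?exprn_gt0// => h.
  by apply/eqP; rewrite eq_le h emod_ge0// ltW.
have /is_derive_cont c0 := is_derive_emod 0.
have /cvgrPdist_lt /(_ _ (divr_gt0 ltr01 (ltr0Sn R 1)))[d /= d0 Hd] := c0.
pose s := Num.min (d / 2) u.
have s0 : 0 < s by rewrite lt_min divr_gt0.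
have := Hd s; rewrite /ball /= sub0r normrN gtr0_norm// emod0.
have sd : s < d by rewrite gt_min; apply/orP; left; lra.
move=> /(_ sd); rewrite Z; last by rewrite s0 ge_min lexx orbT.
by rewrite subr0 normr1; lra.
Qed.

(** The comparison near 0, where a power of [u] is of no use, rests on
    compactness; hence the truncation at 1. *)
Lemma emod_compare : exists (K : R) (N : nat), 0 < K /\ forall (s t r : R),
  0 <= s -> 0 <= t -> 1 <= r ->
  Num.max s 1 <= r * Num.max t 1 -> Num.max t 1 <= r * Num.max s 1 ->
  emod s <= K * r ^+ N * emod t.
Proof.
have [N HN] := emod_growth.
have ce : {within `[0, 1]%classic, continuous emod}.
  by apply: continuous_subspaceT => u; exact: is_derive_cont (is_derive_emod u).
have [a a01 Ha] := EVT_max ler01 ce; have [b b01 Hb] := EVT_min ler01 ce.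
have b0 : 0 < emod b by apply: emod_gt0; move: b01; rewrite in_itv/= => /andP[].
have a0 : 0 < emod a by apply: emod_gt0; move: a01; rewrite in_itv/= => /andP[].
pose k := emod a / emod b.
have k1 : 1 <= k by rewrite ler_pdivlMr// mul1r; exact: Ha.
have unit_int (s t : R) : 0 <= s <= 1 -> 0 <= t <= 1 -> emod s <= k * emod t.
  move=> s01 t01; rewrite /k mulrAC ler_pdivlMr//; apply: ler_pM.
  - by apply: emod_ge0; case/andP: s01.
  - exact: ltW.
  - exact: Ha.
  - exact: Hb.
have clamp (s : R) : 0 <= s -> emod s <= k * emod (Num.max s 1) /\
    emod (Num.max s 1) <= k * emod s.
  move=> s0; have [s1|s1] := leP s 1.
    by split; apply: unit_int; rewrite ?s0 ?s1 ?ler01 ?lexx.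
  by split; rewrite ler_peMl// ltW// emod_gt0// ltW//; lra.
exists (k * k), N; split; first by rewrite mulr_gt0//; lra.
move=> s t r s0 t0 r1; have [c1 _] := clamp s s0; have [_ c2] := clamp t t0.
move: c1 c2; set m := Num.max s 1; set n := Num.max t 1 => c1 c2 h1 h2.
have m1 : 1 <= m by rewrite le_max lexx orbT.
have n1 : 1 <= n by rewrite le_max lexx orbT.
have m0 : 0 < m by lra.
have n0 : 0 < n by lra.
have mid : emod m <= r ^+ N * emod n.
  have [mn|nm] := leP m n.
    have [|H _] := HN m n; first by rewrite m0.
    rewrite -(@ler_pM2l _ (m ^+ N)) ?exprn_gt0// (le_trans H)// mulrA -exprMn.
    apply: ler_wpM2r; first exact/ltW/emod_gt0/ltW.
    by rewrite lerXn2r ?nnegrE ?mulr_ge0 ?(ltW m0) ?(ltW n0)//; [lra|rewrite mulrC].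
  have [|_ H] := HN n m; first by rewrite n0 ltW.
  rewrite -(@ler_pM2r _ (n ^+ N)) ?exprn_gt0// (le_trans H)// mulrC mulrAC -exprMn.
  apply: ler_wpM2r; first exact/ltW/emod_gt0/ltW.
  by rewrite lerXn2r ?nnegrE ?mulr_ge0 ?(ltW m0) ?(ltW n0)//; lra.
have k0 : 0 <= k by lra.
have -> : k * k * r ^+ N * emod t = k * (r ^+ N * (k * emod t)) by ring.
apply: (le_trans c1); apply: ler_wpM2l => //.
apply: (le_trans mid); apply: ler_wpM2l => //.
by rewrite exprn_ge0//; lra.
Qed.

Lemma E_weight_gt0 (x : R) : 0 < E_weight nu x.
Proof. by rewrite E_weightE invr_gt0 emod_gt0// sqr_ge0. Qed.

(** The weight varies at most polynomially. *)
Lemma E_weight_compare : exists (K : R) (L : nat), 0 < K /\ forall x y : R,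
  E_weight nu x <= K * (1 + `|x - y|) ^+ L * E_weight nu y.
Proof.
have [K [N [K0 H]]] := emod_compare.
exists K, (2 * N)%N; split => // x y.
have dist (a b : R) : Num.max ((a / 2) ^+ 2) 1 <= (1 + `|a - b|) ^+ 2 * Num.max ((b / 2) ^+ 2) 1.
  have p0 := normr_ge0 (a - b).
  have r1 : 1 <= (1 + `|a - b|) ^+ 2 by rewrite expr_ge1 ?addr_ge0// lerDl.
  have m1 : 1 <= Num.max ((b / 2) ^+ 2) 1 by rewrite le_max lexx orbT.
  rewrite ge_max; apply/andP; split; last first.
    by rewrite (le_trans r1)// ler_peMr//; lra.
  pose m := Num.max `|b / 2| 1.
  have mE : m ^+ 2 <= Num.max ((b / 2) ^+ 2) 1.
    rewrite /m /Num.max; case: ifPn => _; rewrite ?expr1n ?le_max ?lexx ?orbT//.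
    by rewrite real_normK ?num_real// lexx.
  rewrite (@le_trans _ _ ((1 + `|a - b|) ^+ 2 * m ^+ 2))//; last first.
    by rewrite ler_wpM2l ?sqr_ge0.
  rewrite -exprMn -[(a / 2) ^+ 2]real_normK ?num_real//.
  have m1' : 1 <= m by rewrite le_max lexx orbT.
  have bm : `|b / 2| <= m by rewrite le_max lexx.
  rewrite lerXn2r ?nnegrE ?mulr_ge0 ?addr_ge0//; first lra.
  have -> : a / 2 = b / 2 + (a - b) / 2 by field.
  rewrite (le_trans (ler_normD _ _))// [`|(a - b) / 2|]normrM (ger0_norm (_ : 0 <= 2^-1))//.
  have : `|a - b| * 1 <= `|a - b| * m by rewrite ler_wpM2l.
  rewrite mulrDl mul1r; lra.
rewrite !E_weightE ler_pdivlMr ?emod_gt0 ?sqr_ge0// mulrC ler_pdivrMr ?emod_gt0 ?sqr_ge0//.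
rewrite exprM; apply: H.
- exact: sqr_ge0.
- exact: sqr_ge0.
- by rewrite expr_ge1 ?addr_ge0// lerDl.
- by rewrite distrC; exact: dist.
- exact: dist.
Qed.

End Weight.

(** * Weighted integral inequalities *)

Section Integration.
Context {R : realType}.
Local Notation mu := (@lebesgue_measure R).

Lemma integral_translate (g : R -> R) (c : R) : continuous g ->
  (forall x, 0 <= g x) ->
  (\int[mu]_x (g (x + c))%:E = \int[mu]_x (g x)%:E)%E.
Proof.
move=> cg g0.
have D x : is_derive x (1:R) (fun x : R => x + c) 1.
  by apply: is_derive_eq; rewrite addr0.
have E : derive1 (fun x : R => x + c) = cst 1.
  by apply/funext => x; rewrite derive1E; have [_ ->] := D x.
rewrite [RHS](@increasing_ge0_integration_by_substitutionT R (fun x => x + c) g)//.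
- by apply: eq_integral => x _; rewrite E /= mulr1.
- by move=> x y xy; rewrite ltrD2r.
- by rewrite E => x; exact: cvg_cst.
- by rewrite E; apply: is_cvg_cst.
- by rewrite E; apply: is_cvg_cst.
- by apply/cvgrNyPle => A; near=> x; rewrite -lerBrDr; near: x; apply: nbhs_ninfty_le; rewrite num_real.
- by apply/cvgryPge => A; near=> x; rewrite -lerBlDr; near: x; apply: nbhs_pinfty_ge; rewrite num_real.
Unshelve. all: by end_near.
Qed.

Lemma continuous_oneDsqr_inv : continuous (fun x : R => (1 + x ^+ 2)^-1).
Proof.
move=> x; apply: cvgV; first by rewrite gt_eqF// ltr_pwDl// sqr_ge0.
by apply: cvgD; [exact: cvg_cst|exact: exprn_continuous].
Qed.

Lemma integralT_oneDsqr_inv : (\int[mu]_x ((1 + x ^+ 2)^-1)%:E = pi%:E)%E.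
Proof.
rewrite (ge0_symfun_integralT (f := fun x : R => (1 + x ^+ 2)^-1)).
- rewrite -set_itvcy.
  have := @integral0y_oneDsqr R; rewrite /oneDsqr => ->.
  by rewrite -EFinM mulrCA divff ?mulr1.
- by move=> x; rewrite invr_ge0 addr_ge0// sqr_ge0.
- exact: continuous_oneDsqr_inv.
- by move=> x /=; rewrite sqrrN.
Qed.

Lemma le_oneDabs_sqr (u : R) : 1 + u ^+ 2 <= (1 + `|u|) ^+ 2.
Proof.
have := normr_ge0 u; have : `|u| ^+ 2 = u ^+ 2 by rewrite real_normK// num_real.
by rewrite sqrrD expr1n mul1r => -> u0; lra.
Qed.

Lemma le_weight_oneDsqr (u : R) : (1 + `|u|) ^- 2 <= (1 + u ^+ 2)^-1.
Proof.
rewrite lef_pV2 ?posrE ?exprn_gt0 ?ltr_wpDr ?sqr_ge0//.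
exact: le_oneDabs_sqr.
Qed.

Lemma powR_ge_base (a p : R) : 0 <= a -> 1 <= p -> a <= 1 + a `^ p.
Proof.
move=> a0 p1; have [a1|a1] := leP a 1; first by rewrite (le_trans a1)// lerDl powR_ge0.
by rewrite (le_trans (_ : a <= a `^ p)) ?lerDr// -[leLHS]powRr1// ler_powR// ltW.
Qed.

Section density.
Variables (nu : R) (nu1 : -1 < nu).
Local Notation w := (E_weight nu).

Let w0 x : 0 <= w x. Proof. by rewrite ltW// E_weight_gt0. Qed.

Let mw : measurable_fun [set: R] w. Proof. exact: measurable_E_weight. Qed.

Import HBNNSimple.

Lemma E_measure_nnsfun (h : {nnsfun (measurableTypeR R) >-> R}) :
  (\int[E_measure nu1]_x (h x)%:E = \int[mu]_x ((h x)%:E * (w x)%:E))%E.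
Proof.
under [LHS]eq_integral do rewrite fimfunE -fsumEFin//.
rewrite [LHS]ge0_integral_fsum//; last 2 first.
  - by move=> r; exact/measurable_EFinP/measurableT_comp.
  - by move=> n x _; rewrite EFinM nnfun_muleindic_ge0.
under [RHS]eq_integral.
  move=> x xD; rewrite fimfunE -fsumEFin// ge0_mule_fsuml; last first.
    by move=> r; rewrite EFinM nnfun_muleindic_ge0.
  over.
rewrite [RHS]ge0_integral_fsum//; last 2 first.
  - move=> r; apply: emeasurable_funM; last exact/measurable_EFinP.
    by apply/measurable_EFinP; apply/measurableT_comp.
  - move=> n x _; apply: mule_ge0; last by rewrite lee_fin.
    by rewrite EFinM nnfun_muleindic_ge0.
apply: eq_fsbigr => r _.
rewrite integralZl_indic_nnsfun// integral_indic// setIT.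
have [r0|r0] := ltP r 0.
  rewrite preimage_nnfun0//= /E_measure integral_set0 mule0 integral0_eq//.
  by move=> x _; rewrite indic0 mulr0 mul0e.
under [RHS]eq_integral do rewrite EFinM -muleA.
rewrite ge0_integralZl//; last 2 first.
  - apply: emeasurable_funM; last exact/measurable_EFinP.
    by apply/measurable_EFinP; exact: measurable_indic.
  - by move=> x _; rewrite mule_ge0 ?lee_fin.
congr (_ * _)%E.
transitivity (\int[mu]_(x in h @^-1` [set r]) (w x)%:E)%E; first by [].
rewrite [LHS]integral_mkcond; apply: eq_integral => x _; rewrite patchE indicE.
by case: ifPn => _; rewrite ?mul1e ?mul0e.
Qed.

(** Integration against [E_measure] is integration against its density. *)
Lemma integral_E_measure (f : R -> \bar R) : measurable_fun [set: R] f ->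
  (forall x, 0 <= f x)%E ->
  (\int[E_measure nu1]_x f x = \int[mu]_x (f x * (w x)%:E))%E.
Proof.
move=> mf f0; pose f_ := @nnsfun_approx _ (measurableTypeR R) R setT measurableT f mf.
have mf_ n : measurable_fun [set: measurableTypeR R] (f_ n).
  exact: measurable_funPT.
have nd (x : measurableTypeR R) a b : (a <= b)%N -> f_ a x <= f_ b x.
  move=> ab; have /lefP := @nd_nnsfun_approx _ (measurableTypeR R) R setT measurableT f mf a b ab.
  exact.
transitivity (limn (fun n => \int[E_measure nu1]_x (f_ n x)%:E)%E).
  rewrite -monotone_convergence//=.
  - apply: eq_integral => x _; apply/esym/cvg_lim => //=.
    exact: cvg_nnsfun_approx.
  - by move=> n; apply/measurable_EFinP; exact: mf_.
  - by move=> n x _; rewrite lee_fin.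
  - by move=> x _ a b ab; rewrite lee_fin; exact: nd.
transitivity (limn (fun n => \int[mu]_x ((f_ n x)%:E * (w x)%:E))%E).
  congr (lim (_ @ \oo)); apply/funext => n.
  exact: E_measure_nnsfun.
rewrite -monotone_convergence//=.
- apply: eq_integral => x _; apply/cvg_lim => //=.
  apply: cvgeZr => //.
  by apply: cvg_nnsfun_approx => // t _; exact: f0.
- move=> n; apply: emeasurable_funM; last exact/measurable_EFinP.
  by apply/measurable_EFinP; exact: mf_.
- by move=> n x _; rewrite mule_ge0 ?lee_fin.
- move=> x _ a b ab; rewrite lee_wpmul2r ?lee_fin//; exact: nd.
Qed.

(** As the weight is positive, almost everywhere bounds of continuous functions
    hold everywhere. *)
Lemma E_measure_ae_le (f : R -> R) (M : R) : continuous f ->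
  {ae E_measure nu1, forall x, f x <= M} -> forall x, f x <= M.
Proof.
move=> cf [A [mA A0 fA]] x0; rewrite leNgt; apply/negP => Mf.
have [K [L [K0 HK]]] := E_weight_compare nu1.
have /cvgrPdist_lt /(_ (f x0 - M)) := cf x0.
rewrite subr_gt0 => /(_ Mf) [d /= d0 Hd].
pose I := `[x0 - d / 2, x0 + d / 2]%classic.
have IA : I `<=` A.
  move=> x; rewrite /I /= in_itv /= => /andP[x1 x2]; apply: fA => /= fxM.
  have : ball x0 d x by rewrite /ball /= ltr_norml; apply/andP; split; lra.
  by move=> /Hd; rewrite ltr_norml => /andP[_]; lra.
have EI : (E_measure nu1 I <= 0)%E.
  by rewrite -A0; apply: le_measure => //; rewrite inE; [exact: measurable_itv|exact: mA].
pose c := w x0 / (K * (1 + d) ^+ L).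
have cd : 0 < K * (1 + d) ^+ L by rewrite mulr_gt0// exprn_gt0// addr_gt0.
have c0 : 0 < c by rewrite divr_gt0// E_weight_gt0.
have : (c%:E * d%:E <= E_measure nu1 I)%E.
  have -> : (c%:E * d%:E = \int[mu]_(x in I) (cst c%:E x))%E.
    have Im : mu [set` `[(x0 - d / 2)%R, (x0 + d / 2)%R]] = d%:E.
      rewrite lebesgue_measure_itv /= lte_fin ltrD2l.
      have -> : (- (d / 2) < d / 2) by lra.
      by rewrite -EFinB; congr (_%:E)%E; field.
    rewrite integral_cst; last exact: measurable_itv.
    by congr (_ * _)%E; exact/esym/Im.
  apply: ge0_le_integral; first exact: measurable_itv.
  - by move=> x _; rewrite lee_fin ltW.
  - exact: measurable_cst.
  - by apply/measurable_EFinP; exact: measurable_funTS.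
  - move=> x; rewrite /I /= in_itv /= => /andP[x1 x2].
    rewrite lee_fin /c ler_pdivrMr// (le_trans (HK x0 x))// mulrC ler_wpM2l ?w0//.
    rewrite ler_pM2l// lerXn2r ?nnegrE ?addr_ge0 ?(ltW d0)//. rewrite lerD2l.
    by rewrite ler_norml; apply/andP; split; lra.
move=> /le_trans /(_ EI); rewrite -EFinM lee_fin leNgt mulr_gt0//.
Qed.

End density.

(** If [g] is dominated by the convolution of [f] with a kernel decaying faster
    than the weight can vary, then [g] inherits weighted [p]-integrability. *)
Lemma weighted_Lp_bound (w : R -> R) (K C p : R) (L : nat) (f g : R -> R) :
  measurable_fun [set: R] w -> (forall x, 0 <= w x) -> 0 < K -> 0 < C -> 1 <= p ->
  (forall x y, w x <= K * (1 + `|x - y|) ^+ L * w y) ->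
  continuous f -> (forall x, 0 <= f x) ->
  measurable_fun [set: R] g -> (forall x, 0 <= g x) ->
  (forall x, ((g x)%:E <= C%:E *
    \int[mu]_s (f s * (1 + `|s - x|) ^- L.+2)%:E)%E) ->
  (\int[mu]_x ((f x `^ p)%:E * (w x)%:E) < +oo)%E ->
  (\int[mu]_x ((g x `^ p)%:E * (w x)%:E) < +oo)%E.
Proof.
move=> mw w0 K0 C0 p1 wc cf f0 mg g0 H If.
have pi0 : 0 < pi :> R by exact: pi_gt0.
have q0 (u : R) : 0 <= (1 + u ^+ 2)^-1 by rewrite invr_ge0 addr_ge0// sqr_ge0.
have k0 (n : nat) (u : R) : 0 <= (1 + `|u|) ^- n by rewrite invr_ge0 exprn_ge0// addr_ge0.
have kq (u : R) : (1 + `|u|) ^- L.+2 <= (1 + u ^+ 2)^-1.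
  apply: le_trans (le_weight_oneDsqr u).
  have p0 : 0 < 1 + `|u| by rewrite ltr_wpDr.
  rewrite lef_pV2 ?posrE ?exprn_gt0// ler_weXn2l// lerDl//.
have ck n x : continuous (fun s : R => (1 + `|s - x|) ^- n).
  move=> s; apply: (@continuous_comp _ _ _ (fun s => s - x) (fun u => (1 + `|u|) ^- n)).
    by apply: cvgB; [exact: cvg_id|exact: cvg_cst].
  exact: continuous_weight.
have cq x : continuous (fun s : R => (1 + (s - x) ^+ 2)^-1).
  move=> s; apply: (@continuous_comp _ _ _ (fun s => s - x) (fun u => (1 + u ^+ 2)^-1)).
    by apply: cvgB; [exact: cvg_id|exact: cvg_cst].
  exact: continuous_oneDsqr_inv.
have mf : measurable_fun [set: R] f by exact: continuous_measurable_fun.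
have mfp : measurable_fun [set: R] (fun s => f s `^ p).
  exact: measurableT_comp (measurable_powR p) mf.
have mk n x : measurable_fun [set: R] (fun s : R => (1 + `|s - x|) ^- n).
  by apply: continuous_measurable_fun; exact: ck.
have mq x : measurable_fun [set: R] (fun s : R => (1 + (s - x) ^+ 2)^-1).
  by apply: continuous_measurable_fun; exact: cq.
have Iq x : (\int[mu]_s ((1 + (s - x) ^+ 2)^-1)%:E = pi%:E)%E.
  rewrite (@integral_translate (fun u => (1 + u ^+ 2)^-1) (- x))//.
    exact: integralT_oneDsqr_inv.
  exact: continuous_oneDsqr_inv.
have Ik x : (\int[mu]_s ((1 + `|s - x|) ^- L.+2)%:E <= pi%:E)%E.
  rewrite -(Iq x); apply: ge0_le_integral; first exact: measurableT.
  - by move=> s _; rewrite lee_fin.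
  - by apply/measurable_EFinP; exact: mk.
  - by apply/measurable_EFinP; exact: mq.
  - by move=> s _; rewrite lee_fin.
pose C3 := (2 * C * pi) `^ p / pi.
have C30 : 0 <= C3 by rewrite divr_ge0 ?powR_ge0// ltW.
(* Jensen's inequality, in the form f <= l * (1 + (f / l) ^ p) at the scale
   l = g x / (2 C pi), for which the constant 1 yields at most half of g x *)
have jensen x : ((g x `^ p)%:E <= C3%:E *
    \int[mu]_s (f s `^ p * (1 + `|s - x|) ^- L.+2)%:E)%E.
  set J := (\int[_]_s _)%E.
  have J0 : (0 <= J)%E.
    by apply: integral_ge0 => s _; rewrite lee_fin mulr_ge0 ?powR_ge0.
  have [gx0|gx0] := eqVneq (g x) 0.
    by rewrite gx0 powR0 ?mule_ge0 ?lee_fin// gt_eqF//; lra.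
  have gp : 0 < g x by rewrite lt_neqAle eq_sym gx0 g0.
  pose l := g x / (2 * C * pi).
  have cp0 : 0 < 2 * C * pi by rewrite !mulr_gt0.
  have l0 : 0 < l by rewrite divr_gt0.
  pose m := l^-1 `^ p.
  have m0 : 0 < m by rewrite powR_gt0// invr_gt0.
  have fl s : f s <= l * (1 + m * f s `^ p).
    have := @powR_ge_base (f s / l) p; rewrite divr_ge0 ?(ltW l0)// => /(_ isT p1).
    by rewrite powRM ?invr_ge0 ?(ltW l0)// ler_pdivrMr// [_ * l]mulrC [f s `^ p * _]mulrC.
  have : ((g x)%:E <= C%:E * (l%:E * (pi%:E + m%:E * J)))%E.
    apply: (le_trans (H x)); rewrite lee_wpmul2l ?lee_fin ?(ltW C0)//.
    apply: (@le_trans _ _ (\int[mu]_s (l%:E * (((1 + `|s - x|) ^- L.+2)%:E +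
        m%:E * (f s `^ p * (1 + `|s - x|) ^- L.+2)%:E)))%E).
      apply: ge0_le_integral; first exact: measurableT.
      - by move=> s _; rewrite lee_fin mulr_ge0.
      - by apply/measurable_EFinP; apply: measurable_funM => //; exact: mk.
      - apply: emeasurable_funM => //; apply: emeasurable_funD.
          by apply/measurable_EFinP; exact: mk.
        apply: emeasurable_funM => //; apply/measurable_EFinP.
        by apply: measurable_funM => //; exact: mk.
      - move=> s _.
        have : f s * (1 + `|s - x|) ^- L.+2 <= l * ((1 + `|s - x|) ^- L.+2 +
            m * (f s `^ p * (1 + `|s - x|) ^- L.+2)).
          have -> : l * ((1 + `|s - x|) ^- L.+2 + m * (f s `^ p * (1 + `|s - x|) ^- L.+2)) =
            l * (1 + m * f s `^ p) * (1 + `|s - x|) ^- L.+2 by ring.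
          by rewrite ler_wpM2r.
        by rewrite -lee_fin => fk; exact: fk.
    rewrite ge0_integralZl//; last 3 first.
    - apply: emeasurable_funD; first by apply/measurable_EFinP; exact: mk.
      apply: emeasurable_funM => //; apply/measurable_EFinP.
      by apply: measurable_funM => //; exact: mk.
    - move=> s _; apply: adde_ge0; first by rewrite lee_fin.
      by apply: mule_ge0; rewrite lee_fin ?(ltW m0)// mulr_ge0 ?powR_ge0.
    - by rewrite lee_fin ltW.
    rewrite lee_wpmul2l ?lee_fin ?(ltW l0)//.
    rewrite ge0_integralD//; last 3 first.
    - by apply/measurable_EFinP; exact: mk.
    - by move=> s _; apply: mule_ge0; rewrite lee_fin ?(ltW m0)// mulr_ge0 ?powR_ge0.
    - apply: emeasurable_funM => //; apply/measurable_EFinP.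
      by apply: measurable_funM => //; exact: mk.
    apply: leeD; first exact: Ik.
    rewrite ge0_integralZl//.
    - by apply/measurable_EFinP; apply: measurable_funM => //; exact: mk.
    - by move=> s _; rewrite lee_fin mulr_ge0 ?powR_ge0.
    - by rewrite lee_fin ltW.
  have -> : g x = 2 * C * pi * l by rewrite /l mulrCA divff ?mulr1// gt_eqF.
  clearbody J; case: J J0 => [j| |]//; last first.
    move=> _ _; have [C3p|C3n] := ltP 0 C3; first by rewrite gt0_muley ?lte_fin// leey.
    by move: C3n; rewrite leNgt divr_gt0// powR_gt0.
  rewrite lee_fin => j0 h0.
  have h : 2 * C * pi * l <= C * (l * (pi + m * j)) by rewrite -lee_fin; exact: h0.
  rewrite -EFinM lee_fin.
  have pj : pi <= m * j.
    have : C * l * (2 * pi) <= C * l * (pi + m * j) by lra.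
    by rewrite (ler_pM2l (mulr_gt0 C0 l0)) => ?; lra.
  have lm : l `^ p * m = 1.
    by rewrite /m -powRM ?invr_ge0 ?(ltW l0)// divff ?gt_eqF// powR1.
  rewrite powRM ?(ltW l0) ?(ltW cp0)// /C3.
  have lj : l `^ p * pi <= j.
    by rewrite -[leRHS]mul1r -lm -[leRHS]mulrA ler_wpM2l ?powR_ge0.
  have -> : (2 * C * pi) `^ p * l `^ p = (2 * C * pi) `^ p / pi * (l `^ p * pi).
    by rewrite mulrACA mulVf ?mulr1// gt_eqF.
  by rewrite ler_wpM2l.
(* the weight costs (1 + |x - s|) ^ L, which leaves an integrable kernel *)
have wq x s : w x * (1 + `|s - x|) ^- L.+2 <= K * w s * (1 + (s - x) ^+ 2)^-1.
  have p0 : 0 < 1 + `|s - x| by rewrite ltr_wpDr.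
  apply: (le_trans (ler_wpM2r (k0 _ _) (wc x s))).
  rewrite distrC.
  have -> : K * (1 + `|s - x|) ^+ L * w s * (1 + `|s - x|) ^- L.+2 =
      K * w s * (1 + `|s - x|) ^- 2.
    by rewrite -[L.+2]addn2 exprD; field; rewrite !expf_neq0// gt_eqF.
  by rewrite ler_wpM2l ?mulr_ge0 ?(ltW K0)// le_weight_oneDsqr.
pose h (z : measurableTypeR R * measurableTypeR R) : \bar R :=
  ((f z.2 `^ p * w z.2) * (1 + (z.2 - z.1) ^+ 2)^-1)%:E.
have h0 z : (0 <= h z)%E by rewrite lee_fin !mulr_ge0 ?powR_ge0.
have mh : measurable_fun [set: measurableTypeR R * measurableTypeR R] h.
  apply/measurable_EFinP; apply: measurable_funM.
    apply: measurable_funM.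
      exact: (measurableT_comp mfp measurable_snd).
    exact: (measurableT_comp mw measurable_snd).
  apply: (@measurableT_comp _ _ _ _ _ _ (fun u : R => (1 + u ^+ 2)^-1)).
    by apply: continuous_measurable_fun; exact: continuous_oneDsqr_inv.
  by apply: measurable_funB; [exact: measurable_snd|exact: measurable_fst].
have mhx x : measurable_fun [set: R] (fun s : R => h (x, s)).
  apply/measurable_EFinP; apply: measurable_funM; last exact: mq.
  exact: measurable_funM.
apply: (@le_lt_trans _ _ ((C3 * K)%:E * \int[mu]_x \int[mu]_s h (x, s))%E).
  rewrite -ge0_integralZl//; last 3 first.
  - exact: measurable_fun_fubini_tonelli_F.
  - by move=> x _; apply: integral_ge0 => s _; exact: h0.
  - by rewrite lee_fin mulr_ge0 ?(ltW K0).
  apply: ge0_le_integral; first exact: measurableT.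
  - by move=> x _; rewrite mule_ge0 ?lee_fin ?powR_ge0.
  - apply: emeasurable_funM; last exact/measurable_EFinP.
    by apply/measurable_EFinP; exact: measurableT_comp (measurable_powR p) mg.
  - apply: emeasurable_funM => //; exact: measurable_fun_fubini_tonelli_F.
  - move=> x _; apply: (le_trans (lee_wpmul2r _ (jensen x))); first by rewrite lee_fin.
    rewrite [(C3 * K)%:E]EFinM -[leLHS]muleA -[leRHS]muleA.
    apply: lee_wpmul2l; first by rewrite lee_fin.
    rewrite muleC -ge0_integralZl//; last 3 first.
    - by apply/measurable_EFinP; apply: measurable_funM => //; exact: mk.
    - by move=> s _; rewrite lee_fin mulr_ge0 ?powR_ge0.
    - by rewrite lee_fin.
    rewrite -ge0_integralZl//; last 2 first.
    - exact: mhx.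
    - by rewrite lee_fin ltW.
    apply: ge0_le_integral; first exact: measurableT.
    - by move=> s _; rewrite lee_fin mulr_ge0// mulr_ge0 ?powR_ge0.
    - apply: emeasurable_funM => //; apply/measurable_EFinP.
      by apply: measurable_funM => //; exact: mk.
    - apply: emeasurable_funM => //.
      exact: mhx.
    - move=> s _; rewrite /h /= -!EFinM lee_fin.
      rewrite mulrCA; have := ler_wpM2l (powR_ge0 (f s) p) (wq x s).
      by move=> hh; apply: (le_trans hh); rewrite le_eqVlt; apply/orP; left; apply/eqP; ring.
have CK0 : (0 <= (C3 * K)%:E)%E by rewrite lee_fin mulr_ge0// ltW.
apply: lte_mul_pinfty => //.
rewrite (_ : (\int[mu]_x \int[mu]_s h (x, s))%E = (\int[mu]_s \int[mu]_x h (x, s))%E); last exact: fubini_tonelli.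
have -> : (\int[mu]_s \int[mu]_x h (x, s) = \int[mu]_s (pi%:E * ((f s `^ p)%:E * (w s)%:E)))%E.
  apply: eq_integral => s _; rewrite /h /=.
  under eq_integral do rewrite EFinM.
  rewrite ge0_integralZl//; last 3 first.
  - apply/measurable_EFinP; have := mq s.
    by under eq_fun do rewrite -[_ ^+ 2]sqrrN opprB.
  - by move=> x _; rewrite lee_fin.
  - by rewrite lee_fin mulr_ge0 ?powR_ge0.
  under eq_integral do rewrite -[_ ^+ 2]sqrrN opprB.
  by rewrite Iq muleC EFinM.
rewrite ge0_integralZl//; last 3 first.
- by apply: emeasurable_funM; exact/measurable_EFinP.
- by move=> s _; rewrite mule_ge0 ?lee_fin ?powR_ge0.
- by rewrite lee_fin ltW.
by rewrite lte_mul_pinfty ?lee_fin// ltW.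
Qed.

End Integration.

(** * Entire functions of exponential type *)

Section ExponentialType.
Context {R : realType}.
Implicit Types (F : R[i] -> R[i]).

Lemma Cderiv_of_derivable F (z : R[i]) : derivable F z 1 ->
  exists l, Cderiv F z l.
Proof.
move=> /cvg_ex[/= l Fl].
exists l; apply: approx_gderiv => e e0.
have e0' : 0 < e%:C :> R[i] by rewrite ltcR.
move: Fl => /cvgrPdist_le /(_ _ e0').
rewrite /dnbhs near_withinE => /nbhs_ballP[d /= d0 H].
have dE : d = (complex.Re d)%:C by rewrite RRe_real// gtr0_real.
have d0' : 0 < complex.Re d by move: d0; rewrite dE ltcR.
exists (complex.Re d) => // h hd.
have [->|h0] := eqVneq h 0; first by rewrite addr0 subrr mulr0 subr0 normc0 mulr0.
have := H h; rewrite /ball /= sub0r normrN.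
have nE (w : R[i]) : `|w| = (normc w)%:C by [].
rewrite dE !nE ltcR => /(_ hd h0) E.
have {}E : (normc (l - h^-1 *: (F (h *: 1 + z) - F z)))%:C <= e%:C := E.
move: E; rewrite lecR normc_distC /GRing.scale /= mulr1 (addrC h) => E.
have -> : F (z + h) - F z - l * h = (h^-1 * (F (z + h) - F z) - l) * h.
  by field.
by rewrite normcM ler_wpM2r ?normc_ge0.
Qed.

Lemma Cderiv_cvg F (z l : R[i]) : Cderiv F z l ->
  (fun h : R[i] => h^-1 *: (F (h *: (1 : R[i]) + z) - F z)) @ (0 : R[i])^' --> l.
Proof.
move=> /gderiv_approx Fl; apply/cvgrPdist_le => e e0.
have eE : e = (complex.Re e)%:C by rewrite RRe_real// gtr0_real.
have e0' : 0 < complex.Re e by move: e0; rewrite eE ltcR.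
have [d d0 Hd] := Fl _ e0'.
rewrite /dnbhs near_withinE; apply/nbhs_ballP; exists d%:C; first by rewrite /= ltcR.
move=> h; rewrite /ball /= sub0r normrN => hd h0.
have {}hd : normc h < d by have : (normc h)%:C < d%:C := hd; rewrite ltcR.
suff : (normc (l - h^-1 * (F (h * 1 + z) - F z)))%:C <= e by [].
rewrite eE lecR normc_distC mulr1 (addrC h).
have -> : h^-1 * (F (z + h) - F z) - l = (F (z + h) - F z - l * h) / h.
  by field.
by rewrite normcM normcV ler_pdivrMr ?normc_gt0// Hd.
Qed.

Lemma derivable_of_Cderiv F (z l : R[i]) : Cderiv F z l -> derivable F z 1.
Proof. by move=> /Cderiv_cvg H; apply/cvg_ex; exists l. Qed.

Lemma derive1_of_Cderiv F (z l : R[i]) : Cderiv F z l -> derive1 F z = l.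
Proof.
move=> /Cderiv_cvg H; rewrite derive1E.
by apply: cvg_lim => //; exact: norm_hausdorff.
Qed.

Lemma entire_Cderiv F : entire F -> forall z, Cderiv F z (derive1 F z).
Proof.
move=> eF z; have [l Fl] := Cderiv_of_derivable (eF z).
by rewrite (derive1_of_Cderiv Fl).
Qed.

Lemma lne_le (r s : R) : 0 <= r -> (lne r%:E <= s%:E)%E = (r <= expR s).
Proof.
move=> r0; have [->|rn] := eqVneq r 0; first by rewrite le0_lneNy// leNye expR_ge0.
have rp : 0 < r by rewrite lt_neqAle eq_sym rn.
rewrite lne_EFin// -{2}[r]lnK ?posrE//. by rewrite ler_expR lee_fin.
Qed.

(** An exponential bound at any rate above the type, valid everywhere. *)
Lemma exp_type_bound F (delta tau : R) : 0 < delta -> delta < tau ->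
  exp_type_le delta F ->
  exists B : R, forall z, normc (F z) <= B * expR (tau * normc z).
Proof.
move=> d0 dt [eF [F0|Fsup]].
  by exists 0 => z; rewrite F0 normc0 mul0r.
have t0 : 0 < tau by exact: lt_trans dt.
have [V [r _ Vr] Vs] : exists2 V, cinfty_nbhs R V & (ereal_sup ((fun z =>
    ((normc z)^-1%:E * lne (normc (F z))%:E)%E) @` V) < tau%:E)%E.
  have : (limf_esup (fun z : R[i] => (normc z)^-1%:E * lne (normc (F z))%:E) (cinfty_nbhs R)
      < tau%:E)%E by apply: (le_lt_trans Fsup); rewrite lte_fin.
  by move=> /ereal_inf_lt[_ [V FV <-] h]; exists V.
have [M HM] := bounded_disc (Num.max r 0) (Ccontinuous_deriv (entire_Cderiv eF)).
exists (Num.max 1 M) => z.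
have e1 : 1 <= expR (tau * normc z).
  by rewrite -expR0 ler_expR mulr_ge0 ?normc_ge0// ltW.
have [zr|rz] := leP (normc z) (Num.max r 0).
  apply: (@le_trans _ _ (Num.max 1 M)); first by rewrite le_max HM ?orbT.
  by rewrite ler_peMr// le_max ler01.
apply: (@le_trans _ _ (1 * expR (tau * normc z))); last first.
  by rewrite ler_wpM2r ?expR_ge0// le_max lexx.
move: rz; rewrite gt_max => /andP[rz z0].
rewrite mul1r -lne_le ?normc_ge0//.
have : ((normc z)^-1%:E * lne (normc (F z))%:E <= tau%:E)%E.
  apply: le_trans (ltW Vs); apply: ereal_sup_ubound; exists z => //.
  exact: Vr.
move=> h; have := lee_wpmul2l (_ : 0 <= (normc z)%:E)%E h.
rewrite lee_fin normc_ge0 => /(_ isT).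
rewrite muleA -EFinM divff ?mul1e ?gt_eqF// => h2.
by apply: (le_trans h2); rewrite -EFinM lee_fin mulrC.
Qed.

(** Conversely, such a family of bounds gives the exponential type. *)
Lemma bound_exp_type F (delta : R) : 0 < delta -> entire F ->
  (forall tau, delta < tau ->
    exists B : R, forall z, normc (F z) <= B * expR (tau * normc z)) ->
  exp_type_le delta F.
Proof.
move=> d0 eF H; split => //; right.
apply/lee_addgt0Pr => e e0; rewrite -EFinD.
have [|B0 HB0] := H (delta + e / 2); first by rewrite ltrDl divr_gt0.
pose B := Num.max 1 B0.
have B1 : 1 <= B by rewrite le_max lexx.
have HB z : normc (F z) <= B * expR ((delta + e / 2) * normc z).
  by rewrite (le_trans (HB0 z))// ler_wpM2r ?expR_ge0// le_max lexx orbT.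
pose r := Num.max 1 (ln B / (e / 2)).
apply: (@le_trans _ _ (ereal_sup ((fun z =>
    ((normc z)^-1%:E * lne (normc (F z))%:E)%E) @` [set z | r < normc z]))).
  by apply: ereal_inf_lbound; exists [set z | r < normc z] => //; exists r.
apply: ub_ereal_sup => _ [z /= rz <-].
move: rz; rewrite gt_max => /andP[z1 zB].
have z0 : 0 < normc z by rewrite (lt_trans _ z1).
have : (lne (normc (F z))%:E <= ((delta + e) * normc z)%:E)%E.
  rewrite lne_le ?normc_ge0// (le_trans (HB z))//.
  rewrite -[B]lnK ?posrE ?(lt_le_trans ltr01)// -expRD ler_expR.
  move: zB; rewrite ltr_pdivrMr ?divr_gt0//; lra.
move=> h; have := lee_wpmul2l (_ : 0 <= (normc z)^-1%:E)%E h.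
rewrite lee_fin invr_ge0 normc_ge0 => /(_ isT) h2.
by apply: (le_trans h2); rewrite -EFinM lee_fin mulrC mulfK// gt_eqF.
Qed.

Lemma deriv_exp_bound F F' (tau B : R) : 0 <= tau ->
  (forall z, Cderiv F z (F' z)) ->
  (forall z, normc (F z) <= B * expR (tau * normc z)) ->
  forall z, normc (F' z) <= B * expR tau * expR (tau * normc z).
Proof.
move=> t0 DF HB z.
have B0 : 0 <= B.
  by have := HB 0; rewrite normc0 mulr0 expR0 mulr1; exact: le_trans (normc_ge0 _).
apply: (cauchy_estimate DF) => u uz; rewrite (le_trans (HB u))//.
rewrite -mulrA -expRD ler_wpM2l// ler_expR -[X in X + _]mulr1 -mulrDr ler_wpM2l//.
by rewrite -[u](subrK z) (le_trans (normcD _ _))// lerD2r.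
Qed.

Lemma exp_type_le_derive1 F (delta : R) : 0 < delta -> exp_type_le delta F ->
  exp_type_le delta (derive1 F).
Proof.
move=> d0 tF; have eF := entire_Cderiv tF.1.
have [F'' DF'] := holomorphic_deriv eF.
apply: bound_exp_type => //; first by move=> z; exact: derivable_of_Cderiv (DF' z).
move=> tau dt; have [B HB] := exp_type_bound d0 dt tF.
by exists (B * expR tau); apply: deriv_exp_bound => //; rewrite ltW// (lt_trans d0).
Qed.

(** ** Growth on the real line *)

(** Polynomial growth on the line, with the same exponent, passes to the
    derivative. *)
Lemma deriv_poly_growth F F' (tau B : R) (n : nat) : 0 <= tau ->
  (forall z, Cderiv F z (F' z)) ->
  (exists B : R, forall z, normc (F z) <= B * expR (tau * normc z)) ->
  (forall t : R, normc (F t%:C) <= B * (1 + `|t|) ^+ n) ->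
  exists B' : R, forall t : R, normc (F' t%:C) <= B' * (1 + `|t|) ^+ n.
Proof.
move=> t0 DF HE HB; have [C C0 HC] := @bernstein_pointwise R n.+1 tau t0.
have B0 : 0 <= B.
  by have := HB 0; rewrite normr0 addr0 expr1n mulr1; exact: le_trans (normc_ge0 _).
have p0 (t : R) : 0 < 1 + `|t| by rewrite ltr_wpDr.
exists (C * B * pi) => x.
have HB' : exists B : R, forall t : R, normc (F t%:C) <= B * (1 + `|t|) ^+ n.+1.
  exists B => t; rewrite (le_trans (HB t))// ler_wpM2l// ler_weXn2l// lerDl//.
rewrite -lee_fin (le_trans (HC F F' DF HE HB' x))//.
have cF : continuous (fun t : R => normc (F (x + t)%:C)).
  move=> t; apply: (@continuous_comp _ _ _ (fun t => x + t) (fun u => normc (F u%:C))).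
    by apply: cvgD; [exact: cvg_cst|exact: cvg_id].
  exact: continuous_normc_entire DF _.
have Bx0 : 0 <= B * (1 + `|x|) ^+ n by rewrite mulr_ge0// exprn_ge0// ltW.
have -> : ((C * B * pi * (1 + `|x|) ^+ n)%:E =
    C%:E * ((B * (1 + `|x|) ^+ n)%:E * pi%:E))%E.
  by rewrite -!EFinM; congr EFin; ring.
rewrite lee_wpmul2l ?lee_fin ?(ltW C0)// -integralT_oneDsqr_inv.
rewrite -ge0_integralZl//; last 2 first.
- by apply/measurable_EFinP; apply: continuous_measurable_fun; exact: continuous_oneDsqr_inv.
- by move=> t _; rewrite lee_fin invr_ge0 addr_ge0// sqr_ge0.
apply: ge0_le_integral; first exact: measurableT.
- by move=> t _; rewrite lee_fin mulr_ge0 ?normc_ge0// invr_ge0 exprn_ge0// ltW.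
- apply/measurable_EFinP; apply: measurable_funM; apply: continuous_measurable_fun => //.
  exact: continuous_weight.
- apply: emeasurable_funM => //; apply/measurable_EFinP.
  by apply: continuous_measurable_fun; exact: continuous_oneDsqr_inv.
- move=> t _; rewrite -EFinM lee_fin.
  have xt : normc (F (x + t)%:C) <= B * (1 + `|x|) ^+ n * (1 + `|t|) ^+ n.
    rewrite (le_trans (HB _))// -mulrA -exprMn ler_wpM2l//.
    rewrite lerXn2r ?nnegrE ?mulr_ge0 ?(ltW (p0 _))//.
    have := ler_normD x t; have : 0 <= `|x| * `|t| by rewrite mulr_ge0.
    rewrite mulrDl mul1r mulrDr mulr1; lra.
  rewrite (le_trans (ler_wpM2r _ xt)) ?invr_ge0 ?exprn_ge0 ?(ltW (p0 _))//.
  rewrite -[leLHS]mulrA ler_wpM2l//.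
  apply: le_trans (le_weight_oneDsqr t).
  rewrite -[n.+2]addn2 exprD invfM mulrA divff ?mul1r// expf_neq0// gt_eqF//.
Qed.

Lemma primitive_exp_bound F P (tau B : R) : 0 <= tau ->
  (forall z, Cderiv P z (F z)) ->
  (forall z, normc (F z) <= B * expR (tau * normc z)) ->
  exists B' : R, forall z, normc (P z) <= B' * expR ((tau + 1) * normc z).
Proof.
move=> t0 DP HB.
have B0 : 0 <= B.
  by have := HB 0; rewrite normc0 mulr0 expR0 mulr1; exact: le_trans (normc_ge0 _).
exists (normc (P 0) + B) => z.
pose k (t : R) := P (t%:C * z).
have Dk t : Rderiv k t (F (t%:C * z) * z).
  apply: gderiv_comp; first exact: DP.
  by have := gderivM (Rderiv_id t) (gderiv_cst (real_complex R) z t);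
    rewrite mul1r mulr0 addr0.
have : normc (k 1 - k 0) <= B * expR (tau * normc z) * normc z * (1 - 0).
  apply: (mean_value_cst ler01 (fun t _ => Dk t)) => t /andP[t1 t2].
  rewrite normcM ler_wpM2r ?normc_ge0// (le_trans (HB _))// ler_wpM2l// ler_expR.
  rewrite ler_wpM2l// normcM normc_real ger0_norm// ler_piMl ?normc_ge0//.
rewrite /k mul1r mul0r subr0 mulr1 => h.
rewrite -[P z](subrK (P 0)) (le_trans (normcD _ _))// addrC mulrDl lerD//.
  by rewrite ler_peMr ?normc_ge0// -expR0 ler_expR mulr_ge0 ?normc_ge0// addr_ge0.
apply: (le_trans h); rewrite -mulrA ler_wpM2l// mulrDl mul1r expRD ler_wpM2l ?expR_ge0//.
by have := expR_ge1Dx (normc z); lra.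
Qed.

Lemma incr_le_integral F P (a b : R) : a <= b -> (forall z, Cderiv P z (F z)) ->
  continuous (fun t : R => normc (F t%:C)) ->
  ((normc (P b%:C - P a%:C))%:E <=
    \int[lebesgue_measure]_(t in `[a, b]) (normc (F t%:C))%:E)%E.
Proof.
rewrite le_eqVlt => /predU1P[->|ab] DP cF.
  by rewrite subrr normc0 integral_ge0// => t _; rewrite lee_fin normc_ge0.
have [u Du] := antiderivative cF.
rewrite (@continuous_FTC2 R _ u a b ab).
- rewrite -EFinB lee_fin.
  apply: (@mean_value R (fun t => P t%:C) (fun t => F t%:C) u _ a b (ltW ab)
    (fun t _ => Rderiv_Cderiv (DP _)) (fun t _ => Du t)) => t _.
  exact: lexx.
- exact: continuous_subspaceT.
- split=> [x _| |].
  + by have [] := Du x.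
  + by apply: cvg_at_right_filter; exact: is_derive_cont (Du _).
  + by apply: cvg_at_left_filter; exact: is_derive_cont (Du _).
- by move=> x _; rewrite derive1E; have [_ ->] := Du x.
Qed.

(** A primitive of a weighted [p]-integrable entire function grows at most
    polynomially, since the weight decays at most polynomially. *)
Lemma primitive_poly_growth F P (nu p : R) : -1 < nu -> 1 <= p ->
  (forall z, Cderiv P z (F z)) -> continuous (fun t : R => normc (F t%:C)) ->
  (\int[lebesgue_measure]_x ((normc (F x%:C) `^ p)%:E * (E_weight nu x)%:E) < +oo)%E ->
  exists (B : R) (n : nat), forall t : R, normc (P t%:C) <= B * (1 + `|t|) ^+ n.
Proof.
move=> nu1 p1 DP cF If.
have [K [L [K0 HK]]] := E_weight_compare nu1.
have w0 := E_weight_gt0 nu1.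
have p0 (t : R) : 0 < 1 + `|t| by rewrite ltr_wpDr.
have Fw0 (t : R) : (0 <= (normc (F t%:C) `^ p)%:E * (E_weight nu t)%:E)%E.
  by apply: mule_ge0; rewrite lee_fin ?powR_ge0// ltW.
set I := (\int[_]_x _)%E in If.
have I0 : (0 <= I)%E.
  by apply: integral_ge0 => x _; exact: Fw0.
have IE : I = (fine I)%:E by rewrite fineK// ge0_fin_numE.
have fI0 : 0 <= fine I by rewrite fine_ge0.
pose c := K / E_weight nu 0.
have c0 : 0 < c by rewrite divr_gt0.
have mF : measurable_fun [set: R] (fun t : R => normc (F t%:C)).
  exact: continuous_measurable_fun.
have mFp : measurable_fun [set: R] (fun t : R => normc (F t%:C) `^ p).
  exact: measurableT_comp (measurable_powR p) mF.
have mw := measurable_E_weight nu1.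
have main (a b r : R) : a <= b -> - r <= a -> b <= r -> 0 <= r ->
    normc (P b%:C - P a%:C) <= (b - a) + c * (1 + r) ^+ L * fine I.
  move=> ab ra br r0; rewrite -lee_fin.
  apply: (le_trans (incr_le_integral ab DP cF)).
  have cr0 : 0 <= c * (1 + r) ^+ L.
    by rewrite mulr_ge0 ?(ltW c0)// exprn_ge0// addr_ge0.
  apply: (@le_trans _ _ (\int[lebesgue_measure]_(t in `[a, b])
     (cst 1 t + (c * (1 + r) ^+ L)%:E * ((normc (F t%:C) `^ p)%:E * (E_weight nu t)%:E)))%E).
    apply: ge0_le_integral; first exact: measurable_itv.
    - by move=> t _; rewrite lee_fin normc_ge0.
    - by apply/measurable_EFinP; exact: measurable_funTS.
    - apply: emeasurable_funD => //; apply: emeasurable_funM => //.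
      by apply: emeasurable_funM; apply/measurable_EFinP; exact: measurable_funTS.
    - move=> t; rewrite /= in_itv /= => /andP[at_ tb].
      rewrite -!EFinM -EFinD lee_fin (le_trans (powR_ge_base (normc_ge0 _) p1))// lerD2l.
      rewrite mulrCA ler_peMr ?powR_ge0//.
      have := HK 0 t; rewrite sub0r normrN => h.
      rewrite /c mulrAC mulrAC -mulrA mulrAC ler_pdivlMr// mul1r (le_trans h)//.
      rewrite [leRHS]mulrA ler_wpM2r ?(ltW (w0 t))// ler_pM2l//.
      rewrite lerXn2r ?nnegrE ?(ltW (p0 _)) ?addr_ge0// lerD2l.
      by rewrite ler_norml (le_trans ra at_) (le_trans tb br).
  rewrite ge0_integralD//; last 2 first.
  - by move=> t _; apply: mule_ge0; [rewrite lee_fin|exact: Fw0].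
  - apply: emeasurable_funM => //.
    by apply: emeasurable_funM; apply/measurable_EFinP; exact: measurable_funTS.
  rewrite EFinD leeD//.
    have Iab : lebesgue_measure [set` `[a, b]] = (b - a)%:E.
      rewrite lebesgue_measure_itv /= lte_fin EFinB.
      by case: ltgtP ab => // -> _; rewrite subee.
    rewrite integral_cst; last exact: measurable_itv.
    by rewrite mul1e le_eqVlt; apply/orP; left; apply/eqP/Iab.
  rewrite ge0_integralZl//; last first.
    by apply: emeasurable_funM; apply/measurable_EFinP; exact: measurable_funTS.
  rewrite [leRHS]EFinM; apply: lee_wpmul2l; first by rewrite lee_fin.
  rewrite -IE; apply: ge0_subset_integral => //.
  by apply: emeasurable_funM; exact/measurable_EFinP.
exists (normc (P 0) + 1 + c * fine I), L.+1 => t.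
have bnd : normc (P t%:C - P 0) <= `|t| + c * (1 + `|t|) ^+ L * fine I.
  have [t0|t0] := leP 0 t.
    rewrite (ger0_norm t0); have := main 0 t t t0.
    by rewrite subr0 oppr_le0; exact.
  rewrite (ltr0_norm t0); have := main t 0 (- t) (ltW t0).
  by rewrite normc_distC sub0r opprK oppr_ge0; apply; rewrite // ltW.
rewrite -[P t%:C](subrK (P 0)) (le_trans (normcD _ _))//.
have e1 : 1 <= (1 + `|t|) ^+ L.+1 by rewrite expr_ge1 ?(ltW (p0 _))// lerDl.
have e2 : (1 + `|t|) ^+ L <= (1 + `|t|) ^+ L.+1 by rewrite ler_weXn2l// lerDl.
have e3 : `|t| <= (1 + `|t|) ^+ L.+1.
  have : (1 + `|t|) ^+ 1 <= (1 + `|t|) ^+ L.+1 by rewrite ler_weXn2l// lerDl.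
  by rewrite expr1; lra.
have h1 : normc (P 0) * 1 <= normc (P 0) * (1 + `|t|) ^+ L.+1.
  by rewrite ler_wpM2l ?normc_ge0.
have h2 : c * fine I * (1 + `|t|) ^+ L <= c * fine I * (1 + `|t|) ^+ L.+1.
  by rewrite ler_wpM2l// mulr_ge0// ltW.
move: bnd h2; rewrite mulrAC !mulrDl mul1r; lra.
Qed.

(** The pointwise inequality, centred at [s = x]. *)
Lemma bernstein_pointwise_centred (n : nat) (tau : R) : 0 <= tau ->
  exists2 C : R, 0 < C & forall F F', (forall z, Cderiv F z (F' z)) ->
  (exists B : R, forall z, normc (F z) <= B * expR (tau * normc z)) ->
  (exists B : R, forall t : R, normc (F t%:C) <= B * (1 + `|t|) ^+ n) ->
  forall x : R, ((normc (F' x%:C))%:E <= C%:E *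
    \int[lebesgue_measure]_s (normc (F s%:C) * (1 + `|s - x|) ^- n.+1)%:E)%E.
Proof.
move=> t0; have [C C0 HC] := @bernstein_pointwise R n tau t0.
exists C => // F F' DF HE HB x; apply: (le_trans (HC F F' DF HE HB x)).
rewrite -(@integral_translate R (fun s => normc (F s%:C) * (1 + `|s - x|) ^- n.+1) x).
- rewrite lee_wpmul2l ?lee_fin ?(ltW C0)// le_eqVlt; apply/orP; left; apply/eqP.
  by apply: eq_integral => s _; rewrite addrK addrC.
- move=> s; apply: cvgM; first exact: continuous_normc_entire DF s.
  apply: (@continuous_comp _ _ _ (fun s => s - x) (fun u => (1 + `|u|) ^- n.+1)).
    by apply: cvgB; [exact: cvg_id|exact: cvg_cst].
  exact: continuous_weight.
- by move=> s; rewrite mulr_ge0 ?normc_ge0// invr_ge0 exprn_ge0// addr_ge0.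
Qed.

Lemma continuous_Re_entire F F' : (forall z, Cderiv F z (F' z)) ->
  continuous (fun t : R => complex.Re (F t%:C)).
Proof.
move=> DF; apply: (@Rcontinuous_approx R (fun t : R => F t%:C)).
  by apply: Rcontinuous_deriv => t; exact: Rderiv_Cderiv (DF _).
by move=> s t; rewrite -Re_opp -Re_add; exact: le_Re_normc.
Qed.

Lemma continuous_Im_entire F F' : (forall z, Cderiv F z (F' z)) ->
  continuous (fun t : R => complex.Im (F t%:C)).
Proof.
move=> DF; apply: (@Rcontinuous_approx R (fun t : R => F t%:C)).
  by apply: Rcontinuous_deriv => t; exact: Rderiv_Cderiv (DF _).
by move=> s t; rewrite -Im_opp -Im_add; exact: le_Im_normc.
Qed.

(** Finiteness of the [p]-norm as finiteness of a weighted integral. *)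
Lemma finite_norm_real (nu p : R) (nu1 : -1 < nu) (f : R -> R) : 1 <= p ->
  measurable_fun [set: R] f -> (forall x, 0 <= f x) ->
  finite_norm (E_measure nu1) p%:E f <->
  (\int[lebesgue_measure]_x ((f x `^ p)%:E * (E_weight nu x)%:E) < +oo)%E.
Proof.
move=> p1 mf f0.
rewrite /finite_norm unlock /=.
have -> : (\int[E_measure nu1]_x (`|(f x)%:E| `^ p) =
    \int[lebesgue_measure]_x ((f x `^ p)%:E * (E_weight nu x)%:E))%E.
  have -> : (\int[E_measure nu1]_x (`|(f x)%:E| `^ p) =
      \int[E_measure nu1]_x (f x `^ p)%:E)%E.
    by apply: eq_integral => x _; rewrite gee0_abs ?lee_fin.
  rewrite integral_E_measure//.
    by apply/measurable_EFinP; exact: measurableT_comp (measurable_powR p) mf.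
  by move=> x; rewrite lee_fin powR_ge0.
split; first by apply: lty_poweRy; rewrite invr_neq0// gt_eqF//; lra.
exact: poweR_lty.
Qed.

End ExponentialType.


(** * Weighted integrability of the derivative *)

Section WeightedDerivative.
Context {R : realType}.
Implicit Types (F : R[i] -> R[i]).

(** The exponent in [E_weight_compare] may be enlarged. *)
Lemma E_weight_compare_ge (nu : R) : -1 < nu -> exists (K : R) (L : nat), 0 < K /\
  forall N, (L <= N)%N -> forall x y : R,
    E_weight nu x <= K * (1 + `|x - y|) ^+ N * E_weight nu y.
Proof.
move=> nu1; have [K [L [K0 HK]]] := E_weight_compare nu1.
exists K, L; split => // N LN x y; rewrite (le_trans (HK x y))//.
rewrite ler_wpM2r ?(ltW (E_weight_gt0 nu1 y))// ler_pM2l//.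
by rewrite ler_weXn2l// lerDl.
Qed.

Lemma deriv_weighted_integrable F F' (nu tau p : R) : -1 < nu -> 0 <= tau -> 1 <= p ->
  (forall z, Cderiv F z (F' z)) ->
  (exists B : R, forall z, normc (F z) <= B * expR (tau * normc z)) ->
  (\int[lebesgue_measure]_x ((normc (F x%:C) `^ p)%:E * (E_weight nu x)%:E) < +oo)%E ->
  (\int[lebesgue_measure]_x ((normc (F' x%:C) `^ p)%:E * (E_weight nu x)%:E) < +oo)%E.
Proof.
move=> nu1 t0 p1 DF HE If.
have [F'' DF'] := holomorphic_deriv DF.
have cF := continuous_normc_entire DF.
have cF' := continuous_normc_entire DF'.
have [P DP] : exists P, forall z, Cderiv P z (F z).
  by apply: primitive => z; exists (F' z).
have [BE HBE] := HE.
have EP := primitive_exp_bound t0 DP HBE.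
have [B [n HB]] := primitive_poly_growth nu1 p1 DP cF If.
have t10 : 0 <= tau + 1 by rewrite addr_ge0.
have [B' HB'] := deriv_poly_growth t10 DP EP HB.
have B'0 : 0 <= B'.
  by have := HB' 0; rewrite normr0 addr0 expr1n mulr1; exact: le_trans (normc_ge0 _).
have [K [L [K0 HK]]] := E_weight_compare_ge nu1.
(* large enough for the growth of F and for the variation of the weight *)
pose N := maxn L n.
have [C C0 HC] := @bernstein_pointwise_centred R N.+1 tau t0.
apply: (@weighted_Lp_bound R (E_weight nu) K C p N (fun t => normc (F t%:C))) => //.
- exact: measurable_E_weight.
- by move=> x; rewrite ltW// E_weight_gt0.
- exact: HK (leq_maxl _ _).
- by move=> x; exact: normc_ge0.
- exact: continuous_measurable_fun.
- by move=> x; exact: normc_ge0.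
- apply: (HC F F' DF HE); exists B' => t; rewrite (le_trans (HB' t))// ler_wpM2l//.
  by rewrite ler_weXn2l ?lerDl// leqW// leq_maxr.
Qed.

Lemma finite_norm_infty_bound (nu : R) (nu1 : -1 < nu) (f : R -> R) : continuous f ->
  finite_norm (E_measure nu1) +oo f -> (0 < E_measure nu1 setT)%E ->
  exists M, forall x, `|f x| <= M.
Proof.
move=> cf; rewrite /finite_norm unlock /= => fin m0.
have /ess_supr_bounded[M HM] :
    (ess_sup (E_measure nu1) (EFin \o (fun x => `|f x|%R)) < +oo)%E.
  by move: fin; rewrite m0.
exists M; apply: (@E_measure_ae_le _ _ nu1 (fun x => `|f x|)) => //.
by move=> x; apply: cvg_norm; exact: cf.
Qed.

Lemma bound_finite_norm_infty (nu : R) (nu1 : -1 < nu) (f : R -> R) (M : R) :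
  (forall x, `|f x| <= M) -> finite_norm (E_measure nu1) +oo f.
Proof.
move=> fM; rewrite /finite_norm unlock /=; case: ifPn => _; last exact: ltry.
apply: (@le_lt_trans _ _ M%:E); last exact: ltry.
by apply/ess_supP; apply: nearW => x /=; rewrite lee_fin.
Qed.

End WeightedDerivative.

Theorem theorem20 (R : realType) (nu delta : R) (hnu : -1 < nu)
    (hdelta : 0 < delta) (F : R[i] -> R[i]) (p : \bar R) (hp : (1 <= p)%E) :
  exp_type_le delta F ->
  in_Lp (E_measure hnu) p (fun x => F x%:C) ->
  exp_type_le delta (derive1 F) /\
  in_Lp (E_measure hnu) p (fun x => derive1 F x%:C).
Proof.
move=> tF [mRe mIm nF].
split; first exact: exp_type_le_derive1.
have DF := entire_Cderiv tF.1.
have [F'' DF'] := holomorphic_deriv DF.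
have cF := continuous_normc_entire DF.
have cF' := continuous_normc_entire DF'.
pose tau := delta + 1.
have t0 : 0 <= tau by rewrite addr_ge0// ltW.
have HE : exists B : R, forall z, normc (F z) <= B * expR (tau * normc z).
  by apply: exp_type_bound tF => //; rewrite ltrDl.
split.
- by apply: continuous_measurable_fun; exact: continuous_Re_entire DF'.
- by apply: continuous_measurable_fun; exact: continuous_Im_entire DF'.
case: p hp nF => [p| |]; rewrite ?leeNy_eq//.
- rewrite lee_fin => p1 /finite_norm_real -/(_ p1) If.
  apply/finite_norm_real => //.
  + exact: continuous_measurable_fun.
  + by move=> x; exact: normc_ge0.
  apply: (deriv_weighted_integrable hnu t0 p1 DF HE); apply: If.
  + exact: continuous_measurable_fun.
  + by move=> x; exact: normc_ge0.
- move=> _ nF; have [m0|m0] := ltP 0%E (E_measure hnu setT); last first.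
    rewrite /finite_norm unlock /=; case: ifPn => [m1|_]; last exact: ltry.
    by have := lt_le_trans m1 m0; rewrite ltxx.
  have [M HM] := finite_norm_infty_bound cF nF m0.
  have [|B HB] := @deriv_poly_growth R F (derive1 F) tau M 0 t0 DF HE.
    by move=> t; rewrite expr0 mulr1; apply: le_trans (HM t); exact: ler_norm.
  apply: (@bound_finite_norm_infty R nu hnu _ B) => x.
  by rewrite ger0_norm ?normc_ge0//; have := HB x; rewrite expr0 mulr1.
Qed.
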